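(* Let $k\in\{0,1,2\}$ and $n\ge 1$. Let $\mathcal C$ be a (finite) disjoint union, as a multiset, of equivalence classes of the relation $\equiv^{k}$ on $\mathrm{SYT}(n)$ such that $f=\sum_{T\in\mathcal C}F_{\mathrm{ID}(T)}$ (sum with multiplicity) is a symmetric function. Then $$f=\sum_{\lambda\vdash n}c_\lambda s_\lambda,$$ where $s_\lambda$ is the Schur function and $c_\lambda$ is the multiplicity of the superstandard tableau $U_\lambda$ in $\mathcal C$.
   Context: Tableaux. Partition diagrams are in French notation: left-justified, rows numbered from bottom to top, row $r$ having $\lambda_r$ cells. $\mathrm{SYT}(\lambda)$ is the set of fillings of $\lambda\vdash n$ by $1,\dots,n$ (each used once), increasing left to right along rows and bottom to top up columns; $\mathrm{SYT}(n)=\bigcup_{\lambda\vdash n}\mathrm{SYT}(\lambda)$. $U_\lambda$ is the tableau whose bottom row is $1,\dots,\lambda_1$, whose second row is $\lambda_1+1,\dots,\lambda_1+\lambda_2$, and so on. The row reading word $\mathrm{rw}(T)$ reads each row left to right, starting with the top row and going down; cells are ordered by this reading order. For a permutation $\pi\in S_n$ in one-line notation, $\mathrm{ID}(\pi)$ is the set of $i\in[n-1]$ such that $i$ occurs to the right of $i+1$; $\mathrm{ID}(T)=\mathrm{ID}(\mathrm{rw}(T))$. For $D\subseteq[n-1]$, $F_D=\sum x_{j_1}\cdots x_{j_n}$ over $j_1\le\cdots\le j_n$ such that $j_k=j_{k+1}$ implies $k\notin D$. Runs. Write $\mathrm{ID}(T)\cup\{n\}=\{b_1<\dots<b_m\}$,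 $b_0=0$. The $r$-th run of $T$ is the set of cells with entries in $(b_{r-1},b_r]$; $\beta_r(T)=b_r-b_{r-1}$ and $\beta(T)=(\beta_1(T),\dots,\beta_m(T))$. Within a run, entries increase in reading order, so $T$ is determined by the sequence of cell sets of its runs. The first $r$ runs of $T$ form the standard Young tableau consisting of entries $\le b_r$. The maps $\mathrm{slink},\mathrm{slink}_*$ on $\mathrm{SYT}(\lambda)$. Let $j$ be minimal such that the first $j$ runs of $T$ do not form a superstandard tableau. If no such $j$ exists ($T=U_\lambda$), both maps fix $T$. Otherwise ($j\ge2$): (1) $\mathrm{slink}(T)$ has the same runs as $T$ except runs $j-1$ and $j$: among the cells of runs $j-1$ and $j$ of $T$ lying strictly below row $j$, the first $\beta_j(T)-1$ in reading order form the new $(j-1)$-th run, and the remaining ones together with the cells of run $j$ in row $j$ form the new $j$-th run. Thus $(\beta_{j-1},\beta_j)$ becomes $(\beta_j-1,\beta_{j-1}+1)$. (2) Let $\mu$ be the shape of the first $j$ runs of $T$ and let $i\ge1$ be minimal with $\mu_{i+1}\le\beta_j(T)+i-j$ (so $i\le j-1$). $\mathrm{slink}_*(T)$ has the same runs as $T$ except runs $i$ and $j$: among the cells of runs $i$ and $j$ of $T$ lying strictly below row $i+1$, the first $\beta_j(T)+i-j$ in reading order form the new $i$-th run, and the remaining ones together with the cells of run $j$ in rows $\ge i+1$ form the new $j$-th run. Thus $(\beta_i,\beta_j)$ becomes $(\beta_j+i-j,\beta_i+j-i)$. Elementary dual equivalence. $d_i$ acts on a permutation by: $\ldots i\ldots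 i-1\ldots i+1\ldots\leftrightarrow\ldots i+1\ldots i-1\ldots i\ldots$ and $\ldots i\ldots i+1\ldots i-1\ldots\leftrightarrow\ldots i-1\ldots i+1\ldots i\ldots$ (all else fixed), and as the identity if $i$ is between $i-1$ and $i+1$. It acts on $\mathrm{SYT}(\lambda)$ through $\mathrm{rw}$. For $i\in[2,n-2]$, $d_i^R(T)=T$ if $i+1\in\mathrm{ID}(T)\cap\mathrm{ID}(d_i(T))$, and $d_i^R(T)=d_i(T)$ otherwise. Relations. $\equiv^0$, $\equiv^1$, $\equiv^2$ are the equivalence relations on standard Young tableaux generated by $T\sim\mathrm{slink}_*(T)$, by $T\sim\mathrm{slink}(T)$, and by $T\sim d_i^R(T)$ for all $i\in[2,n-2]$, respectively. *)

(* Defs.v *)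
From HB Require Import structures.
From mathcomp Require Import all_boot all_order all_algebra.
From mathcomp Require Import finmap multiset.
From mathcomp.multinomials Require Import mpoly.

Set Implicit Arguments.
Unset Strict Implicit.
Unset Printing Implicit Defensive.

Import GRing.Theory.

Local Open Scope nat_scope.

(** * Partitions and standard Young tableaux

    A filling is the sequence of its rows, bottom row first (French notation).
    Rows, columns, runs and entries are all numbered from 1. *)

Definition is_part (n : nat) (la : seq nat) : bool :=
  [&& sorted geq la, 0 \notin la & sumn la == n].

(* [u] is the row immediately above [s]; the length condition on the rows of a
   diagram is imposed separately. *)
Definition col_lt (s u : seq nat) : bool :=
  all (fun c => nth 0 s c < nth 0 u c) (iota 0 (size u)).

Definition is_syt (n : nat) (T : seq (seq nat)) : bool :=
  [&& is_part n (shape T), perm_eq (flatten T) (iota 1 n),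
      all (sorted ltn) T & sorted col_lt T].

Record intpart (n : nat) :=
  IntPart { parts :> seq nat; _ : is_part n parts }.

Record syt (n : nat) :=
  Syt { rows :> seq (seq nat); _ : is_syt n rows }.

HB.instance Definition _ n := [isSub for @parts n].
HB.instance Definition _ n := [Countable of intpart n by <:].
HB.instance Definition _ n := [isSub for @rows n].
HB.instance Definition _ n := [Countable of syt n by <:].

Lemma leq_sumn (s : seq nat) x : x \in s -> x <= sumn s.
Proof.
elim: s => //= y s IHs; rewrite inE => /orP[/eqP->|/IHs le_x_s].
  exact: leq_addr.
exact: leq_trans le_x_s (leq_addl _ _).
Qed.

Lemma size_part n la : is_part n la -> size la <= n.
Proof.
case/and3P=> _ + /eqP<-; elim: la => //= x la IHla.
rewrite inE negb_or eq_sym -lt0n => /andP[x_gt0 /IHla le_la].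
by rewrite -add1n leq_add.
Qed.

Definition part_code n (la : intpart n) : n.-bseq 'I_n.+1 :=
  insub_bseq n (map inord la).
Definition part_decode n (b : n.-bseq 'I_n.+1) : option (intpart n) :=
  insub (map val b).

Lemma part_codeK n : pcancel (@part_code n) (@part_decode n).
Proof.
move=> la; rewrite /part_decode /part_code /insub_bseq val_insubd.
have Hla := valP la; rewrite size_map size_part // -map_comp map_id_in.
  exact: valK.
move=> x x_la /=; rewrite inordK // ltnS.
by have /and3P[_ _ /eqP<-] := Hla; apply: leq_sumn.
Qed.

HB.instance Definition _ n : isFinite (intpart n) := PCanIsFinite (@part_codeK n).

Definition syt_code n (T : syt n) : n.-bseq (n.-bseq 'I_n.+1) :=
  insub_bseq n [seq insub_bseq n (map inord s) | s <- rows T].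
Definition syt_decode n (b : n.-bseq (n.-bseq 'I_n.+1)) : option (syt n) :=
  insub [seq map val (bseqval s) | s <- bseqval b].

Lemma syt_codeK n : pcancel (@syt_code n) (@syt_decode n).
Proof.
move=> T; rewrite /syt_decode /syt_code /insub_bseq.
have /and4P[shT entT _ _] := valP T.
have/and3P[_ _ /eqP sumT] := shT.
have le_T : size (rows T) <= n by rewrite -(size_map size) size_part.
rewrite [bseqval (insubd _ _)]val_insubd size_map le_T -map_comp map_id_in.
  exact: valK.
move=> s sT /=; have le_s : size s <= n.
  by rewrite -[leqRHS]sumT leq_sumn //; apply: map_f.
rewrite [bseqval (insubd _ _)]val_insubd size_map le_s -map_comp map_id_in //.
move=> x xs /=; rewrite inordK //.
have: x \in flatten T by apply/flattenP; exists s.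
by rewrite (perm_mem entT) mem_iota add1n => /andP[].
Qed.

HB.instance Definition _ n : isFinite (syt n) := PCanIsFinite (@syt_codeK n).

Definition superstd_rows (la : seq nat) : seq (seq nat) :=
  reshape la (iota 1 (sumn la)).

Lemma superstd_rows_sorted m la :
  sorted geq la -> all (sorted ltn) (reshape la (iota m (sumn la))) &&
    sorted col_lt (reshape la (iota m (sumn la))).
Proof.
elim: la m => //= x la IHla m path_la.
rewrite take_iota drop_iota addKn (minn_idPl (leq_addr _ _)) iota_ltn_sorted /=.
have /andP[-> /=] := IHla (m + x) (path_sorted path_la).
case: la path_la {IHla} => //= y la /andP[le_yx _] ->; rewrite andbT.
rewrite take_iota (minn_idPl (leq_addr _ _)) /col_lt size_iota.
apply/allP=> c; rewrite mem_iota /= add0n => lt_c.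
rewrite !nth_iota // ?(leq_trans lt_c) // -addnA ltn_add2l addnC.
by rewrite -[ltnLHS]addn0 ltn_add2l (leq_trans _ le_yx) // (leq_trans _ lt_c).
Qed.

Lemma superstdP n (la : intpart n) : is_syt n (superstd_rows la).
Proof.
have Hla := valP la; have /and3P[sla _ /eqP sum_la] := Hla.
rewrite /is_syt /superstd_rows reshapeKl ?size_iota // Hla /=.
rewrite reshapeKr ?size_iota // [in perm_eq _ _]sum_la perm_refl.
exact: superstd_rows_sorted.
Qed.

(* The superstandard tableau U_la. *)
Definition superstd n (la : intpart n) : syt n := Syt (superstdP la).

(** * Reading words and inverse descents *)

Definition rw (T : seq (seq nat)) : seq nat := flatten (rev T).

(* The filling of shape [sh] with row reading word [w]. *)
Definition of_rw (sh w : seq nat) : seq (seq nat) := rev (reshape (rev sh) w).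

(* The inverse descents of the permutation [w] of 1..n, in increasing order. *)
Definition ID_word (n : nat) (w : seq nat) : seq nat :=
  [seq i <- iota 1 n.-1 | index i.+1 w < index i w].

Definition ID (n : nat) (T : seq (seq nat)) : seq nat := ID_word n (rw T).

(** * Runs *)

(* [:: b_0; b_1; ...; b_m] *)
Definition run_ends (n : nat) (T : seq (seq nat)) : seq nat :=
  0 :: rcons (ID n T) n.

Definition nb_runs n T : nat := (size (run_ends n T)).-1.

Definition run_end n T (r : nat) : nat := nth n (run_ends n T) r.

Definition beta n T (r : nat) : nat := run_end n T r - run_end n T r.-1.

(* The cells (row, column) of the diagram of shape [sh], in reading order. *)
Definition cells (sh : seq nat) : seq (nat * nat) :=
  flatten (rev [seq [seq (r, c) | c <- iota 1 (nth 0 sh r.-1)]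
               | r <- iota 1 (size sh)]).

Definition entry (T : seq (seq nat)) (x : nat * nat) : nat :=
  nth 0 (nth [::] T x.1.-1) x.2.-1.

(* The cells of the [r]-th run, in reading order. *)
Definition run n T (r : nat) : seq (nat * nat) :=
  [seq x <- cells (shape T) | run_end n T r.-1 < entry T x <= run_end n T r].

(* The filling of shape [sh] whose successive runs are the cell sets in [R]:
   1, 2, ... are placed in the first cell set in reading order, and so on. *)
Definition of_runs (sh : seq nat) (R : seq (seq (nat * nat))) : seq (seq nat) :=
  let order := flatten [seq [seq x <- cells sh | x \in A] | A <- R] in
  [seq [seq (index (r, c) order).+1 | c <- iota 1 (nth 0 sh r.-1)]
  | r <- iota 1 (size sh)].

(* The filling formed by the entries <= b of T. *)
Definition trunc (b : nat) (T : seq (seq nat)) : seq (seq nat) :=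
  [seq s <- [seq [seq x <- s | x <= b] | s <- T] | s != [::]].

Definition first_runs n T (r : nat) : seq (seq nat) := trunc (run_end n T r) T.

Definition is_superstd (T : seq (seq nat)) : bool :=
  T == superstd_rows (shape T).

(* The minimal j such that the first j runs are not superstandard, if any. *)
Definition first_bad n T : option nat :=
  ohead [seq j <- iota 1 (nb_runs n T) | ~~ is_superstd (first_runs n T j)].

(** * The maps slink and slink_* *)

(* The common operation: runs [i] and [j] are changed, [i < j].  The cells of
   these runs strictly below row [i.+1] are split after the first
   [beta_j + i - j] ones. *)
Definition relink n T (i j : nat) : seq (seq nat) :=
  let low := [seq x <- cells (shape T)
             | (x \in run n T i ++ run n T j) && (x.1 < i.+1)] in
  let high := [seq x <- run n T j | i.+1 <= x.1] in
  let d := beta n T j + i - j in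
  let new_run r := if r == i then take d low
                   else if r == j then drop d low ++ high
                   else run n T r in
  of_runs (shape T) [seq new_run r | r <- iota 1 (nb_runs n T)].

(* Run [j] has no cell above row [j], as the first [j.-1] runs are
   superstandard; its cells in row [j] are those in rows >= [j]. *)
Definition slink n T : seq (seq nat) :=
  if first_bad n T is Some j then relink n T j.-1 j else T.

(* The condition mu_{i+1} <= beta_j + i - j is written without subtraction, as
   the right-hand side may be negative. *)
Definition slink_star n T : seq (seq nat) :=
  if first_bad n T is Some j then
    let mu := shape (first_runs n T j) in
    let i := head 0 [seq i <- iota 1 j | nth 0 mu i + j <= beta n T j + i] in
    relink n T i j
  else T.

(** * Elementary dual equivalences *)

Definition swap_values (a b : nat) (w : seq nat) : seq nat :=
  [seq if x == a then b else if x == b then a else x | x <- w].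

Definition between (x y z : nat) : bool := (x < y < z) || (z < y < x).

Definition d_word (i : nat) (w : seq nat) : seq nat :=
  let p := index i.-1 w in let q := index i w in let r := index i.+1 w in
  if between p q r then w
  else if between q p r then swap_values i i.+1 w
  else swap_values i.-1 i w.

Definition d (i : nat) (T : seq (seq nat)) : seq (seq nat) :=
  of_rw (shape T) (d_word i (rw T)).

Definition dR n (i : nat) (T : seq (seq nat)) : seq (seq nat) :=
  if (i.+1 \in ID n T) && (i.+1 \in ID n (d i T)) then T else d i T.

(** * The equivalence relations on SYT(n)

    slink, slink_* and the d_i^R are computed on bare fillings; a generator of
    the k-th relation links T to the tableau with the same rows as its image. *)

Definition generator (k n : nat) (T U : syt n) : bool :=
  match k with
  | 0 => rows U == slink_star n T
  | 1 => rows U == slink n T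
  | _ => has (fun i => rows U == dR n i T) [seq i <- iota 0 n | 2 <= i <= n - 2]
  end.

Definition sequiv (k n : nat) : rel (syt n) :=
  connect [rel T U | generator k T U || generator k U T].

Definition is_class (k n : nat) (K : {set syt n}) : Prop :=
  exists T, K = [set U | sequiv k T U].

(* [C] is the multiset union of finitely many, possibly repeated, classes. *)
Definition union_of_classes (k n : nat) (C : multiset (syt n)) : Prop :=
  exists Ks : seq {set syt n},
    (forall K, K \in Ks -> is_class k K) /\
    (forall T, C T = count (fun K : {set syt n} => T \in K) Ks).

(** * Symmetric functions

    A formal power series of bounded degree in x_1, x_2, ... with integer
    coefficients is given by its truncations in x_1, ..., x_N for all N, i.e.
    the ring of symmetric functions is seen as an inverse limit of rings of
    symmetric polynomials. *)

Local Open Scope ring_scope.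

Definition series := forall N : nat, {mpoly int[N]}.

Definition symfun (f : series) : Prop := forall N, f N \is symmetric.

(* j_1 <= ... <= j_n, and j_k = j_{k+1} implies k \notin D. *)
Definition compatible (n : nat) (D : seq nat) (j : seq nat) : bool :=
  sorted leq j &&
  all (fun k => (nth 0%N j k.-1 == nth 0%N j k) ==> (k \notin D)) (iota 1 n.-1).

Definition fundamental (n : nat) (D : seq nat) : series := fun N =>
  \sum_(j : n.-tuple 'I_N | compatible n D (map val j))
    \prod_(k < n) 'X_(tnth j k).

Definition is_ssyt (t : seq (seq nat)) : bool :=
  all (sorted leq) t && sorted col_lt t.

(* The generating function of semistandard tableaux of shape [la]; a filling of
   shape [la] is given by its entries, read from the bottom row up. *)
Definition schur (n : nat) (la : intpart n) : series := fun N =>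
  \sum_(w : n.-tuple 'I_N | is_ssyt (reshape la (map val w)))
    \prod_(k < n) 'X_(tnth w k).

(* Main.v *)
From HB Require Import structures.
Require Import Defs.
From mathcomp Require Import perm.
From mathcomp Require Import all_boot all_order all_algebra.
From mathcomp Require Import finmap multiset.
From mathcomp.multinomials Require Import mpoly.
From mathcomp Require Import zify.

(* Encode a tableau by its word w, where w_k is the row of the entry k: standard
   tableaux become ballot words, inverse descents become ascents, and the runs become
   the maximal weakly decreasing factors.  On words, slink_* exchanges two parts of
   beta up to a shift, beta_r - r and beta_s - s being swapped, so it is an involution
   that changes the sign of the Jacobi-Trudi determinant
   phi_la(T) = det [beta_r(T) - r = la_c - c], while phi_la(U_mu) is 1 if mu = la and 0
   otherwise.  Hence, for C constant on the orbits of slink_*, the sum of C(T) phi_la(T)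
   over all T is C(U_la).

   If f is symmetric, its monomial coefficients do not depend on the order of the
   parts; neither do those of the tableaux of a given shape (Bender-Knuth), which form
   a unitriangular system on partitions.  So f has the same monomial coefficients as
   some combination of Schur functions with coefficients d_mu.  A monomial coefficient
   counts the T with ID(T) inside a given set, hence, by Moebius inversion on the subsets
   of [n-1], any function of ID(T), in particular phi_la, has the same sum over both
   sides, which gives d_la = C(U_la).

   Being constant under slink suffices: if the row i of slink_* is not the
   last possible one, slink and slink_* commute and slink lowers the index of
   the first bad run; otherwise they coincide.  Finally T and slink(T) are connected
   by the d_i^R. *)

Set Implicit Arguments.
Unset Strict Implicit.
Unset Printing Implicit Defensive.

Import GRing.Theory.

Local Open Scope nat_scope.

(* [lia] does not recognize [nat] behind its canonical eqType structure. *)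
Ltac nlia :=
  try change (Equality.sort Datatypes_nat__canonical__eqtype_Equality) with nat in *;
  lia.

(** Two facts reduce most steps to arithmetic on letter counts: a weakly decreasing word is
    determined by its counts, and a ballot word followed by a weakly decreasing one stays ballot
    exactly when the new cells form a horizontal strip. A tableau that is not superstandard has the
    word [sup la ++ B ++ D], where [B] is its first bad run; the maps change [la] and [B] but not
    their joint contents, so [D] is carried along. The row i of slink_* is the first one in which
    the new part beta_j + i - j fits between mu_{i+1} and mu_i. Hence the first j - 1 runs stay
    superstandard, and as mu does not change, the same i is found a second time. slink always uses
    row j - 1; when its new part is too long for that row, run j - 1 becomes bad, which is why the
    two maps are compared by induction on j. *)

Lemma sorted_count_leq (s : seq nat) k c : sorted ltn s -> c < size s ->
  (nth 0 s c <= k) = (c < count (leq^~ k) s).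
Proof.
elim: s c => //= x s IHs c px lt_c; have sorted_s := path_sorted px.
case: (leqP x k) => [le_xk|lt_kx].
  by case: c lt_c => [|c] lt_c; rewrite ?le_xk // IHs.
have -> : count (leq^~ k) s = 0.
  apply/eqP; rewrite -leqn0 leqNgt -has_count; apply/hasPn=> y ys.
  by rewrite -ltnNge (ltn_trans lt_kx) // (allP (order_path_min ltn_trans px)).
apply/negbTE; rewrite -ltnNge; case: c lt_c => //= c lt_c.
by rewrite (ltn_trans lt_kx) // (allP (order_path_min ltn_trans px)) // mem_nth.
Qed.

Lemma take_nth_iota (T : Type) (x0 : T) (s : seq T) k :
  k <= size s -> take k s = [seq nth x0 s i | i <- iota 0 k].
Proof.
move=> le_k; apply: (@eq_from_nth _ x0); first by rewrite size_map size_iota size_takel.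
move=> i; rewrite size_takel // => lt_i.
by rewrite nth_take // (nth_map 0) ?size_iota // nth_iota.
Qed.

(** * Ballot words *)

Definition ballot (w : seq nat) : Prop :=
  forall k r, count_mem r.+1 (take k w) <= count_mem r (take k w).

Lemma ballot_take k w : ballot w -> ballot (take k w).
Proof. by move=> bw j r; rewrite -take_min; apply: bw. Qed.

Lemma ballot_catl u v : ballot (u ++ v) -> ballot u.
Proof. by move/(@ballot_take (size u)); rewrite take_size_cat. Qed.

Lemma ballot_count w r : ballot w -> count_mem r.+1 w <= count_mem r w.
Proof. by move/(_ (size w) r); rewrite take_size. Qed.

Lemma ballot_count_leq w r s : ballot w -> r <= s -> count_mem s w <= count_mem r w.
Proof.
move=> bw /subnK<-; elim: (s - r) => //= m IHm; rewrite addSn.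
exact: leq_trans (ballot_count _ bw) IHm.
Qed.

(** A prefix that ends inside [v] contains at most all the letters [r.+1] and at least the letters
    [r] of [u], so these extreme counts decide. *)
Lemma ballot_cat u v : ballot u ->
  (forall r, count_mem r.+1 (u ++ v) <= count_mem r u) -> ballot (u ++ v).
Proof.
move=> bu le_uv k r; case: (leqP k (size u)) => [le_k|lt_k].
  by rewrite takel_cat.
have lt_k' : k < size u = false by lia.
rewrite take_cat lt_k'; apply: leq_trans (leq_trans (le_uv r) _).
  by rewrite !count_cat leq_add2l -{2}(cat_take_drop (k - size u) v) count_cat leq_addr.
by rewrite count_cat leq_addr.
Qed.

(** Prefixes that end beyond [u] see only its contents. Hence a rearrangement of the first runs has
    to be checked on these runs alone. *)
Lemma ballot_perm_catr u u' v : perm_eq u u' -> ballot u' -> ballot (u ++ v) ->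
  ballot (u' ++ v).
Proof.
move=> puu' bu' bv k r; case: (leqP k (size u')) => [le_k|lt_k].
  by rewrite takel_cat.
have lt_k' : k < size u' = false by lia.
rewrite take_cat lt_k'; have := bv k r.
by rewrite take_cat (perm_size puu') lt_k' !count_cat !(permP puu').
Qed.

Lemma geq_filter_cat r (s : seq nat) : sorted geq s ->
  s = [seq x <- s | r < x] ++ [seq x <- s | x <= r].
Proof.
elim: s => //= x s IHs px; have /IHs eq_s := path_sorted px.
case: ltnP => [_ | le_xr]; first by rewrite {1}eq_s.
have all_le : all (geq x) s.
  by apply: (@order_path_min _ geq) px => y u v /= h1 h2; apply: leq_trans h2 h1.
rewrite (eq_in_filter (a2 := pred0)) ?filter_pred0 => [/=|y /(allP all_le) /= le_yx].
  congr cons; apply/esym/all_filterP/allP=> y /(allP all_le) /= le_yx.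
  exact: leq_trans le_yx le_xr.
by rewrite ltnNge (leq_trans le_yx le_xr).
Qed.

(** Cut [v] after its letters above [r]: this prefix has all the letters [r.+1] and no letter [r]
    beyond those of [u]. With [ballot_cat], this is the horizontal strip condition. *)
Lemma ballot_strip u v : sorted geq v -> ballot (u ++ v) ->
  forall r, count_mem r.+1 (u ++ v) <= count_mem r u.
Proof.
move=> sv buv r; pose v1 := [seq x <- v | r < x]; pose v2 := [seq x <- v | x <= r].
have eq_v : v = v1 ++ v2 by apply: geq_filter_cat.
have: ballot (u ++ v1) by apply: (@ballot_catl _ v2); rewrite -catA -eq_v.
move/(@ballot_count _ r); rewrite {1}eq_v !count_cat.
suff -> : count_mem r v1 = 0.
  suff -> : count_mem r.+1 v2 = 0 by lia.
  by apply/count_memPn; rewrite mem_filter ltnn.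
by apply/count_memPn; rewrite mem_filter ltnn.
Qed.

Lemma sorted_geq_eq (s t : seq nat) : sorted geq s -> sorted geq t ->
  (forall r, count_mem r s = count_mem r t) -> s = t.
Proof.
move=> ss st eqst; apply: (sorted_eq (leT := geq)) => //.
- by move=> y x z /= h1 h2; apply: leq_trans h2 h1.
- by move=> x y /=; rewrite andbC => /anti_leq.
- by apply/allP=> r _; rewrite /= eqst.
Qed.

(** * The tableau of a ballot word *)

Definition posn (r : nat) (w : seq nat) : seq nat :=
  [seq k <- iota 1 (size w) | nth 0 w k.-1 == r].

Definition height (w : seq nat) : nat := foldr (fun x m => maxn x.+1 m) 0 w.

(* [w] lists the rows, numbered from 0, of the entries 1, 2, ... *)
Definition tab (w : seq nat) : seq (seq nat) :=
  [seq posn r w | r <- iota 0 (height w)].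

Lemma mem_posn r w k :
  (k \in posn r w) = (0 < k <= size w) && (nth 0 w k.-1 == r).
Proof. by rewrite mem_filter mem_iota andbC add1n ltnS. Qed.

Lemma posn_sorted r w : sorted ltn (posn r w).
Proof. by apply: sorted_filter; [exact: ltn_trans | exact: iota_ltn_sorted]. Qed.

Lemma count_posn r w k :
  count (leq^~ k) (posn r w) = count_mem r (take k w).
Proof.
rewrite -size_filter -filter_predI; wlog le_k : k / k <= size w.
  move=> hw; case: (leqP k (size w)) => [|lt_k]; first exact: hw.
  have := hw _ (leqnn (size w)); rewrite take_size take_oversize 1?ltnW // => <-.
  congr size; apply: eq_in_filter => i; rewrite mem_iota /=; lia.
rewrite (take_nth_iota 0) // count_map -size_filter.
rewrite -{1}(subnKC le_k) iotaD filter_cat size_cat.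
have /eqP-> : size [seq x <- iota (1 + k) (size w - k) |
   predI (leq^~ k) (fun k => nth 0 w k.-1 == r) x] == 0.
  rewrite size_filter -leqn0 leqNgt -has_count; apply/negP=> /hasP[x].
  rewrite mem_iota /=; lia.
rewrite addn0 !size_filter -[1]addn0 iotaDl count_map; apply: eq_in_count => x.
by rewrite mem_iota /= add1n => ->.
Qed.

Lemma size_posn r w : size (posn r w) = count_mem r w.
Proof.
have /= := count_posn r w (size w); rewrite take_size => <-; apply/esym/eqP.
rewrite -all_count; apply/allP=> k; rewrite mem_posn => /andP[/andP[_]].
by [].
Qed.

(** The bridge between entries and counts: through it the column condition on a tableau becomes the
    ballot inequality on prefixes. *)
Lemma nth_posn_leq r w c k : c < count_mem r w ->
  (nth 0 (posn r w) c <= k) = (c < count_mem r (take k w)).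
Proof.
by move=> lt_c; rewrite sorted_count_leq ?posn_sorted ?size_posn // count_posn.
Qed.

Lemma ltn_height w x : x \in w -> x < height w.
Proof. by elim: w => //= y w IHw; rewrite inE leq_max => /orP[/eqP->|/IHw->]; rewrite ?leqnn ?orbT. Qed.

Lemma height_mem w : 0 < height w -> (height w).-1 \in w.
Proof.
elim: w => //= y w IHw _; rewrite inE; case: (leqP (height w) y.+1) => [_|lt_y] /=.
  by rewrite eqxx.
by rewrite IHw ?orbT // (leq_trans _ lt_y).
Qed.

Lemma ballot_height w r : ballot w -> (r < height w) = (r \in w).
Proof.
move=> bw; apply/idP/idP=> [lt_r|]; last exact: ltn_height.
have /height_mem : 0 < height w by apply: leq_ltn_trans lt_r.
rewrite -!has_pred1 !has_count => /leq_trans; apply; apply: ballot_count_leq => //.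
lia.
Qed.

Lemma shape_tab w : shape (tab w) = [seq count_mem r w | r <- iota 0 (height w)].
Proof. by rewrite /shape -map_comp; apply: eq_map => r /=; rewrite size_posn. Qed.

Lemma nth_shape_tab w r : nth 0 (shape (tab w)) r = count_mem r w.
Proof.
rewrite shape_tab; case: (ltnP r (height w)) => [lt_r|le_r].
  by rewrite (nth_map 0) ?size_iota // nth_iota.
rewrite nth_default ?size_map ?size_iota //; apply/esym/count_memPn/negP=> /ltn_height.
lia.
Qed.

Lemma nth_tab w r : nth [::] (tab w) r = posn r w.
Proof.
case: (ltnP r (height w)) => [lt_r|le_r].
  by rewrite (nth_map 0) ?size_iota // nth_iota.
rewrite nth_default ?size_map ?size_iota //; apply/esym/nilP; rewrite /nilp size_posn.
by apply/eqP/count_memPn/negP=> /ltn_height; lia.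
Qed.

Lemma perm_flatten_tab w : perm_eq (flatten (tab w)) (iota 1 (size w)).
Proof.
apply: uniq_perm; rewrite ?iota_uniq //.
  rewrite /tab; elim: (height w) {1}0 => //= m IHm i; rewrite cat_uniq IHm.
  rewrite filter_uniq ?iota_uniq //= andbT; apply/hasPn=> k /flatten_mapP[r].
  rewrite mem_iota /= !mem_posn => /andP[lt_ir _] /andP[_ /eqP->].
  by rewrite negb_and gtn_eqF ?orbT.
move=> k; apply/flatten_mapP/idP=> [[r _]|]; first by rewrite mem_filter => /andP[].
move=> kw; exists (nth 0 w k.-1); last by rewrite mem_filter eqxx.
rewrite mem_iota /= add0n ltn_height // mem_nth //.
by move: kw; rewrite mem_iota; case: k.
Qed.

Lemma is_syt_tab w : ballot w -> is_syt (size w) (tab w).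
Proof.
move=> bw; apply/and4P; split.
- apply/and3P; split.
  + apply/(sortedP 0) => i; rewrite {1}shape_tab size_map size_iota => lt_i.
    by rewrite !nth_shape_tab /=; apply: ballot_count.
  + apply/negP; rewrite shape_tab => /mapP[r]; rewrite mem_iota /= add0n => lt_r.
    move/esym/count_memPn/negP; case.
    by rewrite -(ballot_height _ bw).
  + by rewrite -size_flatten (perm_size (perm_flatten_tab w)) size_iota.
- exact: perm_flatten_tab.
- by apply/allP=> _ /mapP[r _ ->]; apply: posn_sorted.
apply/(sortedP [::]) => r; rewrite size_map size_iota => lt_r.
rewrite !nth_tab; apply/allP=> c; rewrite mem_iota /= add0n size_posn => lt_c.
set k := nth 0 (posn r.+1 w) c.
have k_in : k \in posn r.+1 w by rewrite mem_nth ?size_posn.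
have lt_c' : c < count_mem r w by apply: leq_trans lt_c (ballot_count _ bw).
have : nth 0 (posn r w) c <= k.
  rewrite nth_posn_leq //; apply: leq_trans (bw k r).
  by rewrite -nth_posn_leq.
(* Strictness: equality would put one entry in two rows. *)
rewrite leq_eqVlt => /orP[/eqP eq_k|//].
have : k \in posn r w by rewrite -eq_k mem_nth // size_posn.
move: k_in; rewrite !mem_posn => /andP[_ /eqP->] /andP[_].
by rewrite eqn_leq ltnn.
Qed.

(** * The word of a tableau *)

Definition word (n : nat) (T : seq (seq nat)) : seq nat :=
  [seq find (fun s => k \in s) T | k <- iota 1 n].

Lemma size_word n T : size (word n T) = n.
Proof. by rewrite size_map size_iota. Qed.

Lemma find_uniq_flatten (T : seq (seq nat)) r k : uniq (flatten T) ->
  (find (fun s => k \in s) T == r) && (r < size T) = (k \in nth [::] T r).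
Proof.
elim: T r => [|s T IHT] r /=; first by rewrite nth_nil ltn0 andbF.
rewrite cat_uniq => /and3P[_ /hasPn sT uT]; case: (boolP (k \in s)) => [ks|nks] /=.
  case: r => [|r] /=; first by rewrite ks.
  apply/esym/negP=> kr; have /sT/negP : k \in flatten T; last exact.
  apply/flattenP; exists (nth [::] T r) => //; apply: mem_nth.
  by rewrite ltnNge; apply/negP=> le_r; rewrite nth_default in kr.
by case: r => [|r] /=; [rewrite (negbTE nks)|rewrite eqSS ltnS IHT].
Qed.

Lemma posn_word n T r : is_syt n T -> posn r (word n T) = nth [::] T r.
Proof.
case/and4P=> _ pT /allP sT _; apply: (irr_sorted_eq (leT := ltn)).
- exact: ltn_trans.
- exact: ltnn.
- exact: posn_sorted.
- case: (ltnP r (size T)) => [lt_r|le_r]; last by rewrite nth_default.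
  exact/sT/mem_nth.
have uT : uniq (flatten T) by rewrite (perm_uniq pT) iota_uniq.
move=> k; rewrite mem_posn size_word -(find_uniq_flatten _ _ uT).
case: (boolP (0 < k <= n)) => /= [kn|nkn].
  rewrite (nth_map 0) ?size_iota ?nth_iota ?add1n ?prednK; try by case/andP: kn => *; lia.
  have lt_f : find (fun s => k \in s) T < size T.
    rewrite -has_find; have : k \in flatten T by rewrite (perm_mem pT) mem_iota; lia.
    by case/flattenP=> s s1 s2; apply/hasP; exists s.
  by apply/esym/andb_idr => /eqP<-.
apply/esym/negbTE; apply: contra nkn; rewrite (find_uniq_flatten _ _ uT) => kr.
have : k \in flatten T; last by rewrite (perm_mem pT) mem_iota; lia.
apply/flattenP; exists (nth [::] T r) => //; apply: mem_nth.
by rewrite ltnNge; apply/negP=> le_r; rewrite nth_default in kr.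
Qed.

Lemma count_word n T r k : is_syt n T ->
  count_mem r (take k (word n T)) = count (leq^~ k) (nth [::] T r).
Proof. by move=> sT; rewrite -count_posn (posn_word _ sT). Qed.

(** Below each entry at most [k] of row [r.+1] stands a smaller entry of row [r], so the columns
    counted for row [r.+1] are among those counted for row [r]. *)
Lemma ballot_word n T : is_syt n T -> ballot (word n T).
Proof.
move=> sT k r; rewrite !(count_word _ _ sT); case/and4P: (sT) => _ _ _ /(sortedP [::]) colT.
case: (ltnP r.+1 (size T)) => [lt_r|le_r]; last by rewrite [nth _ _ r.+1]nth_default.
have count_nth s : count (leq^~ k) s = count (fun c => nth 0 s c <= k) (iota 0 (size s)).
  by rewrite -{1}(mkseq_nth 0 s) count_map.
have /allP col_r := colT r lt_r.
have le_sz : size (nth [::] T r.+1) <= size (nth [::] T r).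
  have [/and3P[/(sortedP 0) shT _ _] _ _ _] := and4P sT.
  have := shT r; rewrite size_map => /(_ lt_r) /=.
  by rewrite !(nth_map [::]) // ltnW.
rewrite !count_nth -(subnKC le_sz) iotaD count_cat.
apply: leq_trans (leq_addr _ _); rewrite -!size_filter.
rewrite !size_filter (eq_in_count (a2 := predI (fun c => nth 0 (nth [::] T r) c <= k)
    (fun c => nth 0 (nth [::] T r.+1) c <= k))); first by apply: sub_count => c /andP[].
move=> c /col_r /= lt_c; apply/esym/andb_idl; exact/leq_trans/ltnW.
Qed.

Lemma tab_word n T : is_syt n T -> tab (word n T) = T.
Proof.
move=> sT; have bw := ballot_word sT; have /and4P[/and3P[_ n0 _] _ _ _] := sT.
have row_neq0 r : (r < size T) = (0 < size (nth [::] T r)).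
  case: ltnP => [lt_r|le_r]; last by rewrite nth_default.
  apply/esym; rewrite lt0n; apply: contra n0 => /eqP<-.
  by apply/mapP; exists (nth [::] T r); rewrite ?mem_nth.
have eq_sz : height (word n T) = size T.
  apply/eqP; rewrite eqn_leq; apply/andP; split; rewrite leqNgt; apply/negP=> lt_r.
    move: (lt_r); rewrite ballot_height // -has_pred1 has_count -size_posn posn_word //.
    by rewrite -row_neq0 ltnn.
  move: (lt_r); rewrite row_neq0 -(posn_word _ sT) size_posn -has_count has_pred1.
  by rewrite -(ballot_height _ bw) ltnn.
apply: (@eq_from_nth _ [::]); first by rewrite size_map size_iota.
by move=> r _; rewrite nth_tab posn_word.
Qed.

Lemma word_tab w : word (size w) (tab w) = w.
Proof.
apply: (@eq_from_nth _ 0); first by rewrite size_word.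
move=> i; rewrite size_word => lt_i.
rewrite (nth_map 0) ?size_iota // nth_iota // add1n.
have uT : uniq (flatten (tab w)) by rewrite (perm_uniq (perm_flatten_tab w)) iota_uniq.
apply/eqP.
have := find_uniq_flatten (nth 0 w i) i.+1 uT.
by rewrite nth_tab mem_posn /= eqxx andbT lt_i => /andP[].
Qed.

Lemma geq_trans : transitive geq.
Proof. by move=> y x z /= le_yx le_zy; apply: leq_trans le_zy le_yx. Qed.

(** * Inverse descents, cells and runs of the tableau of a word *)

Lemma sorted_rev_rows (T : eqType) (R : rel T) (f : nat -> seq T) m L :
  transitive R -> (forall r, sorted R (f r)) ->
  (forall r r' x y, r < r' -> x \in f r' -> y \in f r -> R x y) ->
  sorted R (flatten (rev [seq f r | r <- iota m L])).
Proof.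
move=> trR sf Rf; rewrite sorted_pairwise //; elim: L m => //= L IHL m.
rewrite rev_cons flatten_rcons pairwise_cat IHL -sorted_pairwise // sf !andbT.
apply/allrelP=> x y /flattenP[s]; rewrite mem_rev => /mapP[r]; rewrite mem_iota.
by case/andP=> lt_mr _ -> xr ym; apply: Rf xr ym.
Qed.

Lemma sorted_index_ltn (T : eqType) (R : rel T) (s : seq T) :
  transitive R -> irreflexive R -> sorted R s ->
  {in s &, forall x y, (index x s < index y s) = R x y}.
Proof.
move=> trR irR sR x y xs ys; apply/idP/idP; first exact: sorted_ltn_index.
move=> Rxy; rewrite ltnNge leq_eqVlt; apply/negP=> /orP[/eqP eq_i|].
  by have := irR x; rewrite -{2}(nth_index x xs) -eq_i nth_index // Rxy.
by move/(sorted_ltn_index trR sR y x ys xs)/(trR _ _ _ Rxy); rewrite irR.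
Qed.

Definition ascents (w : seq nat) : seq nat :=
  [seq i <- iota 1 (size w).-1 | nth 0 w i.-1 < nth 0 w i].

Lemma mem_rw_tab w : rw (tab w) =i iota 1 (size w).
Proof.
move=> k; rewrite -(perm_mem (perm_flatten_tab w)); apply/perm_mem.
exact/perm_flatten/permEl/perm_rev.
Qed.

Definition row_before (w : seq nat) (k k' : nat) : bool :=
  (nth 0 w k'.-1 < nth 0 w k.-1) || ((nth 0 w k.-1 == nth 0 w k'.-1) && (k < k')).

Lemma rw_tab_sorted w :
  [/\ transitive (row_before w), irreflexive (row_before w) & sorted (row_before w) (rw (tab w))].
Proof.
have trR : transitive (row_before w) by rewrite /row_before => y x z /=; lia.
split=> //; first by move=> x; rewrite /row_before eqxx !ltnn.
apply: sorted_rev_rows => // [r|r r' x y lt_r].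
  apply: (sub_in_sorted (P := mem (posn r w)) (e := ltn)); last exact: posn_sorted.
    move=> x y /=; rewrite !mem_posn /row_before => /andP[_ /eqP->] /andP[_ /eqP->] ->.
    by rewrite eqxx orbT.
  exact/allP.
by rewrite !mem_posn /row_before => /andP[_ /eqP->] /andP[_ /eqP->]; rewrite lt_r.
Qed.

Lemma ID_tab w : ID (size w) (tab w) = ascents w.
Proof.
rewrite /ID /ID_word /ascents.
have [trR irR sR] := rw_tab_sorted w.
apply: eq_in_filter => i; rewrite mem_iota => i_in.
rewrite (sorted_index_ltn trR irR sR) ?mem_rw_tab ?mem_iota; try nlia.
by rewrite /row_before /= [i.+1 < i]ltnNge leqnSn andbF orbF.
Qed.

(* The factors in [ws] are then the runs of [tab (flatten ws)], each entry being
   replaced by its row. *)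
Definition run_factors (ws : seq (seq nat)) : bool :=
  [&& all (sorted geq) ws, [::] \notin ws &
      sorted (fun s t => last 0 s < head 0 t) ws].

Lemma run_factors_exist w : exists2 ws, run_factors ws & flatten ws = w.
Proof.
elim: w => [|x w [ws ws_runs <-]]; first by exists [::].
case: ws ws_runs => [|[|y s] ws]; first by exists [:: [:: x]].
  by case/and3P.
case/and3P=> /=; rewrite !inE /= => /andP[sys s_ws] n0 lt_ws.
have [le_yx|lt_xy] := leqP y x.
  exists ((x :: y :: s) :: ws); rewrite // /run_factors /= le_yx sys s_ws inE.
  by rewrite n0; case: (ws) lt_ws.
by exists ([:: x] :: (y :: s) :: ws); rewrite // /run_factors /= lt_xy lt_ws sys s_ws !inE /= n0.
Qed.

Lemma nth_geq_sorted (s : seq nat) i j :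
  sorted geq s -> i <= j -> j < size s -> nth 0 s j <= nth 0 s i.
Proof.
move=> ss le_ij lt_j.
by apply: (sorted_leq_nth geq_trans leqnn); rewrite ?inE ?(leq_ltn_trans le_ij).
Qed.

Lemma ascents_cat s w : sorted geq s -> s != [::] -> w != [::] ->
  last 0 s < head 0 w ->
  ascents (s ++ w) = size s :: map (addn (size s)) (ascents w).
Proof.
rewrite -!size_eq0 -!lt0n => ss s_gt0 w_gt0 lt_sw; rewrite /ascents size_cat.
rewrite (_ : (size s + size w).-1 = (size s).-1 + (1 + (size w).-1)); last nlia.
rewrite iotaD filter_cat (eq_in_filter (a2 := pred0)) ?filter_pred0 => [|i].
  rewrite add1n prednK //= !nth_cat prednK // leqnn ltnn subnn nth_last nth0 lt_sw.
  rewrite -[(size s).+1]addn1 iotaDl filter_map; congr cons; congr map.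
  apply: eq_in_filter => i; rewrite mem_iota => /andP[i_gt0 _] /=.
  rewrite !nth_cat !ifF; try nlia.
  by rewrite addKn (_ : _ - _ = i.-1); last nlia.
rewrite mem_iota => i_in; apply/negbTE; rewrite -leqNgt !nth_cat !ifT; try nlia.
by apply: nth_geq_sorted => //; nlia.
Qed.

Lemma ascents_sorted s : sorted geq s -> ascents s = [::].
Proof.
move=> ss; apply/eqP; rewrite -size_eq0 size_filter -leqn0 leqNgt -has_count.
apply/hasPn=> i; rewrite mem_iota -leqNgt => i_in.
by apply: nth_geq_sorted => //; nlia.
Qed.

Lemma scanl_addn c s : scanl addn c s = map (addn c) (scanl addn 0 s).
Proof.
elim: s c => //= x s IHs c; rewrite add0n IHs [in RHS]IHs -map_comp.
by congr cons; apply: eq_map => y /=; rewrite addnA.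
Qed.

Lemma nth_scanl_addn d c s r : r <= size s ->
  nth d (c :: scanl addn c s) r = c + sumn (take r s).
Proof.
elim: s c r => [|x s IHs] c [|r] //= le_r; rewrite ?addn0 //.
by rewrite IHs // addnA.
Qed.

Lemma flatten_eq0 (ws : seq (seq nat)) : [::] \notin ws ->
  (flatten ws == [::]) = (ws == [::]).
Proof. by case: ws => // -[|]. Qed.

Lemma run_ends_tab ws : run_factors ws -> ws != [::] ->
  run_ends (size (flatten ws)) (tab (flatten ws)) = 0 :: scanl addn 0 (map size ws).
Proof.
rewrite /run_ends ID_tab => rf ws0; congr cons.
elim: ws rf ws0 => // s ws IHws /and3P[/= /andP[ss s_ws]].
rewrite inE negb_or => /andP[s0 n0] lt_ws _; have [ws_nil|ws0] := eqVneq ws [::].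
  by rewrite ws_nil /= cats0 ascents_sorted.
have rf : run_factors ws by rewrite /run_factors s_ws n0 (path_sorted lt_ws).
have fw0 : flatten ws != [::] by rewrite flatten_eq0.
rewrite ascents_cat // 1?eq_sym //; last first.
  by case: ws ws0 n0 lt_ws {IHws s_ws rf fw0} => //= -[|y t] ws //= _ _ /andP[].
by rewrite rcons_cons size_cat -map_rcons IHws // add0n -scanl_addn.
Qed.

Section RunFactors.

Variables (ws : seq (seq nat)) (ws_runs : run_factors ws).
Let w := flatten ws.
Let n := size w.

Lemma nb_runs_tab : ws != [::] -> nb_runs n (tab w) = size ws.
Proof. by move=> ws0; rewrite /nb_runs run_ends_tab // /= size_scanl size_map. Qed.

Lemma run_end_tab r : ws != [::] -> r <= size ws ->
  run_end n (tab w) r = size (flatten (take r ws)).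
Proof.
move=> ws0 le_r; rewrite /run_end run_ends_tab // size_flatten /shape map_take.
by rewrite nth_scanl_addn ?size_map.
Qed.

Lemma run_end_oversize r : size ws < r -> run_end n (tab w) r = n.
Proof.
move=> lt_r; have [ws0|ws0] := eqVneq ws [::].
  by rewrite /run_end /run_ends /n /w ws0 /ID /ID_word; case: r lt_r => [|[|r]] //= _; rewrite nth_nil.
by rewrite /run_end nth_default // run_ends_tab //= size_scanl size_map.
Qed.

(** Beyond the last run, [run_end] returns its default [n], so the missing parts of beta are 0; this
    gives a meaning to all rows of the n by n matrix [run_matrix]. *)
Lemma beta_tab r : 0 < r -> beta n (tab w) r = size (nth [::] ws r.-1).
Proof.
case: r => // r _; rewrite /beta /=; have [ws0|ws0] := eqVneq ws [::].
  have wn : n = 0 by rewrite /n /w ws0.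
  rewrite ws0 nth_nil /= /run_end /run_ends wn /ID /ID_word /=.
  by case: r => [|[|r]].
case: (ltnP r (size ws)) => [lt_r|le_r].
  rewrite !run_end_tab ?(ltnW lt_r) // (take_nth [::]) // flatten_rcons size_cat.
  by rewrite addKn.
rewrite run_end_oversize // nth_default //; move: le_r; rewrite leq_eqVlt.
case/orP=> [/eqP<-|lt_r]; last by rewrite run_end_oversize // subnn.
by rewrite run_end_tab // take_size subnn.
Qed.

End RunFactors.

(** * Cells of consecutive entries, and fillings rebuilt from cell sets *)

Definition cell (w : seq nat) (k : nat) : nat * nat :=
  ((nth 0 w k).+1, count_mem (nth 0 w k) (take k.+1 w)).

(** As [cell w k] is the cell of the entry [k.+1], these are the cells of the entries [a.+1] to [b],
    in the order of the entries. *)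
Definition window (w : seq nat) (a b : nat) : seq (nat * nat) :=
  [seq cell w k | k <- iota a (b - a)].

Definition reads_before (x y : nat * nat) : bool :=
  (y.1 < x.1) || ((x.1 == y.1) && (x.2 < y.2)).

Lemma reads_before_trans : transitive reads_before.
Proof. by move=> [b b'] [a a'] [c c']; rewrite /reads_before /=; lia. Qed.

Lemma reads_before_irr : irreflexive reads_before.
Proof. by move=> [a a']; rewrite /reads_before /=; lia. Qed.

Lemma count_take_leq r (w : seq nat) a b :
  a <= b -> count_mem r (take a w) <= count_mem r (take b w).
Proof.
move=> le_ab; rewrite -(cat_take_drop a (take b w)) take_takel // count_cat.
exact: leq_addr.
Qed.

Lemma count_takeS r (w : seq nat) k : k < size w ->
  count_mem r (take k.+1 w) = count_mem r (take k w) + (nth 0 w k == r).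
Proof. by move=> lt_k; rewrite (take_nth 0) // -cats1 count_cat /= addn0. Qed.

Lemma cell_posn r w c : c < count_mem r w ->
  let p := nth 0 (posn r w) c in (0 < p <= size w) /\ cell w p.-1 = (r.+1, c.+1).
Proof.
move=> lt_c p; have: p \in posn r w by rewrite mem_nth // size_posn.
rewrite mem_posn => /andP[p_in /eqP wp]; split=> //.
rewrite /cell wp prednK; last by case/andP: p_in.
congr pair; apply/eqP; rewrite eqn_leq -(nth_posn_leq p lt_c) leqnn andbT.
have /andP[p_gt0 le_p] := p_in; rewrite -{1}(prednK p_gt0) count_takeS ?prednK //.
rewrite wp eqxx addn1 ltnS leqNgt -nth_posn_leq // -/p.
by rewrite -ltnNge prednK.
Qed.

(** The cells form the skew shape between the shapes of two prefixes, so that membership depends on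
    letter counts only. This allows the runs of different words to be compared. *)
Lemma mem_window w a b x : b <= size w ->
  (x \in window w a b) = (0 < x.1) &&
    (count_mem x.1.-1 (take a w) < x.2 <= count_mem x.1.-1 (take b w)).
Proof.
case: x => x c le_b; apply/mapP/idP => /= [[k]|].
  rewrite mem_iota => k_in [-> ->] /=; rewrite count_take_leq ?andbT; last by nlia.
  by rewrite count_takeS ?eqxx ?addn1 ?ltnS ?count_take_leq //; nlia.
case: x => // r; case: c => // c /and3P[_ /= lt_c le_c].
have lt_cw : c < count_mem r w.
  by apply: leq_trans le_c _; rewrite -{2}(take_size w) count_take_leq.
have [/andP[p_gt0 le_p] cellp] := cell_posn lt_cw.
exists (nth 0 (posn r w) c).-1; last by rewrite cellp.
move: lt_c le_c; rewrite ltnS leqNgt -!nth_posn_leq // mem_iota.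
case: (nth 0 (posn r w) c) p_gt0 => //= p _; nlia.
Qed.

Lemma window_cat w a b c : a <= b -> b <= c ->
  window w a b ++ window w b c = window w a c.
Proof.
move=> le_ab le_bc; rewrite /window -map_cat; congr map.
by rewrite -[in iota b _](subnKC le_ab) -iotaD; congr iota; lia.
Qed.

(** Along a decreasing factor the row goes down, or stays the same while the column grows: the order
    of the entries is the reading order. *)
Lemma sorted_window w a b : b <= size w -> sorted geq (drop a (take b w)) ->
  sorted reads_before (window w a b).
Proof.
move=> le_b sw; apply/(sortedP (0, 0)) => i; rewrite size_map size_iota => lt_i.
rewrite !(nth_map 0) ?size_iota // ?(ltnW lt_i) // !nth_iota // ?(ltnW lt_i) //.
have lt_k : a + i.+1 < b by nlia.
move/(sortedP 0): sw => /(_ i); rewrite size_drop size_takel // => /(_ lt_i).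
rewrite !nth_drop !nth_take // /reads_before /cell /=; last by nlia.
rewrite ltnS leq_eqVlt => /orP[/eqP eq_w|-> //]; apply/orP; right.
rewrite eq_w eqxx /= (count_takeS _ (leq_trans lt_k le_b)). rewrite eq_w eqxx addn1 ltnS.
by rewrite count_take_leq // addnS.
Qed.

Lemma mem_cells_row sh x : (x \in cells sh) =
  [&& 0 < x.1 <= size sh & 0 < x.2 <= nth 0 sh x.1.-1].
Proof.
case: x => x c; apply/flattenP/idP => /= [[s]|/andP[x_in c_in]].
  rewrite mem_rev => /mapP[r]; rewrite mem_iota => r_in -> /mapP[c'].
  by rewrite mem_iota => c_in [-> ->]; nlia.
exists [seq (x, c0) | c0 <- iota 1 (nth 0 sh x.-1)].
  by rewrite mem_rev; apply: map_f; rewrite mem_iota; nlia.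
by apply: map_f; rewrite mem_iota; nlia.
Qed.

Lemma mem_cells w x : (x \in cells (shape (tab w))) =
  (0 < x.1) && (0 < x.2 <= count_mem x.1.-1 w).
Proof.
rewrite mem_cells_row nth_shape_tab size_map size_map size_iota.
case: x => -[//|r] c /=; case: (ltnP r (height w)) => //= le_r.
suff -> : count_mem r w = 0 by case: c.
by apply/count_memPn/negP=> /ltn_height; rewrite ltnNge le_r.
Qed.

Lemma sorted_cells sh : sorted reads_before (cells sh).
Proof.
apply: sorted_rev_rows => [|r|r r' x y lt_r /mapP[c _ ->] /mapP[c' _ ->]].
- exact: reads_before_trans.
- apply: (homo_sorted (e := ltn)); last exact: iota_ltn_sorted.
  by move=> c c'; rewrite /reads_before /= ltnn eqxx.
- by rewrite /reads_before /= lt_r.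
Qed.

Lemma filter_cells w (A : seq (nat * nat)) a b : b <= size w ->
  sorted geq (drop a (take b w)) ->
  {in cells (shape (tab w)), A =i window w a b} ->
  [seq x <- cells (shape (tab w)) | x \in A] = window w a b.
Proof.
move=> le_b sw eqA; apply: (irr_sorted_eq (leT := reads_before)).
- exact: reads_before_trans.
- exact: reads_before_irr.
- exact/sorted_filter/sorted_cells/reads_before_trans.
- exact: sorted_window.
move=> x; rewrite mem_filter; apply/andP/idP => [[xA xc]|xw]; first by rewrite -eqA.
suff xc : x \in cells (shape (tab w)) by rewrite eqA.
move: xw; rewrite mem_window // mem_cells => /and3P[-> lt_x le_x] /=.
rewrite (leq_ltn_trans _ lt_x) //=; apply: leq_trans le_x _.
by rewrite -{2}(take_size w) count_take_leq.
Qed.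

Lemma tab_window w :
  [seq [seq (index (r, c) (window w 0 (size w))).+1 | c <- iota 1 (nth 0 (shape (tab w)) r.-1)]
  | r <- iota 1 (size (shape (tab w)))] = tab w.
Proof.
rewrite /window subn0.
have inj_cell : {in iota 0 (size w) &, injective (cell w)}.
  suff lt_cell k k' : k < k' -> k' < size w -> cell w k = cell w k' -> False.
    move=> k k'; rewrite !mem_iota /= add0n => lt_k lt_k' eq_c.
    by case: (ltngtP k k') => // [/lt_cell|/lt_cell] h; case: h.
  move=> lt_k lt_k' [eq_w]; rewrite eq_w [X in _ = X]count_takeS // eqxx => eq_c.
  by have := count_take_leq (nth 0 w k') w lt_k; rewrite eq_c addn1 ltnn.
rewrite size_map (iotaDl 1 0) -map_comp -[in RHS](mkseq_nth [::] (tab w)).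
apply: eq_map => r; rewrite [LHS]/= add1n nth_shape_tab nth_tab.
rewrite (iotaDl 1 0) -map_comp -[in RHS](mkseq_nth 0 (posn r w)) size_posn.
apply/eq_in_map => c; rewrite mem_iota /= add0n add1n => lt_c.
have [/andP[p_gt0 le_p] <-] := cell_posn lt_c; set p := nth _ _ _ in p_gt0 le_p *.
have lt_p : p.-1 < size w by rewrite prednK.
have -> : cell w p.-1 = nth (0, 0) [seq cell w k | k <- iota 0 (size w)] p.-1.
  by rewrite (nth_map 0) ?size_iota // nth_iota.
by rewrite index_uniq ?size_map ?size_iota ?prednK // map_inj_in_uniq ?iota_uniq.
Qed.

(** [of_runs] puts each cell set in reading order, which on a decreasing factor is the order of the
    entries; so only the sets have to match, and only inside the diagram. *)
Lemma of_runs_tab ws (R : seq (seq (nat * nat))) : all (sorted geq) ws ->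
  size R = size ws ->
  (forall i, i < size ws -> {in cells (shape (tab (flatten ws))),
    nth [::] R i =i window (flatten ws) (size (flatten (take i ws)))
                                       (size (flatten (take i.+1 ws)))}) ->
  of_runs (shape (tab (flatten ws))) R = tab (flatten ws).
Proof.
set w := flatten ws; move=> sws szR eqR; rewrite /of_runs -[RHS]tab_window.
suff -> : flatten [seq [seq x <- cells (shape (tab w)) | x \in A] | A <- R] =
  window w 0 (size w) by [].
suff eq_take i : i <= size ws ->
    flatten [seq [seq x <- cells (shape (tab w)) | x \in A] | A <- take i R] =
    window w 0 (size (flatten (take i ws))).
  by have := eq_take _ (leqnn _); rewrite -{1}szR !take_size.
elim: i => [|i IHi] lt_i; first by rewrite !take0 /window.
rewrite (take_nth [::]) ?szR // map_rcons flatten_rcons IHi 1?ltnW //.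
have sz_take : size (flatten (take i.+1 ws)) =
    size (flatten (take i ws)) + size (nth [::] ws i).
  by rewrite (take_nth [::]) // flatten_rcons size_cat.
have le_sz : size (flatten (take i.+1 ws)) <= size w.
  by rewrite /w -{2}(cat_take_drop i.+1 ws) flatten_cat size_cat leq_addr.
rewrite (filter_cells le_sz _ (eqR i lt_i)) ?window_cat ?sz_take ?leq_addr //.
have -> : w = flatten (take i ws) ++ nth [::] ws i ++ flatten (drop i.+1 ws).
  by rewrite /w -{1}(cat_take_drop i ws) (drop_nth [::] lt_i) flatten_cat.
rewrite take_cat ltnNge leq_addr addKn /= drop_size_cat // take_size_cat //.
by apply: (allP sws); rewrite mem_nth.
Qed.

Lemma mem_run w ws r x : run_factors ws -> ws != [::] -> w = flatten ws ->
  0 < r <= size ws ->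
  (x \in run (size w) (tab w) r) = (0 < x.1) &&
    (count_mem x.1.-1 (flatten (take r.-1 ws)) < x.2 <= count_mem x.1.-1 (flatten (take r ws))).
Proof.
move=> ws_runs ws0 eq_w /andP[r_gt0 le_r]; rewrite mem_filter mem_cells.
have re i : i <= size ws -> run_end (size w) (tab w) i = size (flatten (take i ws)).
  by rewrite eq_w; apply: run_end_tab.
rewrite !re //; last by rewrite (leq_trans (leq_pred r)).
have take_w i : flatten (take i ws) = take (size (flatten (take i ws))) w.
  by rewrite eq_w -{3}(cat_take_drop i ws) flatten_cat take_size_cat.
rewrite [in RHS]take_w [flatten (take r ws) in RHS]take_w.
case: x => -[|x] [|c]; rewrite ?andbF //= /entry nth_tab /=.
case: (ltnP c (count_mem x w)) => [lt_c|le_c]; last first.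
  rewrite andbF; apply/esym/negbTE; rewrite negb_and -!leqNgt orbC.
  apply/orP; left; apply: leq_trans le_c; rewrite -{2}(take_size w).
  apply: count_take_leq; rewrite eq_w -{2}(cat_take_drop r ws) flatten_cat size_cat.
  exact: leq_addr.
by rewrite andbT ltnNge !nth_posn_leq // -leqNgt.
Qed.

(** * Superstandard tableaux and the shape of the first bad run *)

(** Each row of [U_la] holds consecutive entries, which gives a constant factor of its word. Thus
    [sup la] is the word of [U_la], and the blocks are its runs when no part is 0. *)
Definition blocks (la : seq nat) : seq (seq nat) :=
  [seq nseq (nth 0 la r) r | r <- iota 0 (size la)].

Definition sup (la : seq nat) : seq nat := flatten (blocks la).

Lemma size_blocks la : size (blocks la) = size la.
Proof. by rewrite size_map size_iota. Qed.

Lemma nth_blocks la r : r < size la -> nth [::] (blocks la) r = nseq (nth 0 la r) r.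
Proof. by move=> lt_r; rewrite (nth_map 0) ?size_iota // nth_iota. Qed.

Lemma blocks_rcons la x : blocks (rcons la x) = rcons (blocks la) (nseq x (size la)).
Proof.
rewrite /blocks size_rcons -addn1 iotaD map_cat /= add0n nth_rcons ltnn eqxx cats1.
by congr rcons; apply/eq_in_map => r; rewrite mem_iota nth_rcons => /= ->.
Qed.

Lemma sup_rcons la x : sup (rcons la x) = sup la ++ nseq x (size la).
Proof. by rewrite /sup blocks_rcons flatten_rcons. Qed.

Lemma take_blocks i la : take i (blocks la) = blocks (take i la).
Proof.
elim/last_ind: la => [//|la x IHla]; have [le_i|] := leqP i (size la).
  by rewrite blocks_rcons -!cats1 !takel_cat ?size_blocks.
by move=> lt_i; rewrite !take_oversize // ?size_blocks size_rcons.
Qed.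

Lemma count_sup r la : count_mem r (sup la) = nth 0 la r.
Proof.
elim/last_ind: la => [|la x IHla]; first by rewrite nth_nil.
rewrite sup_rcons count_cat IHla count_nseq nth_rcons /=.
by case: ltngtP => [|lt_r|->]; rewrite ?addn0 // nth_default ?mul1n // ?leqnn // ltnW.
Qed.

Lemma size_sup la : size (sup la) = sumn la.
Proof.
by elim/last_ind: la => // la x IHla; rewrite sup_rcons size_cat size_nseq IHla sumn_rcons.
Qed.

Lemma sup_sorted la : sorted leq (sup la).
Proof.
rewrite (sorted_pairwise leq_trans); elim/last_ind: la => // la x IHla.
rewrite sup_rcons pairwise_cat IHla /= andbC -(sorted_pairwise leq_trans); apply/andP; split.
  by case: x => //= x; elim: x => //= x IHx; rewrite leqnn.
apply/allrelP=> y z yla /nseqP[-> _]; rewrite leqNgt; apply: contraL yla => lt_y.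
by rewrite -has_pred1 has_count count_sup nth_default // ltnW.
Qed.

Lemma ballot_sup la : sorted geq la -> ballot (sup la).
Proof.
elim/last_ind: la => [_ [|k] r //|la x IHla sla]; rewrite sup_rcons.
have sla' : sorted geq la by move: sla; rewrite -cats1 => /cat_sorted2[].
apply: (ballot_cat (IHla sla')) => r; rewrite -sup_rcons !count_sup.
have := nth_geq_sorted sla (leqnSn r); rewrite size_rcons ltnS.
case: (ltnP r (size la)) => [lt_r /(_ isT)|le_r _]; first by rewrite [X in _ <= X]nth_rcons lt_r.
by rewrite nth_default // size_rcons ltnS.
Qed.

Lemma shape_tab_sup la : sorted geq la -> 0 \notin la -> shape (tab (sup la)) = la.
Proof.
move=> sla n0; have bs := ballot_sup sla.
have eq_h : height (sup la) = size la.
  apply/eqP; rewrite eqn_leq; apply/andP; split; rewrite leqNgt; apply/negP.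
    by rewrite ballot_height // -has_pred1 has_count count_sup nth_default.
  move=> lt_r; have: nth 0 la (height (sup la)) \in la by apply: mem_nth.
  suff -> : nth 0 la (height (sup la)) = 0 by apply/negP.
  by apply/eqP; rewrite -count_sup -leqn0 leqNgt -has_count has_pred1 -ballot_height // ltnn.
rewrite shape_tab eq_h -[RHS](mkseq_nth 0); apply: eq_map => r; exact: count_sup.
Qed.

Lemma tab_sorted v : sorted leq v -> tab v = superstd_rows (shape (tab v)).
Proof.
move=> sv; rewrite -{1}(flattenK (tab v)) /superstd_rows -size_flatten.
congr reshape; apply: (irr_sorted_eq (leT := ltn)).
- exact: ltn_trans.
- exact: ltnn.
- rewrite (sorted_pairwise ltn_trans) /tab; elim: (height v) 0 => //= m IHm i.
  rewrite pairwise_cat IHm -(sorted_pairwise ltn_trans) posn_sorted !andbT.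
  apply/allrelP=> x y; rewrite mem_posn => /andP[x_in /eqP wx] /flatten_mapP[r].
  rewrite mem_iota mem_posn => r_in /andP[y_in /eqP wy]; rewrite ltnNge; apply/negP=> le_yx.
  have: nth 0 v y.-1 <= nth 0 v x.-1; last by rewrite wx wy; lia.
  by apply: (sorted_leq_nth leq_trans leqnn 0 sv); rewrite ?inE; lia.
- exact: iota_ltn_sorted.
by move=> k; rewrite (perm_mem (perm_flatten_tab v)) (perm_size (perm_flatten_tab v)) size_iota.
Qed.

Lemma superstd_rows_tab la : sorted geq la -> 0 \notin la -> superstd_rows la = tab (sup la).
Proof.
by move=> sla n0; rewrite (tab_sorted (sup_sorted la)) shape_tab_sup.
Qed.

(** Superstandard means that the rows are filled one after the other from the bottom, so the row of
    the next entry never goes down. *)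
Lemma is_superstd_tab v : ballot v -> is_superstd (tab v) = sorted leq v.
Proof.
move=> bv; apply/eqP/idP; last exact: tab_sorted.
have /and4P[/and3P[sla n0 /eqP sz] _ _ _] := is_syt_tab bv.
have eq_sz : size v = size (sup (shape (tab v))) by rewrite size_sup.
rewrite superstd_rows_tab // => /(congr1 (word (size v))).
by rewrite (word_tab v) {1}eq_sz (word_tab (sup _)) => ->; apply: sup_sorted.
Qed.

(* The first [size la] runs of the tableau of [sup la ++ B ++ D] are
   superstandard, and the next one, [B], spoils this. *)
Record bad_form (la B D : seq nat) : Prop := BadForm {
  bad_sorted : sorted geq B;
  bad_top : size la \in B;
  bad_low : has (fun x => x < size la) B;
  bad_next : (D == [::]) || (last 0 B < head 0 D);
  bad_pos : 0 \notin la;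
  bad_ballot : ballot (sup la ++ B ++ D) }.

Lemma ballot_sup_cat_le la B x : sorted geq B -> ballot (sup la ++ B) -> x \in B -> x <= size la.
Proof.
move=> sB bB xB; rewrite leqNgt; apply/negP; case: x xB => // x xB; rewrite ltnS => le_x.
have := ballot_strip sB bB x; rewrite count_sup nth_default // leqn0 count_cat addn_eq0.
by rewrite -[count_mem _ B == 0]negbK -lt0n -has_count has_pred1 xB andbF.
Qed.

(** Induction on the runs, [la] collecting the superstandard ones. The third hypothesis records the
    ascent at the end of [la]; as a horizontal strip opens at most one new row, the next run starts
    with the letter [size la]. If it is constant it extends [la]; otherwise it also has a lower
    letter and is the bad run [B]. *)
Lemma sup_or_bad_run_factors (ws : seq (seq nat)) (la : seq nat) : run_factors ws -> 0 \notin la ->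
  [|| la == [::], ws == [::] | (size la).-1 < head 0 (flatten ws)] ->
  ballot (sup la ++ flatten ws) ->
  (exists2 la', 0 \notin la' & sup la ++ flatten ws = sup la') \/
  (exists la' B D, bad_form la' B D /\ sup la ++ flatten ws = sup la' ++ B ++ D).
Proof.
elim: ws la => [|s ws IHws] la rf n0 next_la bw; first by left; exists la; rewrite ?cats0.
case/and3P: rf => /= /andP[ss s_ws]; rewrite inE negb_or eq_sym => /andP[s0 n0_ws] lt_ws.
have rf : run_factors ws by rewrite /run_factors s_ws n0_ws (path_sorted lt_ws).
have s_gt0 : 0 < size s by case: (s) s0.
have head_s t : head 0 (s ++ t) = head 0 s by case: (s) s0.
have next_s : (ws == [::]) || (last 0 s < head 0 (flatten ws)).
  by case: (ws) n0_ws lt_ws => [|[|y t] ws'] //= _ /andP[].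
have bs : ballot (sup la ++ s) by move: bw; rewrite /= catA => /ballot_catl.
have le_s x : x \in s -> x <= size la by apply: ballot_sup_cat_le.
have [/all_pred1P eq_s|not_all] := boolP (all (pred1 (size la)) s).
  have {1 2}-> : sup la ++ s ++ flatten ws = sup (rcons la (size s)) ++ flatten ws.
    by rewrite sup_rcons -eq_s catA.
  apply: IHws => //.
  - by rewrite mem_rcons inE negb_or n0 eq_sym -lt0n s_gt0.
  - rewrite size_rcons /=; case/orP: next_s => [->|]; first by rewrite orbT.
    rewrite {1}eq_s; suff -> : last 0 (nseq (size s) (size la)) = size la by move->; rewrite !orbT.
    by case: (size s) s_gt0 => //= m _; elim: m.
  - by rewrite sup_rcons -eq_s -catA.
right; exists la, s, (flatten ws); split=> //; split=> //.
- have hs : head 0 s \in s by case: (s) s0 => //= x t _; rewrite mem_head.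
  move: next_la; rewrite /= head_s; case: eqP => [la0 _|_ /=].
    by have := le_s _ hs; rewrite la0 /= leqn0 => /eqP e0; rewrite -[X in X \in _]e0.
  have := le_s _ hs; rewrite leq_eqVlt => /orP[/eqP<- //|lt1].
  by rewrite (ltn_predK lt1) leqNgt lt1.
- case/allPn: not_all => x xs /= neq_x; apply/hasP; exists x => //.
  by rewrite ltn_neqAle neq_x le_s.
- by case/orP: next_s => [/eqP->|->]; rewrite ?orbT.
Qed.

Lemma sup_or_bad w : ballot w ->
  (exists2 la, 0 \notin la & w = sup la) \/
  (exists la B D, bad_form la B D /\ w = sup la ++ B ++ D).
Proof.
move=> bw; have [ws rf eq_w] := run_factors_exist w.
by have := @sup_or_bad_run_factors ws [::] rf isT isT; rewrite /= eq_w; apply.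
Qed.

(** * The operation relink on words *)

(** The letters of the two relinked runs in rows up to [i]. Rows count from 0 here and runs from 1
    in [relink], so row [i] stands for run [i.+1] and [B] is run [(size la).+1]; both shifts cancel
    in beta_j + i - j. *)
Definition low_word (la B : seq nat) (i : nat) : seq nat :=
  nseq (nth 0 la i) i ++ [seq x <- B | x <= i].

Definition relink_word (la B D : seq nat) (i : nat) : seq nat :=
  let u := low_word la B i in
  let d := size B + i - size la in
  sup (take i la) ++ take d u ++ flatten (drop i.+1 (blocks la)) ++
  ([seq x <- B | i < x] ++ drop d u) ++ D.

Lemma nseq_sorted m x : sorted geq (nseq m x).
Proof. by case: m => //= m; elim: m => //= m ->; rewrite leqnn. Qed.

Lemma sorted_geq_cat s t : sorted geq s -> sorted geq t ->
  (forall x y, x \in s -> y \in t -> y <= x) -> sorted geq (s ++ t).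
Proof.
rewrite !(sorted_pairwise geq_trans) pairwise_cat => -> -> le_ts; rewrite !andbT.
by apply/allrelP=> x y xs yt; apply: le_ts.
Qed.

Lemma low_word_sorted la B i : sorted geq B -> sorted geq (low_word la B i).
Proof.
move=> sB; apply: sorted_geq_cat; first exact: nseq_sorted.
  exact/sorted_filter/sB/geq_trans.
by move=> x y /nseqP[-> _]; rewrite mem_filter => /andP[].
Qed.

Lemma count_low_word la B i r :
  count_mem r (low_word la B i) = (r == i) * nth 0 la i + (r <= i) * count_mem r B.
Proof.
rewrite count_cat count_nseq /= eq_sym; congr (_ + _); rewrite count_filter.
case: leqP => [le_r|lt_r]; rewrite ?mul1n ?mul0n.
  by apply: eq_count => x /=; case: eqP => // ->.
by apply/eqP; rewrite -leqn0 leqNgt -has_count; apply/hasPn=> x _ /=; case: eqP => // ->; rewrite leqNgt lt_r.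
Qed.

Lemma perm_relink_word la B D i : sorted geq B -> i < size la ->
  perm_eq (relink_word la B D i) (sup la ++ B ++ D).
Proof.
move=> sB lt_i; apply/permP=> p; rewrite /relink_word !count_cat.
set u := low_word la B i; set d := _ - _.
have := count_cat p (take d u) (drop d u); rewrite cat_take_drop {1}/u count_cat.
have := congr1 (count p) (geq_filter_cat i sB); rewrite count_cat.
have : count p (sup la) = count p (sup (take i la)) + count p (nseq (nth 0 la i) i) +
    count p (flatten (drop i.+1 (blocks la))).
  rewrite /sup -take_blocks -{1}(cat_take_drop i (blocks la)).
  by rewrite (drop_nth [::]) ?size_blocks // nth_blocks // flatten_cat !count_cat /= addnA.
lia.
Qed.

Lemma height_subset (v w : seq nat) : {subset v <= w} -> height v <= height w.
Proof.
elim: v => //= x v IHv sub_w; rewrite geq_max ltn_height ?sub_w ?mem_head //=.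
by apply: IHv => y yv; rewrite sub_w // inE yv orbT.
Qed.

Lemma perm_shape_tab v w : perm_eq v w -> shape (tab v) = shape (tab w).
Proof.
move=> pvw; rewrite !shape_tab (_ : height v = height w).
  by apply: eq_map => r; rewrite (permP pvw).
by apply/eqP; rewrite eqn_leq !height_subset // => x; rewrite (perm_mem pvw).
Qed.

Lemma take_flatten (T : Type) p (ws : seq (seq T)) :
  take (size (flatten (take p ws))) (flatten ws) = flatten (take p ws).
Proof. by rewrite -{2}(cat_take_drop p ws) flatten_cat take_size_cat. Qed.

Lemma nth_take_if p (la : seq nat) r :
  nth 0 (take p la) r = if r < p then nth 0 la r else 0.
Proof.
case: ltnP => [lt_rp|le_pr]; first exact: nth_take.
by rewrite nth_default // size_take; case: ltnP => // h; apply: leq_trans le_pr.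
Qed.

Lemma count_drop_blocks p la r :
  count_mem r (flatten (drop p (blocks la))) = if p <= r then nth 0 la r else 0.
Proof.
have := count_sup r la; rewrite /sup -{1}(cat_take_drop p (blocks la)) flatten_cat count_cat.
by rewrite take_blocks -/(sup _) count_sup nth_take_if; case: ltnP => _; lia.
Qed.

Section BadForm.

Variables (la B D : seq nat) (bf : bad_form la B D).
Let k := size la.
Let w := sup la ++ B ++ D.

Lemma bad_sup_ballot : ballot (sup la ++ B).
Proof. by have := bad_ballot bf; rewrite catA => /ballot_catl. Qed.

Lemma bad_mem_le x : x \in B -> x <= k.
Proof. by apply: ballot_sup_cat_le; [apply: bad_sorted bf|apply: bad_sup_ballot]. Qed.

Lemma bad_size_gt0 : 0 < k.
Proof. by have /hasP[x _ lt_x] := bad_low bf; apply: leq_ltn_trans lt_x. Qed.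

Lemma bad_la_sorted : sorted geq la.
Proof.
apply/(sortedP 0) => i _; rewrite -!count_sup; apply: ballot_count.
exact: ballot_catl bad_sup_ballot.
Qed.

(* Run [(size la).+1] is a horizontal strip. *)
Lemma bad_strip r : nth 0 la r.+1 + count_mem r.+1 B <= nth 0 la r.
Proof.
by have := ballot_strip (bad_sorted bf) bad_sup_ballot r; rewrite count_cat !count_sup.
Qed.

Lemma bad_head : head 0 B = k.
Proof.
have := bad_top bf; have := bad_sorted bf; have := bad_mem_le.
rewrite -/k; case: (B) => //= x s le_x sx; rewrite inE => /orP[/eqP-> //|ks].
apply/eqP; rewrite eqn_leq le_x ?mem_head //=.
exact: (allP (order_path_min geq_trans sx)).
Qed.

Lemma bad_run_factors wsD : run_factors wsD -> flatten wsD = D ->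
  run_factors (blocks la ++ B :: wsD).
Proof.
case/and3P=> s_ws n0 lt_ws eqD; have B0 : B != [::] by have := bad_top bf; case: (B).
have la_gt0 r : r < k -> 0 < nth 0 la r.
  by move=> lt_r; rewrite lt0n; apply: contra (bad_pos bf) => /eqP<-; apply: mem_nth.
have last_nseq m (x : nat) : 0 < m -> last 0 (nseq m x) = x by case: m => //= m _; elim: m.
apply/and3P; split.
- rewrite all_cat /= s_ws (bad_sorted bf) !andbT; apply/allP=> s /mapP[r _ ->].
  exact: nseq_sorted.
- rewrite mem_cat inE negb_or negb_or eq_sym B0 n0 !andbT; apply/mapP=> -[r].
  by rewrite mem_iota /= => /la_gt0; case: (nth 0 la r).
have sorted_D : sorted (fun s t => last 0 s < head 0 t) (B :: wsD).
  have := bad_next bf; rewrite -eqD; case: (wsD) n0 lt_ws => //= -[//|x s] ws'.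
  by rewrite inE /= => _ -> ->.
have sorted_la : sorted (fun s t => last 0 s < head 0 t) (rcons (blocks la) B).
  apply/(sortedP [::]) => r; rewrite size_rcons size_blocks ltnS => lt_r.
  rewrite !nth_rcons size_blocks lt_r nth_blocks // last_nseq ?la_gt0 //.
  have [lt_r1|le_r1] := ltnP r.+1 (size la).
    by rewrite nth_blocks //; case: (nth 0 la r.+1) (la_gt0 _ lt_r1).
  by rewrite eqn_leq lt_r le_r1 /= bad_head.
by rewrite sorted_cat_cons sorted_la.
Qed.

Variable (i : nat) (lt_i : i < k).

(** The factors [ws'] of the new word may differ from its runs, since a boundary can fail to be an
    ascent; [of_runs_tab] asks only that they decrease. Each cell set is then compared with its
    window through the contents of the prefixes. *)
Lemma relink_tab : relink (size w) (tab w) i.+1 k.+1 = tab (relink_word la B D i).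
Proof.
have sB := bad_sorted bf; set u := low_word la B i; set d := size B + i - k.
have su : sorted geq u by apply: low_word_sorted.
have u_le r : i < r -> count_mem r (take d u) = 0.
  move=> lt_ir; apply/eqP; rewrite -leqn0.
  apply: leq_trans (_ : count_mem r u <= _).
    by rewrite -[X in _ <= count _ X](cat_take_drop d) count_cat leq_addr.
  by rewrite count_low_word (gtn_eqF lt_ir) [r <= i]leqNgt lt_ir.
have [wsD rfD eqD] := run_factors_exist D.
pose ws := blocks la ++ B :: wsD; have rf : run_factors ws by apply: bad_run_factors eqD.
have eq_w : w = flatten ws by rewrite flatten_cat /= eqD.
have ws0 : ws != [::] by rewrite /ws; case: (blocks la).
have sz_ws : size ws = k + (size wsD).+1 by rewrite size_cat size_blocks.
pose ws' := take i (blocks la) ++ take d u :: drop i.+1 (blocks la) ++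
  ([seq x <- B | i < x] ++ drop d u) :: wsD.
have eq_w' : relink_word la B D i = flatten ws'.
  by rewrite flatten_cat /= flatten_cat /= eqD take_blocks.
have sz_ws' : size ws' = size ws.
  rewrite sz_ws size_cat /= size_cat /= size_drop size_takel size_blocks ?(ltnW lt_i) //.
  by rewrite -/k; lia.
have take_ws p : p <= k -> flatten (take p ws) = sup (take p la).
  by move=> le_p; rewrite takel_cat ?size_blocks // take_blocks.
have take_ws_k p : flatten (take (k + p.+1) ws) = sup la ++ B ++ flatten (take p wsD).
  by rewrite take_cat size_blocks -/k ltnNge leq_addr addKn flatten_cat.
have take_ws_k1 : flatten (take k.+1 ws) = sup la ++ B.
  by rewrite -addn1 take_ws_k take0 cats0.
have take_ws'_i p : p <= i -> flatten (take p ws') = sup (take p la).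
  move=> le_p; rewrite takel_cat ?size_takel ?size_blocks ?(ltnW lt_i) //.
  by rewrite take_takel // take_blocks.
have take_ws'_k p : i < p <= k -> flatten (take p ws') =
    sup (take i la) ++ take d u ++ flatten (drop i.+1 (blocks (take p la))).
  case/andP=> lt_ip le_p; rewrite take_cat size_takel ?size_blocks ?(ltnW lt_i) //.
  rewrite ltnNge (ltnW lt_ip) /= -[p - i]prednK ?subn_gt0 // flatten_cat take_blocks /=.
  rewrite takel_cat; last by rewrite size_drop size_blocks; nlia.
  by rewrite take_drop take_blocks (_ : _ + _ = p) //; nlia.
(* Once both modified runs are included, prefixes have the same contents as before, so the later
   runs keep their cells. *)
have take_ws'_D p r : k < p ->
    count_mem r (flatten (take p ws')) = count_mem r (flatten (take p ws)).
  move=> lt_p; rewrite -(subnKC lt_p) addSnnS take_ws_k.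
  rewrite -(permP (perm_relink_word (flatten (take (p - k.+1) wsD)) sB lt_i)).
  congr (count _ _); rewrite /ws' /relink_word -/u -/d.
  rewrite take_cat size_takel ?size_blocks ?(ltnW lt_i) // ltnNge.
  rewrite (leq_trans (ltnW lt_i)) ?leq_addr //= flatten_cat take_blocks.
  have -> : k + (p - k.+1).+1 - i = (k - i.+1 + (p - k.+1).+1).+1 by nlia.
  rewrite /= take_cat size_drop size_blocks -/k ltnNge leq_addr /= addKn /=.
  by rewrite flatten_cat.
have eq_sh : shape (tab w) = shape (tab (relink_word la B D i)).
  by apply: perm_shape_tab; rewrite perm_sym perm_relink_word.
have mem_run_w p x : p < size ws -> (x \in run (size w) (tab w) p.+1) = (0 < x.1) &&
    (count_mem x.1.-1 (flatten (take p ws)) < x.2 <= count_mem x.1.-1 (flatten (take p.+1 ws))).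
  by move=> lt_p; rewrite (mem_run _ rf).
(* In [v] the two runs, restricted to the low rows, stand side by side: their cells form a single
   window, which the new runs split after [d] cells. *)
pose v := sup (take i la) ++ u; pose a := size (sup (take i la)).
have count_u r : count_mem r u = (r == i) * nth 0 la i + (r <= i) * count_mem r B.
  exact: count_low_word.
have count_v r : count_mem r v = count_mem r (sup (take i la)) + count_mem r u.
  exact: count_cat.
have count_w r : count_mem r w = nth 0 la r + count_mem r B + count_mem r D.
  by rewrite !count_cat count_sup addnA.
have take_v m : take (a + m) v = sup (take i la) ++ take m u.
  by rewrite takeD take_size_cat // drop_size_cat.
have take_a_v : take a v = sup (take i la) by rewrite take_size_cat.
have sz_v : size v = a + size u by rewrite size_cat.
rewrite /relink eq_sh eq_w'; set low := [seq x <- cells _ | _]; set high := [seq x <- run _ _ _ | _].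
have beta_k : beta (size w) (tab w) k.+1 = size B.
  by rewrite eq_w beta_tab //= nth_cat size_blocks ltnn subnn.
have eq_low : low = window v a (size v).
  apply: (irr_sorted_eq (leT := reads_before)).
  - exact: reads_before_trans.
  - exact: reads_before_irr.
  - exact/sorted_filter/sorted_cells/reads_before_trans.
  - by apply: sorted_window => //; rewrite take_size drop_size_cat.
  move=> x; rewrite mem_filter -eq_w' -eq_sh mem_cells mem_cat !mem_run_w ?sz_ws; try nlia.
  rewrite mem_window // take_size take_a_v take_ws_k1 !take_ws ?(ltnW lt_i) //.
  rewrite take_size count_v count_w !(count_cat _ (sup la)) !count_sup !nth_take_if count_u.
  case: x => -[|r] c //=.
  change (r.+1 < i.+2) with (r <= i); change (r < i.+1) with (r <= i).
  by case: (ltngtP r i) => [lt_r|gt_r|->]; rewrite ?mul1n ?mul0n ?add0n /=; nlia.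
have take_dE m : window v a (a + minn m (size u)) = take m low.
  rewrite eq_low /window -map_take take_iota sz_v; congr map; congr iota; lia.
have drop_dE m : window v (a + m) (size v) = drop m low.
  by rewrite eq_low /window -map_drop drop_iota sz_v; congr map; congr iota; lia.
have nb : nb_runs (size w) (tab w) = size ws by rewrite eq_w nb_runs_tab.
apply: of_runs_tab.
- have blk_sorted s : s \in blocks la -> sorted geq s.
    by case/mapP=> r _ ->; apply: nseq_sorted.
  have [s_wsD _ _] := and3P rfD; apply/allP=> s.
  rewrite mem_cat inE mem_cat inE => /or4P[/mem_take/blk_sorted //|/eqP->|/mem_drop/blk_sorted //|].
    exact: take_sorted.
  case/predU1P=> [->|/(allP s_wsD) //]; apply: sorted_geq_cat.
  + exact/sorted_filter/sB/geq_trans.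
  + exact: drop_sorted.
  move=> x y; rewrite mem_filter => /andP[lt_ix _] /mem_drop.
  rewrite mem_cat => /orP[/nseqP[-> _]|]; first exact: ltnW.
  by rewrite mem_filter => /andP[le_yi _]; apply: leq_trans le_yi (ltnW lt_ix).
- by rewrite size_map size_iota sz_ws' nb.
move=> p; rewrite sz_ws' => lt_p x; rewrite -eq_w' -eq_sh mem_cells => /andP[x_gt0 _].
rewrite eq_w' mem_window ?x_gt0; last first.
  by rewrite -{2}(cat_take_drop p.+1 ws') flatten_cat size_cat leq_addr.
rewrite !take_flatten (nth_map 0) ?size_iota ?nb // nth_iota // add1n.
have ltn_leqF m c : (m < c <= m) = false by lia.
rewrite !eqSS; case: eqP => [->|/eqP neq_pi].
  rewrite beta_k addnS subSS -/d -take_dE mem_window ?sz_v ?leq_add2l ?geq_minr //.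
  rewrite x_gt0 take_a_v take_v take_min take_size take_ws'_i // take_ws'_k ?ltnSn //.
  rewrite catA [in RHS]count_cat count_drop_blocks nth_take_if ltnS.
  by case: (ltngtP i x.1.-1) => _; rewrite ?addn0.
case: eqP => [->|/eqP neq_pk].
  rewrite beta_k addnS subSS -/d mem_cat -drop_dE mem_window // mem_filter mem_run_w; last first.
    by rewrite sz_ws; lia.
  rewrite x_gt0 take_v take_size take_ws'_k ?lt_i ?leqnn // take_ws // take_ws'_D // take_ws_k1.
  rewrite count_v take_size !(count_cat _ (sup _)) !(count_cat _ (take d u)) !count_sup count_u.
  rewrite count_drop_blocks !nth_take_if.
  case: x x_gt0 => -[//|r] c _ /=; change (i.+1 < r.+1) with (i < r).
  case: (ltngtP r i) => [lt_r|gt_r|->]; rewrite ?mul1n ?mul0n ?add0n ?addn0 ?orbF //=.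
  by rewrite u_le // ltn_leqF.
rewrite mem_run_w // x_gt0 /=.
case: (ltngtP p i) neq_pi => // [lt_pi _|lt_ip _].
  by rewrite !take_ws'_i ?(ltnW lt_pi) // !take_ws //; lia.
case: (ltngtP p k) neq_pk => // [lt_pk _|lt_kp _]; last first.
  by rewrite !take_ws'_D // ltnW.
have lt_ip1 : i < p.+1 by apply: ltnW.
rewrite !take_ws'_k ?lt_ip ?lt_ip1 ?lt_pk ?(ltnW lt_pk) // !take_ws ?(ltnW lt_pk) //.
rewrite !(count_cat _ (sup _)) !(count_cat _ (take d u)) !count_sup !count_drop_blocks !nth_take_if.
(* A run strictly between the two has no cell in the rows up to [i], and in the rows above [i] the
   part taken from [u] has no letter. *)
case: (leqP x.1.-1 i) => [le_r|gt_r]; last by rewrite u_le // [_ < i]ltnNge (ltnW gt_r).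
by rewrite (leq_ltn_trans le_r lt_ip) (leq_ltn_trans le_r lt_ip1) !ltn_leqF.
Qed.

End BadForm.

(** * The map slink_* on words *)

Lemma filter_posn r w b : [seq x <- posn r w | x <= b] = posn r (take b w).
Proof.
apply: (irr_sorted_eq (leT := ltn)).
- exact: ltn_trans.
- exact: ltnn.
- exact/sorted_filter/posn_sorted/ltn_trans.
- exact: posn_sorted.
move=> k; rewrite mem_filter !mem_posn size_take_min leq_min.
case: (leqP k b) => [le_k|_]; last by rewrite andbF.
by rewrite /=; case: k le_k => // k lt_k; rewrite nth_take.
Qed.

Lemma trunc_tab w b : ballot w -> trunc b (tab w) = tab (take b w).
Proof.
move=> bw; rewrite /trunc /tab -map_comp.
rewrite (eq_map (g := fun r => posn r (take b w))) => [|r]; last exact: filter_posn.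
have le_h : height (take b w) <= height w by apply: height_subset => x /mem_take.
rewrite -(subnKC le_h) iotaD map_cat filter_cat add0n.
rewrite [X in X ++ _](_ : _ = tab (take b w)); last first.
  apply/all_filterP/allP=> _ /mapP[r r_in ->]; rewrite -size_eq0 size_posn -lt0n -has_count has_pred1.
  by rewrite -(ballot_height _ (ballot_take _ bw)); move: r_in; rewrite mem_iota.
rewrite [X in _ ++ X](_ : _ = [::]) ?cats0 //; apply/eqP; rewrite -(negbK (_ == _)) -has_filter.
apply/hasPn=> _ /mapP[r r_in ->]; rewrite negbK -size_eq0 size_posn; apply/eqP/count_memPn/negP.
by move/ltn_height; move: r_in; rewrite mem_iota; lia.
Qed.

(** Row [r], counted from 0, of the shape mu of the first [(size la).+1] runs. *)
Definition mu_row (la B : seq nat) (r : nat) : nat := nth 0 la r + count_mem r B.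

(** The choice of i in slink_*, with i and j both lowered by one; subtraction is avoided because
    beta_j + i - j may be negative. *)
Record star_row (la B : seq nat) (i : nat) : Prop := StarRow {
  star_lt : i < size la;
  star_le : mu_row la B i.+1 + size la <= size B + i;
  star_min : forall i', i' < i -> size B + i' < mu_row la B i'.+1 + size la }.

(** The new part fits in row [i] of mu, so the new run [i] consists of letters [i] only. In [B] only
    the number of letters [i] then changes, to what is left of row [i] of mu. *)
Definition star_part (la B : seq nat) (i : nat) : nat := size B + i - size la.

Definition star_la (la B : seq nat) (i : nat) : seq nat :=
  set_nth 0 la i (star_part la B i).

Definition star_run (la B : seq nat) (i : nat) : seq nat :=
  [seq x <- B | i < x] ++ nseq (mu_row la B i - star_part la B i) i ++ [seq x <- B | x < i].

Lemma low_wordE la B i : sorted geq B ->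
  low_word la B i = nseq (mu_row la B i) i ++ [seq x <- B | x < i].
Proof.
move=> sB; apply: sorted_geq_eq; first exact: low_word_sorted.
  apply: sorted_geq_cat; rewrite ?nseq_sorted ?(sorted_filter geq_trans) // => x y.
  by move=> /nseqP[-> _]; rewrite mem_filter => /andP[/ltnW].
move=> r; rewrite count_low_word count_cat count_nseq /= eq_sym count_filter /mu_row.
have -> : count (predI (pred1 r) (fun x => x < i)) B = (r < i) * count_mem r B.
  case: ltnP => lt_r; rewrite ?mul1n ?mul0n.
    by apply: eq_count => x /=; case: eqP => // ->.
  by rewrite (eq_count (a2 := pred0)) ?count_pred0 // => x /=; case: eqP => //= ->; rewrite ltnNge lt_r.
by case: ltngtP => [||->]; rewrite ?mul1n ?mul0n ?addn0.
Qed.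

Section BadForm.

Variables (la B D : seq nat) (bf : bad_form la B D).
Let k := size la.
Let w := sup la ++ B ++ D.
Let mu := mu_row la B.

Lemma first_bad_tab : first_bad (size w) (tab w) = Some k.+1.
Proof.
have [wsD rfD eqD] := run_factors_exist D.
pose ws := blocks la ++ B :: wsD; have rf : run_factors ws by apply: bad_run_factors eqD.
have eq_w : w = flatten ws by rewrite flatten_cat /= eqD.
have ws0 : ws != [::] by rewrite /ws; case: (blocks la).
have bw : ballot w := bad_ballot bf.
have nb : nb_runs (size w) (tab w) = k + (size wsD).+1.
  by rewrite eq_w nb_runs_tab // size_cat size_blocks.
have first_runs_w j : j <= k.+1 -> first_runs (size w) (tab w) j = tab (flatten (take j ws)).
  move=> le_j; rewrite /first_runs eq_w run_end_tab //; last by rewrite -nb_runs_tab // -eq_w nb; lia.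
  by rewrite -eq_w trunc_tab // eq_w take_flatten.
have b_take j : ballot (flatten (take j ws)) by rewrite -take_flatten -eq_w; apply: ballot_take.
rewrite /first_bad nb iotaD filter_cat (eq_in_filter (a2 := pred0)).
  rewrite filter_pred0 /= add1n first_runs_w // is_superstd_tab // ifT //.
  have -> : take k.+1 ws = rcons (blocks la) B by rewrite /ws -cat_rcons take_size_cat // size_rcons size_blocks.
  rewrite flatten_rcons (sorted_pairwise leq_trans) pairwise_cat !negb_and; apply/orP; right; apply/orP; right.
  have := bad_head bf; have /hasP[x] := bad_low bf; rewrite -(sorted_pairwise leq_trans).
  case: (B) => //= y s; rewrite inE => /predU1P[->|xs] lt_x eq_y; first by rewrite eq_y ltnn in lt_x.
  apply/negP=> /(order_path_min leq_trans)/allP/(_ x xs); rewrite eq_y /=; lia.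
move=> j; rewrite mem_iota => j_in; rewrite first_runs_w ?is_superstd_tab //; last by lia.
by rewrite takel_cat ?size_blocks ?take_blocks ?sup_sorted //; nlia.
Qed.

Lemma beta_bad : beta (size w) (tab w) k.+1 = size B.
Proof.
have [wsD rfD eqD] := run_factors_exist D.
have -> : w = flatten (blocks la ++ B :: wsD) by rewrite flatten_cat /= eqD.
rewrite beta_tab //; last exact: bad_run_factors eqD.
by rewrite nth_cat size_blocks ltnn subnn.
Qed.

Lemma slink_tab : slink (size w) (tab w) = tab (relink_word la B D k.-1).
Proof.
have k_gt0 : 0 < k by apply: bad_size_gt0 bf.
by rewrite /slink first_bad_tab /= -(relink_tab bf) prednK.
Qed.

Lemma slink_star_tab i : star_row la B i ->
  slink_star (size w) (tab w) = tab (relink_word la B D i).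
Proof.
case=> lt_i le_i min_i; rewrite /slink_star first_bad_tab; set j := head _ _.
suff -> : j = i.+1 by apply: relink_tab.
rewrite /j beta_bad.
have mu_E r : nth 0 (shape (first_runs (size w) (tab w) k.+1)) r = mu r.
  have [wsD rfD eqD] := run_factors_exist D.
  have eq_w : w = flatten (blocks la ++ B :: wsD) by rewrite flatten_cat /= eqD.
  rewrite /first_runs trunc_tab ?nth_shape_tab; last exact: bad_ballot.
  have := @run_end_tab _ (bad_run_factors bf rfD eqD) k.+1; rewrite -eq_w => ->.
  - by rewrite eq_w take_flatten -cat_rcons take_size_cat ?size_rcons ?size_blocks //
      flatten_rcons count_cat count_sup.
  - by case: (blocks la).
  - by rewrite size_cat size_blocks /= addnS ltnS leq_addr.
rewrite [X in iota 1 X](_ : _ = i + (k - i).+1); last by rewrite addnS subnKC // ltnW.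
rewrite iotaD filter_cat (eq_in_filter (a2 := pred0)).
  by rewrite filter_pred0 /= add1n mu_E -[_ <= _]/(mu i.+1 + k.+1 <= size B + i.+1) !addnS ltnS le_i.
move=> [|r]; rewrite mem_iota add1n ltnS //= => lt_r; rewrite mu_E; apply/negbTE.
by rewrite -ltnNge !addnS ltnS; apply: min_i.
Qed.

(** The last row [k.-1] always qualifies: [mu k] is the number of letters [k] in [B], and [B] also
    has a lower letter. *)
Lemma star_row_exists : exists i, star_row la B i.
Proof.
pose P i := (i < k) && (mu i.+1 + k <= size B + i).
have exP : exists i, P i.
  exists k.-1; have k_gt0 := bad_size_gt0 bf; rewrite /P prednK // leqnn /=.
  rewrite /mu /mu_row nth_default // add0n; suff : count_mem k B < size B by nlia.
  rewrite ltn_neqAle count_size andbT -all_count; have /hasP[x xB lt_x] := bad_low bf.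
  by apply/allPn; exists x; rewrite //= ltn_eqF.
case: (ex_minnP exP) => i /andP[lt_i le_i] min_i; exists i; split=> // r lt_r.
rewrite ltnNge; apply/negP=> le_r; have := min_i r; rewrite /P le_r andbT (ltn_trans lt_r lt_i).
by move/(_ isT); rewrite leqNgt lt_r.
Qed.

End BadForm.

(** * Involutivity of slink_* on the pair ([la], [B]) *)

Section BadForm.

Variables (la B D : seq nat) (bf : bad_form la B D).
Let k := size la.
Let mu := mu_row la B.

Lemma mu_row_le r : mu r.+1 <= nth 0 la r.
Proof. exact: bad_strip bf r. Qed.

Lemma mu_row_geq r s : r <= s -> mu s <= mu r.
Proof.
move/subnK<-; elim: (s - r) => //= m IHm; rewrite addSn.
by apply: leq_trans (leq_trans (mu_row_le _) (leq_addr _ _)) IHm.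
Qed.

Lemma size_filter_geq r (s : seq nat) :
  size [seq x <- s | r <= x] = count_mem r s + size [seq x <- s | r < x].
Proof.
rewrite !size_filter; elim: s => //= x s ->; rewrite addnACA; congr (_ + _).
by case: ltngtP.
Qed.

(** The cells of a horizontal strip lie in distinct columns, and those in rows at least [r] lie in
    columns at most [mu r]. The proof descends from row [k]. *)
Lemma size_filter_bad r : r <= k -> size [seq x <- B | r <= x] <= mu r.
Proof.
move=> le_r; rewrite -(subKn le_r); elim: (k - r) (leq_subr r k) => [_|m IHm lt_m].
  rewrite subn0 size_filter_geq /mu /mu_row nth_default // add0n.
  rewrite [X in _ + size X](eq_in_filter (a2 := pred0)) ?filter_pred0 ?addn0 // => x xB.
  by apply/negbTE; rewrite -leqNgt; apply: bad_mem_le bf _ xB.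
rewrite size_filter_geq [mu _]addnC leq_add2l; apply: leq_trans (mu_row_le _).
by rewrite -subSn // subSS; apply: IHm; apply: ltnW.
Qed.

Variables (i : nat) (si : star_row la B i).
Let d := star_part la B i.

Lemma star_partE : d + k = size B + i.
Proof. by rewrite subnK //; apply: leq_trans (star_le si); rewrite leq_addl. Qed.

Lemma star_part_ge : mu i.+1 <= d.
Proof. by rewrite -(leq_add2r k) star_partE; exact: star_le si. Qed.

(** For [i > 0] this is the failure of the condition at [i.-1]; for [i = 0] it holds because the
    whole strip [B] has at most [mu 0] cells. *)
Lemma star_part_le : d <= mu i.
Proof.
rewrite -(leq_add2r k) star_partE; case: (i) (star_min si) => [_|j /(_ j (ltnSn j))]; last by rewrite addnS.
rewrite addn0; apply: leq_trans (leq_addr _ _); apply: leq_trans (size_filter_bad (leq0n k)).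
by rewrite (eq_filter (a2 := predT)) ?filter_predT.
Qed.

Lemma star_part_gt0 : 0 < d.
Proof.
apply: leq_trans star_part_ge; have := star_lt si; rewrite leq_eqVlt => /orP[/eqP eq_i|lt_i].
  by rewrite /mu /mu_row eq_i nth_default // add0n -has_count has_pred1 (bad_top bf).
rewrite /mu /mu_row addn_gt0 lt0n; apply/orP; left; apply: contra (bad_pos bf) => /eqP<-.
exact: mem_nth.
Qed.

Lemma size_star_la : size (star_la la B i) = k.
Proof. by rewrite size_set_nth; apply/maxn_idPr; exact: star_lt si. Qed.

Lemma nth_star_la r : nth 0 (star_la la B i) r = if r == i then d else nth 0 la r.
Proof. exact: nth_set_nth. Qed.

Lemma count_star_run r :
  count_mem r (star_run la B i) = if r == i then mu i - d else count_mem r B.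
Proof.
rewrite !count_cat count_nseq /= eq_sym !count_filter.
case: (ltngtP r i) => [lt_r|gt_r|->]; rewrite ?mul0n ?mul1n ?add0n /=.
- rewrite [X in X + _](eq_count (a2 := pred0)) ?count_pred0 => [|x /=].
    by apply: eq_count => x /=; case: eqP => //= ->.
  by case: eqP => //= ->; rewrite ltnNge ltnW.
- rewrite addnC [X in X + _](eq_count (a2 := pred0)) ?count_pred0 => [|x /=].
    by apply: eq_count => x /=; case: eqP => //= ->.
  by case: eqP => //= ->; rewrite ltnNge ltnW.
rewrite !(eq_count (a2 := pred0)) ?count_pred0 ?addn0 // => x /=.
  by case: eqP => //= ->; rewrite ltnn.
by case: eqP => //= ->; rewrite ltnn.
Qed.

Lemma mem_star_run x : x \in B -> x != i -> x \in star_run la B i.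
Proof.
by rewrite -!has_pred1 !has_count => xB /negbTE neq_x; rewrite count_star_run neq_x.
Qed.

Lemma star_mu_row r : mu_row (star_la la B i) (star_run la B i) r = mu r.
Proof.
rewrite /mu_row nth_star_la count_star_run; case: eqP => [->|//].
by rewrite subnKC // star_part_le.
Qed.

Lemma star_run_sorted : sorted geq (star_run la B i).
Proof.
have sB := bad_sorted bf.
apply: sorted_geq_cat; first exact: (sorted_filter geq_trans).
  apply: sorted_geq_cat; rewrite ?nseq_sorted ?(sorted_filter geq_trans) // => x y.
  by move=> /nseqP[-> _]; rewrite mem_filter => /andP[/ltnW].
move=> x y; rewrite mem_filter mem_cat => /andP[/ltnW le_x _] /orP[/nseqP[-> _] //|].
by rewrite mem_filter => /andP[/ltnW le_y _]; apply: leq_trans le_y le_x.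
Qed.

Lemma relink_word_star :
  relink_word la B D i = sup (star_la la B i) ++ star_run la B i ++ D.
Proof.
have lt_i := star_lt si; have sB := bad_sorted bf.
rewrite /relink_word low_wordE // -/mu -/(star_part la B i) -/d.
have -> : sup (star_la la B i) = sup (take i la) ++ nseq d i ++ flatten (drop i.+1 (blocks la)).
  rewrite /sup -take_blocks -[nseq d i ++ _]/(flatten (nseq d i :: drop i.+1 (blocks la))).
  rewrite -flatten_cat; congr flatten; apply: (@eq_from_nth _ [::]).
    rewrite size_blocks size_star_la size_cat /= size_drop size_takel size_blocks ?(ltnW lt_i) //.
    by rewrite addnS -addSn subnKC.
  move=> r; rewrite size_blocks size_star_la => lt_r; rewrite nth_blocks ?size_star_la //.
  rewrite nth_star_la nth_cat size_takel ?size_blocks ?(ltnW lt_i) //.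
  case: ltngtP => [lt_ri|gt_ri|->]; last by rewrite subnn.
    by rewrite nth_take // nth_blocks.
  rewrite -[r - i]prednK ?subn_gt0 //= nth_drop (_ : _ + _ = r) ?nth_blocks //; lia.
have eq_nseq : nseq (mu i) i = nseq d i ++ nseq (mu i - d) i.
  by rewrite -nseqD subnKC // star_part_le.
rewrite eq_nseq -catA take_size_cat ?size_nseq // drop_size_cat ?size_nseq //.
by rewrite /star_run !catA.
Qed.

Lemma perm_star_run : perm_eq (sup (star_la la B i) ++ star_run la B i) (sup la ++ B).
Proof.
apply/allP=> r _ /=; rewrite !(count_cat _ (sup _)) !count_sup; apply/eqP; exact: star_mu_row.
Qed.

(** With [star_partE] this gives the exchange of the shifted parts beta_i - i and beta_j - j. *)
Lemma size_star_run : size (star_run la B i) + d = size B + nth 0 la i.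
Proof.
have := perm_size perm_star_run; rewrite !(size_cat (sup _)) !size_sup.
have := sumn_set_nth_ltn 0 d (star_lt si); rewrite -/(star_la la B i).
have : nth 0 la i <= sumn la by apply: leq_sumn; rewrite mem_nth ?(star_lt si).
lia.
Qed.

(** If all letters of [B] were at least [i], the strip bound would give [size B <= mu i = d],
    whereas [d = size B + i - k] is smaller. So when no letter [i] is left in the new run, it has a
    lower one. *)
Lemma star_low : d = mu i -> has (fun x => x < i) B.
Proof.
move=> eq_d; rewrite has_count lt0n; apply/eqP=> no_low.
have := size_filter_bad (ltnW (star_lt si)); rewrite size_filter.
have -> : count (fun x => i <= x) B = size B.
  rewrite -(count_predC (fun x => x < i) B) no_low add0n.
  by apply: eq_count => x /=; rewrite -leqNgt.
have := star_partE; have := star_lt si; rewrite eq_d -/mu -/k; lia.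
Qed.

Lemma last_sorted_geq (s : seq nat) x : sorted geq s -> x \in s -> last 0 s <= x.
Proof.
move=> ss xs; have lt_x : index x s < size s by rewrite index_mem.
rewrite -nth_last -[X in _ <= X](nth_index 0 xs); apply: nth_geq_sorted; rewrite // ?(ltn_predK lt_x) //.
by rewrite -ltnS (ltn_predK lt_x).
Qed.

(** This keeps an ascent in front of [D], so that the new bad run does not absorb letters of [D]. *)
Lemma last_star_run : last 0 (star_run la B i) <= last 0 B.
Proof.
have lastB : last 0 B \in B by have := bad_top bf; case: (B) => //= x s _; apply: mem_last.
apply: last_sorted_geq star_run_sorted _.
have [eq_l|neq_l] := eqVneq (last 0 B) i; last exact/mem_star_run/neq_l.
rewrite eq_l -has_pred1 has_count count_star_run eqxx subn_gt0 ltn_neqAle star_part_le andbT.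
apply/eqP=> /star_low /hasP[x xB]; rewrite -eq_l ltnNge => /negP[].
exact: last_sorted_geq (bad_sorted bf) xB.
Qed.

Lemma star_la_sorted : sorted geq (star_la la B i).
Proof.
apply/(sortedP 0) => r _; rewrite !nth_star_la /=.
case: (eqVneq r.+1 i) => [eq_i|_].
  rewrite (_ : (r == i) = false); last by rewrite -eq_i ltn_eqF.
  by apply: leq_trans star_part_le _; rewrite -eq_i; apply: mu_row_le.
case: eqP => [->|_]; last exact: leq_trans (leq_addr _ _) (mu_row_le r).
exact: leq_trans (leq_addr _ _) star_part_ge.
Qed.

Lemma bad_form_star : bad_form (star_la la B i) (star_run la B i) D.
Proof.
have lt_i := star_lt si; split.
- exact: star_run_sorted.
- by rewrite size_star_la; apply: mem_star_run (bad_top bf) _; rewrite gtn_eqF.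
- rewrite size_star_la; have [eq_d|neq_d] := eqVneq d (mu i).
    have /hasP[x xB lt_x] := star_low eq_d; apply/hasP; exists x; last exact: ltn_trans lt_i.
    by rewrite mem_star_run // ltn_eqF.
  apply/hasP; exists i => //; rewrite -has_pred1 has_count count_star_run eqxx subn_gt0.
  by rewrite ltn_neqAle neq_d star_part_le.
- have := bad_next bf; case: eqP => //= _; exact: leq_ltn_trans last_star_run.
- apply/negP=> /(nthP 0)[r]; rewrite size_star_la nth_star_la => lt_r.
  case: eqP => [_ d0|_ la0]; first by have := star_part_gt0; rewrite d0.
  by have /negP[] := bad_pos bf; rewrite -la0 mem_nth.
rewrite catA; apply: (ballot_perm_catr (u := sup la ++ B)).
- by rewrite perm_sym perm_star_run.
- apply: ballot_cat; first exact/ballot_sup/star_la_sorted.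
  move=> r; rewrite (permP perm_star_run) count_cat !count_sup nth_star_la -/(mu_row la B _) -/mu.
  by case: eqP => [->|_]; [exact: star_part_ge|exact: mu_row_le].
by rewrite -catA; apply: bad_ballot bf.
Qed.

(** The new run has size [nth 0 la i + k - i], so the threshold at row [r] is now
    [nth 0 la i + r - i], while mu is unchanged. At [r = i] it reaches [mu i.+1] by the strip
    condition; for [r < i] it is below [mu i], hence below [mu r.+1]. *)
Lemma star_row_star : star_row (star_la la B i) (star_run la B i) i.
Proof.
have lt_i := star_lt si; have eq_sz := size_star_run; have eq_d := star_partE.
split; first by rewrite size_star_la.
  by rewrite star_mu_row size_star_la; have := mu_row_le i; rewrite -/k in eq_d lt_i *; lia.
move=> r lt_r; rewrite star_mu_row size_star_la; have := mu_row_geq lt_r.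
by rewrite {1}/mu {1}/mu_row -/k in eq_d lt_i *; lia.
Qed.

Lemma star_part_star : star_part (star_la la B i) (star_run la B i) i = nth 0 la i.
Proof.
rewrite /star_part size_star_la; have := size_star_run; have := star_partE; lia.
Qed.

Lemma star_la_star : star_la (star_la la B i) (star_run la B i) i = la.
Proof.
rewrite /star_la star_part_star set_set_nth eqxx; apply: (@eq_from_nth _ 0).
  by rewrite size_set_nth; apply/maxn_idPr; exact: star_lt si.
by move=> r _; rewrite nth_set_nth /=; case: eqP => // ->.
Qed.

End BadForm.

Lemma star_run_star la B D i : bad_form la B D -> star_row la B i ->
  star_run (star_la la B i) (star_run la B i) i = B.
Proof.
move=> bf si; have bf' := bad_form_star bf si; have si' := star_row_star bf si.
apply: sorted_geq_eq; [exact: star_run_sorted bf' i|exact: bad_sorted bf|move=> r].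
rewrite !count_star_run (star_mu_row bf si) (star_part_star bf si).
by case: eqP => [->|//]; rewrite addKn.
Qed.

(** * Comparison of slink and slink_* *)

Lemma star_run_drop la B D i : bad_form la B D -> star_row la B i ->
  star_run la B i = [seq x <- B | i < x] ++ drop (star_part la B i) (low_word la B i).
Proof.
move=> bf si; rewrite low_wordE; last exact: bad_sorted bf.
rewrite /star_run -[in RHS](subnKC (star_part_le bf si)) nseqD -catA drop_size_cat //.
by rewrite size_nseq.
Qed.

Lemma count_filter_mem r (p : pred nat) (s : seq nat) :
  count_mem r [seq x <- s | p x] = p r * count_mem r s.
Proof.
elim: s => [|x s IHs] /=; first by rewrite muln0.
case: (eqVneq x r) => [->|/negbTE neq_x]; last by case: (p x) => /=; rewrite ?neq_x IHs.
by case: (p r) IHs => //= ->; rewrite eqxx !mul1n.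
Qed.

Lemma count_take_nseq s m e (t : seq nat) :
  minn e m <= count_mem s (take e (nseq m s ++ t)).
Proof.
rewrite take_cat size_nseq; case: ltnP => [lt_e|le_m].
  by rewrite take_nseq ?(ltnW lt_e) // count_nseq /= eqxx mul1n.
by rewrite count_cat count_nseq /= eqxx mul1n leq_addr.
Qed.

Section Slink.

Variables (la B D : seq nat) (bf : bad_form la B D).
Let k := size la.
Let mu := mu_row la B.
Let u := low_word la B k.-1.
Let d := (size B).-1.

(** With [k = size la], the word of slink has the superstandard start [slink_la], then the new run
    [k] of size beta_j - 1, then the new run [k.+1] followed by [D]. *)
Definition slink_la := take (size la).-1 la.
Definition slink_run := take (size B).-1 (low_word la B (size la).-1).
Definition slink_rest :=
  [seq x <- B | (size la).-1 < x] ++ drop (size B).-1 (low_word la B (size la).-1).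

Let k_gt0 : 0 < k := bad_size_gt0 bf.

Lemma bad_run_gt0 : 0 < size B.
Proof. by have := bad_top bf; case: (B). Qed.

Lemma relink_word_slink D' :
  relink_word la B D' k.-1 = sup slink_la ++ slink_run ++ slink_rest ++ D'.
Proof.
rewrite /relink_word (_ : _ - _ = d); last first.
  by have := bad_run_gt0; have := k_gt0; rewrite /d /k; lia.
by rewrite /slink_rest (prednK k_gt0) drop_oversize ?size_blocks.
Qed.

Lemma count_low_slink r :
  count_mem r u = if r < k.-1 then count_mem r B else if r == k.-1 then mu r else 0.
Proof.
rewrite count_low_word; case: (ltngtP r k.-1) => [_|_|->] //=; rewrite ?mul1n //.
Qed.

Lemma mu_top : mu k = count_mem k B.
Proof. by rewrite /mu /mu_row nth_default. Qed.

Lemma count_top_lt : count_mem k B < size B.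
Proof.
rewrite ltn_neqAle count_size andbT -all_count; have /hasP[x xB lt_x] := bad_low bf.
by apply/allPn; exists x; rewrite //= ltn_eqF.
Qed.

Lemma count_top_le : count_mem k B <= nth 0 la k.-1.
Proof. by rewrite -mu_top -{1}(prednK k_gt0); apply: mu_row_le bf _. Qed.

Lemma size_low_slink : size u + count_mem k B = size B + nth 0 la k.-1.
Proof.
rewrite size_cat size_nseq size_filter -addnA [RHS]addnC; congr (_ + _).
rewrite -(count_predC (fun x => x <= k.-1) B); congr (_ + _).
apply: eq_in_count => x /(bad_mem_le bf) le_x /=.
by rewrite -ltnNge prednK // eqn_leq le_x.
Qed.

Lemma size_slink_run : size slink_run = d.
Proof.
by apply: size_takel; have := size_low_slink; have := count_top_le; rewrite -/u /d; lia.
Qed.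

Lemma ballot_slink : ballot (sup slink_la ++ slink_run ++ slink_rest ++ D).
Proof.
have lek := leq_pred k.
have count_A r : count_mem r (sup slink_la) = if r < k.-1 then nth 0 la r else 0.
  by rewrite count_sup nth_take_if.
have count_run_le r : count_mem r slink_run <= count_mem r u.
  by rewrite -[X in _ <= count _ X](cat_take_drop d) count_cat leq_addr.
have ballot_A : ballot (sup slink_la).
  exact/ballot_sup/take_sorted/(bad_la_sorted bf).
have ballot_1 : ballot (sup slink_la ++ slink_run).
  apply: ballot_cat => // r; rewrite count_cat !count_A.
  apply: leq_trans (_ : (if r.+1 < k.-1 then nth 0 la r.+1 else 0) + count_mem r.+1 u <= _).
    by rewrite leq_add2l.
  rewrite count_low_slink; have := mu_row_le bf r; rewrite /mu /mu_row.
  by case: (ltngtP r.+1 k.-1) => [lt_r|gt_r|eq_r]; rewrite ?(ltnW lt_r) ?eq_r ?leqnn //; case: ifP.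
have perm_w : perm_eq (sup slink_la ++ slink_run ++ slink_rest) (sup la ++ B).
  have := perm_relink_word [::] (bad_sorted bf) (_ : k.-1 < size la).
  by rewrite relink_word_slink !cats0; apply; rewrite prednK.
have ballot_2 : ballot (sup slink_la ++ slink_run ++ slink_rest).
  rewrite catA; apply: ballot_cat => // r; rewrite -catA (permP perm_w) !count_cat count_A count_sup.
  have := mu_row_le bf r; rewrite -/mu /mu_row; have [lt_r le_mu|le_r le_mu] := ltnP r k.-1.
    exact: leq_trans le_mu (leq_addr _ _).
  move: le_r; rewrite leq_eqVlt => /orP[/eqP eq_r|gt_r].
    (* The letters [k] have to be matched by letters [k.-1] of [slink_run]. These come first in the
       low word, so at least [minn d (mu k.-1)] of them are taken, and both terms bound the number
       of letters [k]. *)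
    rewrite -eq_r prednK // -/(mu_row la B k) -/mu mu_top /slink_run low_wordE; last exact: bad_sorted bf.
    apply: leq_trans (count_take_nseq _ _ _ _); rewrite leq_min; apply/andP; split.
      by rewrite -ltnS prednK ?bad_run_gt0 // count_top_lt.
    by apply: leq_trans count_top_le _; rewrite /mu_row leq_addr.
  suff -> : nth 0 la r.+1 + count_mem r.+1 B = 0 by [].
  rewrite nth_default; last by rewrite -/k; lia.
  by apply/count_memPn/negP=> /(bad_mem_le bf); rewrite -/k; lia.
have -> : sup slink_la ++ slink_run ++ slink_rest ++ D =
  (sup slink_la ++ slink_run ++ slink_rest) ++ D by rewrite -!catA.
apply: (ballot_perm_catr (u := sup la ++ B)) ballot_2 _; first by rewrite perm_sym.
by rewrite -catA; apply: bad_ballot bf.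
Qed.

Lemma size_low_geq r : r <= k.-1 -> size [seq x <- u | r <= x] <= mu r.
Proof.
move=> le_r; rewrite -(subKn le_r); elim: (k.-1 - r) (leq_subr r k.-1) => [_|m IHm lt_m].
  rewrite subn0 size_filter_geq count_low_slink ltnn eqxx.
  rewrite [X in _ + size X](eq_in_filter (a2 := pred0)) ?filter_pred0 ?addn0 // => x.
  rewrite mem_cat ltnNge => /orP[/nseqP[-> _]|]; first by rewrite leqnn.
  by rewrite mem_filter => /andP[->].
have lt_r : k.-1 - m.+1 < k.-1 by lia.
rewrite size_filter_geq count_low_slink lt_r [mu _]addnC leq_add2l.
apply: leq_trans (mu_row_le bf _); rewrite -subSn // subSS; apply: IHm; exact: ltnW.
Qed.

Lemma filter_low_slink r : r < k.-1 ->
  [seq x <- u | x <= r] = nseq (count_mem r B) r ++ [seq x <- B | x < r].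
Proof.
move=> lt_r; rewrite /u /low_word filter_cat -filter_predI.
rewrite [X in X ++ _](eq_in_filter (a2 := pred0)) ?filter_pred0 => [|x /nseqP[-> _]]; last first.
  by rewrite /= leqNgt lt_r.
rewrite cat0s; apply: sorted_geq_eq; first exact/(sorted_filter geq_trans)/(bad_sorted bf).
  apply: sorted_geq_cat; rewrite ?nseq_sorted ?(sorted_filter geq_trans) ?(bad_sorted bf) // => x y.
  by move=> /nseqP[-> _]; rewrite mem_filter => /andP[/ltnW].
move=> s; rewrite count_cat count_nseq /= eq_sym !count_filter.
case: (ltngtP s r) => [lt_s|gt_s|->]; rewrite ?mul0n ?add0n ?mul1n.
- apply: eq_count => x /=; case: eqP => //= ->.
  by rewrite lt_s ltnW // (ltnW (ltn_trans lt_s lt_r)).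
- apply: eq_count => x /=; case: eqP => //= ->.
  by rewrite [s < r]ltnNge (ltnW gt_s) leqNgt gt_s.
rewrite [X in _ + X](eq_count (a2 := pred0)) ?count_pred0 ?addn0 => [|x /=].
  by apply: eq_count => x /=; case: eqP => //= ->; rewrite leqnn (ltnW lt_r).
by case: eqP => //= ->; rewrite ltnn.
Qed.

(** At most [nth 0 la r] letters of [u] exceed [r]. If the cut at [d] falls among them, then
    [d <= nth 0 la r]; otherwise at most [nth 0 la r] of the [d] letters are spent before the
    letters [r] begin. *)
Lemma count_slink_run_ge r : r < k.-1 ->
  minn d (mu r) <= nth 0 la r + count_mem r slink_run.
Proof.
have su : sorted geq u by apply: low_word_sorted (bad_sorted bf).
move=> lt_r; rewrite /slink_run -/u (geq_filter_cat r su) -/d.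
set G := [seq x <- u | r < x].
have le_G : size G <= nth 0 la r by apply: leq_trans (size_low_geq lt_r) (mu_row_le bf r).
rewrite filter_low_slink //.
rewrite take_cat; case: ltnP => [lt_d|le_d].
  by apply: leq_trans (geq_minl _ _) (leq_trans (leq_trans (ltnW lt_d) le_G) (leq_addr _ _)).
rewrite count_cat addnCA; apply: leq_trans (leq_addl _ _).
apply: leq_trans (leq_add (leqnn (nth 0 la r)) (count_take_nseq r _ _ _)).
move: le_G le_d; rewrite /mu /mu_row; move: (size G) (nth 0 la r) (count_mem r B) d; lia.
Qed.

Variables (i : nat) (si : star_row la B i) (lt_i : i < k.-1).

Lemma size_slink_la : size slink_la = k.-1.
Proof. by rewrite size_takel // leq_pred. Qed.

Lemma nth_slink_la r : nth 0 slink_la r = if r < k.-1 then nth 0 la r else 0.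
Proof. exact: nth_take_if. Qed.

Lemma head_slink_rest : head 0 (slink_rest ++ D) = k.
Proof.
rewrite /slink_rest -/k; set F := [seq x <- B | k.-1 < x].
have Fk x : x \in F -> x = k.
  rewrite mem_filter prednK // => /andP[ge_x /(bad_mem_le bf) le_x].
  by apply/eqP; rewrite eqn_leq le_x.
have : k \in F by rewrite mem_filter prednK // leqnn; apply: bad_top bf.
by case: F Fk => //= x s Fk _; apply: Fk; rewrite mem_head.
Qed.

Lemma slink_run_le x : x \in slink_run -> x <= k.-1.
Proof.
move/mem_take; rewrite mem_cat => /orP[/nseqP[-> _] //|].
by rewrite mem_filter => /andP[].
Qed.

(** For [i < k.-1] the number [d] exceeds [star_part la B i], which is at least [mu i.+1]. Hence
    [slink_run] cannot consist of letters [k.-1] only, and it is a bad run. *)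
Lemma slink_run_gt : mu k.-1 < d.
Proof.
have le1 : mu i.+1 <= star_part la B i := star_part_ge si.
have eq2 : star_part la B i + k = size B + i := star_partE si.
have le3 : mu k.-1 <= mu i.+1 := mu_row_geq bf lt_i.
by have := lt_i; rewrite /d; lia.
Qed.

Lemma bad_form_slink : bad_form slink_la slink_run (slink_rest ++ D).
Proof.
have sB := bad_sorted bf.
have la_gt0 : 0 < nth 0 la k.-1.
  rewrite lt0n; apply: contra (bad_pos bf) => /eqP<-; apply: mem_nth.
  by rewrite prednK.
split.
- exact/take_sorted/low_word_sorted.
- rewrite size_slink_la -has_pred1 has_count /slink_run low_wordE //.
  apply: leq_trans (count_take_nseq _ _ _ _); rewrite leq_min.
  by rewrite (leq_ltn_trans _ slink_run_gt) //= /mu_row addn_gt0 la_gt0.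
- rewrite size_slink_la; apply/negPn/negP=> /hasPn no_low.
  have := slink_run_gt; rewrite -size_slink_run ltnNge => /negP[].
  have -> : mu k.-1 = count_mem k.-1 u by rewrite count_low_slink ltnn eqxx.
  apply: leq_trans (_ : count_mem k.-1 slink_run <= _); last first.
    by rewrite -[X in _ <= count _ X](cat_take_drop d) count_cat leq_addr.
  rewrite leq_eqVlt eq_sym -all_count; apply/orP; left; apply/allP=> x xr /=.
  by rewrite eqn_leq slink_run_le //= leqNgt no_low.
- apply/orP; right; rewrite head_slink_rest -(ltn_predK (m := 0) k_gt0) ltnS.
  apply: slink_run_le; have := slink_run_gt; rewrite -size_slink_run.
  by case: slink_run => //= x s _; apply: mem_last.
- by apply/negP=> /mem_take; apply/negP; exact: bad_pos bf.
- exact: ballot_slink.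
Qed.

(** The threshold is the same, as the size of the bad run and its index both drop by one. Rows of mu
    can only shrink, and a row before the last is shortened no further than to [d], which is still
    above the threshold for [r < i]. *)
Lemma star_row_slink : star_row slink_la slink_run i.
Proof.
have eq_sz := size_slink_run; have k1 := k_gt0; have B1 := bad_run_gt0.
have eq_mu r : mu_row slink_la slink_run r <= mu r.
  rewrite /mu_row nth_slink_la; apply: leq_trans (_ : (if r < k.-1 then nth 0 la r else 0) + count_mem r u <= _).
    by rewrite leq_add2l -[X in _ <= count _ X](cat_take_drop d) count_cat leq_addr.
  by rewrite count_low_slink /mu /mu_row; case: ltngtP.
have lt_ik := lt_i; split; rewrite size_slink_la ?eq_sz //.
  have le1 := eq_mu i.+1; have le2 : mu i.+1 + k <= size B + i := star_le si.
  by rewrite /d; lia.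
move=> r lt_r; have le_mu : size B + r < mu r.+1 + k := star_min si lt_r.
have lt_rk : r.+1 < k.-1 by apply: leq_ltn_trans lt_i.
have := count_slink_run_ge lt_rk; rewrite /mu_row nth_slink_la lt_rk.
by move: (_ + count_mem _ slink_run) => X; rewrite /d; lia.
Qed.

Let d' := star_part la B i.
Let la' := star_la la B i.
Let B' := star_run la B i.
Let Y := nseq (mu i) i ++ [seq x <- B | x < i].
Let G := [seq x <- u | i < x].

(** [Y] is the low word cut by slink_* at row [i]. The low words cut by slink, before and after
    slink_*, are both [G] followed by a suffix of [Y], without its first [nth 0 la i] and [d']
    letters respectively; this is why the two maps commute. *)
Lemma low_slink_drop : u = G ++ drop (nth 0 la i) Y.
Proof.
have su : sorted geq u by apply: low_word_sorted (bad_sorted bf).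
rewrite {1}(geq_filter_cat i su) filter_low_slink // /Y.
by rewrite /mu /mu_row nseqD -catA drop_size_cat ?size_nseq.
Qed.

Lemma low_slink_star : low_word la' B' k.-1 = G ++ drop d' Y.
Proof.
have sB' := star_run_sorted bf i.
have le_d : d' <= mu i := star_part_le bf si.
rewrite /Y -(subnKC le_d) nseqD -catA drop_size_cat ?size_nseq //.
apply: sorted_geq_eq; first exact: low_word_sorted.
  apply: sorted_geq_cat.
  - exact/(sorted_filter geq_trans)/low_word_sorted/(bad_sorted bf).
  - apply: sorted_geq_cat; rewrite ?nseq_sorted ?(sorted_filter geq_trans) ?(bad_sorted bf) // => x y.
    by move=> /nseqP[-> _]; rewrite mem_filter => /andP[/ltnW].
  move=> x y; rewrite mem_filter => /andP[lt_x _]; rewrite mem_cat => /orP[/nseqP[-> _]|].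
    exact: ltnW.
  by rewrite mem_filter => /andP[lt_y _]; rewrite ltnW // (ltn_trans lt_y).
move=> r; rewrite count_low_word /la' /B' nth_star_la (gtn_eqF lt_i) count_star_run -/d'.
rewrite !count_cat count_nseq /= [i == r]eq_sym !count_filter_mem count_low_slink.
case: (ltngtP r i) => [lt_r|gt_r|->]; rewrite ?mul0n ?mul1n ?add0n.
- by rewrite ltn_eqF ?(ltn_trans lt_r lt_i) // ltnW ?(ltn_trans lt_r lt_i) // add0n mul1n.
- by rewrite addn0; case: (ltngtP r k.-1) => [_|_|->]; rewrite ?mul0n ?mul1n ?addn0.
by rewrite ltn_eqF // ltnW // mul1n addn0.
Qed.

End Slink.

Lemma relink_word_slink_star la B D i :
  bad_form la B D -> star_row la B i -> i < (size la).-1 ->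
  relink_word (slink_la la) (slink_run la B) (slink_rest la B ++ D) i =
  relink_word (star_la la B i) (star_run la B i) D (size la).-1.
Proof.
move=> bf si lt_i; set k := size la in lt_i *; set la' := star_la la B i; set B' := star_run la B i.
have bf' : bad_form la' B' D := bad_form_star bf si.
have sB := bad_sorted bf.
have sz_la' : size la' = k := size_star_la si.
rewrite (relink_word_star (bad_form_slink bf si lt_i) (star_row_slink bf si lt_i)).
rewrite -sz_la' (relink_word_slink bf').
have k_gt0 : 0 < k := bad_size_gt0 bf; have B_gt0 : 0 < size B := bad_run_gt0 bf.
have part_eq : star_part la B i + k = size B + i := star_partE si.
have sz_B' : size B' + star_part la B i = size B + nth 0 la i := size_star_run bf si.
have sz_run : size (slink_run la B) = (size B).-1 := size_slink_run bf.
set u := low_word la B k.-1; set Y := nseq (mu_row la B i) i ++ [seq x <- B | x < i].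
set G := [seq x <- u | i < x].
have uE : u = G ++ drop (nth 0 la i) Y := low_slink_drop bf lt_i.
have u'E : low_word la' B' k.-1 = G ++ drop (star_part la B i) Y := low_slink_star bf si lt_i.
have le_G : size G <= mu_row la B i.+1 := size_low_geq bf lt_i.
have le_la : mu_row la B i.+1 <= nth 0 la i := mu_row_le bf i.
have le_d : mu_row la B i.+1 <= star_part la B i := star_part_ge si.
have sz_B'_gt : nth 0 la i < size B' by nlia.
have filter_G : [seq x <- G | i < x] = G by rewrite -filter_predI; apply: eq_filter => x /=; rewrite andbb.
have filter_G' : [seq x <- G | x <= i] = [::].
  rewrite -filter_predI (eq_filter (a2 := pred0)) ?filter_pred0 // => x /=.
  by rewrite leqNgt; case: (i < x).
have Y_le x : x \in Y -> x <= i.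
  by rewrite mem_cat => /orP[/nseqP[-> _] //|]; rewrite mem_filter => /andP[/ltnW].
(* [G] fits entirely in [slink_run], its size being at most [star_part la B i], which is below
   [size B]; [x] letters of the suffix of [Y] follow. *)
set x := (size B).-1 - size G.
have runE : slink_run la B = G ++ take x (drop (nth 0 la i) Y).
  rewrite /slink_run -/k -/u uE take_cat ifF //; nlia.
have run_hi : [seq y <- slink_run la B | i < y] = G.
  rewrite runE filter_cat filter_G [X in _ ++ X](eq_in_filter (a2 := pred0)) ?filter_pred0 ?cats0 //.
  by move=> y /mem_take /mem_drop /Y_le le_y; rewrite ltnNge le_y.
have run_lo : [seq y <- slink_run la B | y <= i] = take x (drop (nth 0 la i) Y).
  rewrite runE filter_cat filter_G' /=; apply/all_filterP/allP.
  by move=> y /mem_take /mem_drop /Y_le.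
have la_eq : star_la (slink_la la) (slink_run la B) i = slink_la la'.
  rewrite /star_la /slink_la /star_part sz_run sz_la' -/k.
  apply: (@eq_from_nth _ 0); first by rewrite size_set_nth !size_takel ?leq_pred ?sz_la' ?leq_pred //; nlia.
  move=> r; rewrite nth_set_nth /= !nth_take_if nth_star_la /star_part size_takel ?leq_pred //.
  by case: eqP => [->|//]; rewrite lt_i -/k => _; nlia.
have run_eq : star_run (slink_la la) (slink_run la B) i = slink_run la' B'.
  rewrite (star_run_drop (bad_form_slink bf si lt_i) (star_row_slink bf si lt_i)) run_hi.
  have -> : star_part (slink_la la) (slink_run la B) i = star_part la B i.
    rewrite /star_part sz_run size_slink_la -/k; nlia.
  rewrite /low_word run_lo [in RHS]/slink_run sz_la' u'E take_cat ifF; last by nlia.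
  congr (_ ++ _); rewrite nth_take_if lt_i [RHS]take_drop.
  (* Both sides take from [Y] the letters after the first [star_part la B i], up to a common cut by
     [sz_B']. *)
  congr drop; rewrite (_ : _ + star_part la B i = nth 0 la i + x); last by rewrite /x; nlia.
  rewrite takeD; congr (_ ++ _); rewrite takel_cat ?size_nseq ?leq_addr //.
  by rewrite take_nseq ?leq_addr.
have rest_eq : slink_rest la B = slink_rest la' B'.
  rewrite /slink_rest sz_la' -/k u'E -/u uE; congr (_ ++ _).
    apply: sorted_geq_eq; first exact/(sorted_filter geq_trans)/sB.
      exact/(sorted_filter geq_trans)/(bad_sorted bf').
    move=> r; rewrite !count_filter_mem count_star_run; case: eqP => [->|//].
    by rewrite ltnNge (ltnW lt_i).
  have drop_G e s : size G <= e -> drop e (G ++ s) = drop (e - size G) s.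
    by move=> le_e; rewrite drop_cat ltnNge le_e.
  by rewrite !drop_G ?drop_drop; [congr drop| |]; nlia.
by rewrite la_eq run_eq rest_eq.
Qed.

(** * The equivalence relations *)

Lemma syt_of_word n w : ballot w -> size w = n -> exists T : syt n, rows T = tab w.
Proof. by move=> bw <-; exists (Syt (is_syt_tab bw)). Qed.

Lemma word_of_syt n (T : syt n) : exists w, [/\ ballot w, size w = n & rows T = tab w].
Proof.
have sT := valP T; exists (word n T).
by rewrite size_word tab_word //; split=> //; apply: ballot_word.
Qed.

Lemma size_tab_word n (T : syt n) w : rows T = tab w -> size w = n.
Proof.
move=> eqT; have /and4P[_ pT _ _] := valP T.
by rewrite -(size_iota 1 n) -(perm_size pT) /= eqT (perm_size (perm_flatten_tab w)) size_iota.
Qed.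

(** [T], [T1], [U1], [U] form the commuting square: slink leads from [T] to [T1] and from [U] to
    [U1], and slink_* from [T1] to [U1], where induction applies because [T1] has one superstandard
    run fewer. *)
Lemma slink_invariant_star n (X : Type) (C : syt n -> X) :
  (forall la B D (T U : syt n), bad_form la B D -> rows T = tab (sup la ++ B ++ D) ->
     rows U = tab (relink_word la B D (size la).-1) -> C T = C U) ->
  forall la B D i (T U : syt n), bad_form la B D -> star_row la B i ->
    rows T = tab (sup la ++ B ++ D) -> rows U = tab (relink_word la B D i) ->
    C T = C U.
Proof.
move=> Cslink la B D i; move: {2}(size la) (leqnn (size la)) => m.
elim: m la B D => [|m IHm] la B D le_m T U bf si eqT eqU.
  by have := bad_size_gt0 bf; rewrite leqn0 in le_m; rewrite (eqP le_m).
have szT := size_tab_word eqT.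
have le_i : i <= (size la).-1 by rewrite -ltnS prednK ?(bad_size_gt0 bf) ?(star_lt si).
case: (ltngtP i (size la).-1) le_i => // [lt_i _|eq_i _]; last first.
  by apply: (Cslink la B D) => //; rewrite -eq_i.
have bf1 := bad_form_slink bf si lt_i; have bf2 := bad_form_star bf si.
have [|T1 eqT1] := @syt_of_word n _ (bad_ballot bf1).
  by rewrite -(relink_word_slink bf) (perm_size (perm_relink_word _ (bad_sorted bf) _)) // prednK ?(bad_size_gt0 bf).
have eqU2 : rows U = tab (sup (star_la la B i) ++ star_run la B i ++ D).
  by rewrite eqU (relink_word_star bf si).
have sz2 : size (star_la la B i) = size la := size_star_la si.
have k_gt0 := bad_size_gt0 bf.
have [||U1 eqU1] := @syt_of_word n (relink_word (star_la la B i) (star_run la B i) D (size la).-1).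
- by rewrite -sz2 (relink_word_slink bf2); apply: ballot_slink.
- rewrite (perm_size (perm_relink_word _ (bad_sorted bf2) _)) ?sz2 ?prednK //.
  exact: size_tab_word eqU2.
rewrite (Cslink _ _ _ T T1 bf eqT); last by rewrite eqT1 (relink_word_slink bf).
rewrite (Cslink _ _ _ U U1 bf2 eqU2); last by rewrite eqU1 sz2.
have si1 := star_row_slink bf si lt_i.
apply: (IHm _ _ _ _ T1 U1 bf1 si1 eqT1); last by rewrite eqU1 relink_word_slink_star.
by rewrite size_slink_la; lia.
Qed.

(** * Elementary dual equivalences on words *)

Lemma posn_cat r X W : posn r (X ++ W) = posn r X ++ map (addn (size X)) (posn r W).
Proof.
rewrite /posn size_cat iotaD filter_cat; congr (_ ++ _).
  apply: eq_in_filter => j; rewrite mem_iota => j_in; rewrite nth_cat ifT //; lia.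
rewrite addnC iotaDl filter_map; congr map; apply: eq_in_filter => j.
rewrite mem_iota => j_in /=; rewrite nth_cat ifF; last by lia.
by congr (nth _ _ _ == _); lia.
Qed.

Lemma posn_cons r x W : posn r (x :: W) = nseq (x == r) 1 ++ map succn (posn r W).
Proof.
rewrite -cat1s posn_cat; congr (_ ++ _).
by rewrite /posn /=; case: eqP.
Qed.

Lemma of_rw_map f T : of_rw (shape T) (map f (rw T)) = map (map f) T.
Proof.
rewrite /of_rw /rw map_flatten (_ : rev (shape T) = shape (map (map f) (rev T))).
  by rewrite flattenK map_rev revK.
rewrite /shape -map_comp map_rev; congr rev.
by apply: eq_map => s /=; rewrite size_map.
Qed.

Lemma swap_values_tab X x y Y : x != y -> let a := (size X).+1 in
  of_rw (shape (tab (X ++ [:: x, y & Y]))) (swap_values a a.+1 (rw (tab (X ++ [:: x, y & Y])))) =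
  tab (X ++ [:: y, x & Y]).
Proof.
move=> neq_xy a; rewrite of_rw_map; set f := fun z => _.
have pw : perm_eq (X ++ [:: x, y & Y]) (X ++ [:: y, x & Y]).
  by rewrite perm_cat2l -(cat1s x) -(cat1s y) -[X in perm_eq _ X](cat1s y) -[X in perm_eq _ (_ ++ X)]cat1s perm_catCA.
have eq_h : height (X ++ [:: x, y & Y]) = height (X ++ [:: y, x & Y]).
  by apply/eqP; rewrite eqn_leq !height_subset // => z; rewrite (perm_mem pw).
rewrite /tab eq_h -map_comp; apply: eq_map => r /=.
rewrite !posn_cat !posn_cons !map_cat -!map_comp.
rewrite map_id_in; last first.
  move=> z; rewrite mem_posn => /andP[z_in _]; rewrite /f /a ifF; last by nlia.
  by rewrite ifF //; nlia.
congr (_ ++ _); rewrite catA [in RHS]catA; congr (_ ++ _); last first.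
  apply/eq_in_map => z; rewrite mem_posn => /andP[z_in _] /=.
  rewrite /f /a ifF; last by nlia.
  by rewrite ifF //; nlia.
have fa : f a = a.+1 by rewrite /f eqxx.
have fa1 : f a.+1 = a by rewrite /f eqxx gtn_eqF.
rewrite !map_nseq /= addn1 addn2 -/a fa fa1.
by case: (eqVneq x r) neq_xy => [->|_]; case: (eqVneq y r) => // ->; rewrite eqxx.
Qed.

(** For [i = (size X).+2] the reading word meets i + 1, i - 1, i in this order, so d_i exchanges i
    and i + 1, which are adjacent letters of the row word. *)
Lemma d_tab X x x' k Y : x' <= x -> x < k ->
  d (size X).+2 (tab (X ++ [:: x, x', k & Y])) = tab (X ++ [:: x, k, x' & Y]).
Proof.
move=> le_x lt_x; pose w := X ++ [:: x, x', k & Y]; rewrite -/w /d /d_word /=.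
have [trR irR sR] := rw_tab_sorted w.
have nth_w j : nth 0 w (size X + j) = nth 0 [:: x, x', k & Y] j.
  by rewrite nth_cat ltnNge leq_addr addKn.
have in_rw j : j < 3 -> (size X + j).+1 \in rw (tab w).
  by move=> lt_j; rewrite mem_rw_tab mem_iota size_cat /=; lia.
have idx a b : a < 3 -> b < 3 ->
  (index (size X + a).+1 (rw (tab w)) < index (size X + b).+1 (rw (tab w))) =
  row_before w (size X + a).+1 (size X + b).+1.
  by move=> lt_a lt_b; rewrite (sorted_index_ltn trR irR sR) ?in_rw.
have := idx 2 0 isT isT; have := idx 0 1 isT isT.
rewrite /row_before /= !nth_w /= addn0 !addn1 !addn2 lt_x => lt1 lt2.
have {}lt1 : index (size X).+1 (rw (tab w)) < index (size X).+2 (rw (tab w)).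
  by rewrite lt1 eq_sym ltnS ltnSn andbT orbC -leq_eqVlt.
move: lt1 lt2; set p := index (size X).+1 _; set q := index _.+2 _; set r := index _ _ => lt1 lt2.
rewrite /between (_ : _ || _ = false); last by lia.
rewrite (_ : _ || _ = true); last by lia.
have neq_x : x' != k by rewrite ltn_eqF // (leq_ltn_trans le_x).
by have := swap_values_tab (rcons X x) Y neq_x; rewrite !cat_rcons size_rcons.
Qed.

(** As [y] does not exceed [k], i + 1 is not an inverse descent of the tableau, so the guard of
    d_i^R is off. *)
Lemma dR_tab X x x' k y Y : x' <= x -> x < k -> y <= k ->
  let w := X ++ [:: x, x', k, y & Y] in
  dR (size w) (size X).+2 (tab w) = tab (X ++ [:: x, k, x', y & Y]).
Proof.
move=> le_x lt_x le_y w; rewrite /dR d_tab // ID_tab mem_filter ifF //.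
have nth_w j : nth 0 w (size X + j) = nth 0 [:: x, x', k, y & Y] j.
  by rewrite nth_cat ltnNge leq_addr addKn.
have := nth_w 2; have := nth_w 3; rewrite addn2 addn3 /= => -> ->.
by rewrite ltnNge le_y.
Qed.

Lemma ballot_rcons u z : ballot u ->
  (forall r, z = r.+1 -> count_mem r.+1 u < count_mem r u) -> ballot (rcons u z).
Proof.
move=> bu lt_z; rewrite -cats1; apply: ballot_cat => // r; rewrite count_cat /= addn0.
case: eqP => [/lt_z|_]; first by rewrite addn1.
by rewrite addn0; apply: ballot_count.
Qed.

Lemma ballot_rcons_lt u r : ballot (rcons u r.+1) -> count_mem r.+1 u < count_mem r u.
Proof.
by move/(@ballot_count _ r); rewrite -cats1 !count_cat /= eqxx eq_sym ltn_eqF // !addn0 addn1.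
Qed.

(** The only danger is [x' = k.-1], when [k] passes a letter that supports it; then [x = k.-1] as
    well, and [x] supports [k] instead. *)
Lemma ballot_move X x x' k Y : x' <= x -> x < k ->
  ballot (X ++ [:: x, x', k & Y]) -> ballot (X ++ [:: x, k, x' & Y]).
Proof.
move=> le_x lt_x; rewrite -!(cat_rcons _ X) -!(cat_rcons _ (rcons _ _)).
set u := rcons X x; set v := rcons (rcons u x') k => bv.
have bu3 : ballot v := ballot_catl bv.
have bu2 : ballot (rcons u x') by move: bu3; rewrite /v -cats1 => /ballot_catl.
have bu : ballot u by move: bu2; rewrite -cats1 => /ballot_catl.
have bX : ballot X by move: bu; rewrite /u -cats1 => /ballot_catl.
apply: ballot_perm_catr bv.
  by rewrite /v -!cats1 -!catA perm_cat2l perm_catC.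
apply: ballot_rcons => [|r eq_r].
  apply: ballot_rcons => // r eq_r; rewrite /v eq_r in bu3 lt_x.
  have := ballot_rcons_lt bu3; rewrite /u -!cats1 !count_cat /= !addn0.
  rewrite (ltn_eqF lt_x) (ltn_eqF (leq_ltn_trans le_x lt_x)) !addn0.
  have := ballot_count r bX; case: (eqVneq x' r) => [eq_x'|_ _]; last by rewrite addn0.
  by rewrite (_ : x = r) ?eqxx ?addn1 ?ltnS //; lia.
rewrite eq_r in bu2; have := ballot_rcons_lt bu2; rewrite -[rcons u k]cats1 !count_cat /= !addn0.
by rewrite !gtn_eqF ?addn0 //; lia.
Qed.

Section DualEquivalence.

Variables (n : nat) (X : Type) (C : syt n -> X).
Hypothesis CdR : forall i (T U : syt n), 2 <= i <= n - 2 -> rows U = dR n i T -> C T = C U.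

(** A chain of moves seen through [C]; the first two components are what the next move of the chain
    requires. *)
Definition same_value (v w : seq nat) : Prop :=
  [/\ perm_eq v w, ballot w & forall T U : syt n, rows T = tab v -> rows U = tab w -> C T = C U].

Lemma same_value_refl v : ballot v -> same_value v v.
Proof.
move=> bv; split=> // T U eqT eqU; congr C; apply: val_inj; by rewrite /= eqT eqU.
Qed.

Lemma same_value_trans u v w : size u = n -> same_value u v -> same_value v w -> same_value u w.
Proof.
move=> szu [puv bv Cuv] [pvw bw Cvw]; split=> //; first exact: perm_trans pvw.
move=> T U eqT eqU; have [|V eqV] := @syt_of_word n v bv; first by rewrite -(perm_size puv).
by rewrite (Cuv T V) // (Cvw V U).
Qed.

Lemma same_value_move Z x x' k y Y : x' <= x -> x < k -> y <= k ->
  let w := Z ++ [:: x, x', k, y & Y] in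
  size w = n -> ballot w -> same_value w (Z ++ [:: x, k, x', y & Y]).
Proof.
move=> le_x lt_x le_y w szw bw; split.
- by rewrite perm_cat2l perm_cons -(cat1s x') -(cat1s k) -(cat1s k) -(cat1s x') perm_catCA.
- exact: ballot_move bw.
move=> T U eqT eqU; apply: (@CdR (size Z).+2); first by rewrite -szw size_cat /=; lia.
by rewrite eqU eqT -szw dR_tab.
Qed.

(** The letter [k] passes the letters of [s] from the last to the first. Each move needs a letter in
    front of the one passed, so it stops behind [x]; the letter just passed plays the part of [y] in
    the next move. *)
Lemma same_value_shift Z x s k y Y : sorted geq (x :: s) -> x < k -> y <= k ->
  let w := Z ++ x :: s ++ [:: k, y & Y] in
  size w = n -> ballot w -> same_value w (Z ++ [:: x, k & s] ++ y :: Y).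
Proof.
elim/last_ind: s y Y => [|s z IHs] y Y ss lt_x le_y w szw bw; first exact: same_value_refl.
have ss' : sorted geq (x :: s) by move: ss; rewrite -rcons_cons -cats1 => /cat_sorted2[].
have all_le : all (geq x) (rcons s z) := order_path_min geq_trans ss.
have le_z : z <= last x s.
  by move: ss; rewrite /= rcons_path => /andP[].
have le_last : last x s <= x.
  have := mem_last x s; rewrite inE => /predU1P[->//|xs].
  by apply: (allP all_le); rewrite mem_rcons inE xs orbT.
have eq_w : w = (Z ++ belast x s) ++ [:: last x s, z, k, y & Y].
  by rewrite /w cat_rcons -cat_cons lastI cat_rcons catA.
have lt_l : last x s < k by apply: leq_ltn_trans le_last _.
have := @same_value_move (Z ++ belast x s) _ _ k y Y le_z lt_l le_y.
rewrite /= -eq_w => /(_ szw bw) step1; apply: (same_value_trans szw step1).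
have [p1 b1 _] := step1.
have eq_w1 : (Z ++ belast x s) ++ [:: last x s, k, z, y & Y] = Z ++ x :: s ++ [:: k, z, y & Y].
  by rewrite -catA -[belast x s ++ _]cat_rcons -lastI.
rewrite eq_w1 in b1 p1 *; rewrite cat_rcons.
apply: IHs => //; first by rewrite ltnW // (leq_ltn_trans le_z lt_l).
by rewrite -(perm_size p1).
Qed.

(* Moving the letters k to the left one step at a time connects every position of
   the block k^c inside a decreasing word x_1 x_2 ... to x_1 k x_2 k ... x_c k ... *)
Fixpoint interleave (c k : nat) (s : seq nat) : seq nat :=
  if c is c'.+1 then if s is x :: s' then [:: x, k & interleave c' k s'] else [::] else s.

Lemma same_value_interleave c k Z s t Y : sorted geq s -> all (gtn k) (s ++ t) ->
  c <= size s -> t != [::] ->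
  size (Z ++ s ++ nseq c k ++ t ++ Y) = n -> ballot (Z ++ s ++ nseq c k ++ t ++ Y) ->
  same_value (Z ++ s ++ nseq c k ++ t ++ Y) (Z ++ interleave c k (s ++ t) ++ Y).
Proof.
elim: c Z s => [|c IHc] Z s ss le_k le_c t0 szw bw.
  by rewrite /= -catA in szw bw *; apply: same_value_refl.
case: s ss le_k le_c szw bw => // x s ss /= /andP[lt_x le_k] le_c szw bw.
(* The letter after the first [k] is another [k] or the first letter of [t]; [t] is nonempty for
   this reason. *)
have [y [r [eq_r le_y]]] : exists y r, nseq c k ++ t ++ Y = y :: r /\ y <= k.
  case: (c) => [|c'] /=; last by exists k, (nseq c' k ++ t ++ Y).
  case: (t) t0 le_k => // y t' _ le_k; exists y, (t' ++ Y); split=> //.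
  by apply/ltnW/(allP le_k); rewrite mem_cat inE eqxx orbT.
rewrite eq_r in szw bw *.
have step1 := same_value_shift ss lt_x le_y szw bw; have [p1 b1 _] := step1.
apply: (same_value_trans szw step1).
have eq_w1 : Z ++ [:: x, k & s] ++ y :: r = (Z ++ [:: x; k]) ++ s ++ nseq c k ++ t ++ Y.
  by rewrite eq_r -!catA.
have -> : Z ++ [:: x, k & interleave c k (s ++ t) ++ Y] =
  (Z ++ [:: x; k]) ++ interleave c k (s ++ t) ++ Y by rewrite -catA.
rewrite eq_w1 in p1 b1 *; apply: IHc => //; first exact: path_sorted ss.
by rewrite -(perm_size p1).
Qed.

(** Between the same ends [A] and [D], both words consist of the decreasing word [u] with the block
    of all letters [k] of [B] inserted at two different places, so both lead to the same interleaved
    word. There is room because the number of these letters is at most the last part of [la] and at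
    most [size B - 1]. *)
Lemma dR_invariant_slink la B D (T U : syt n) : bad_form la B D ->
  rows T = tab (sup la ++ B ++ D) -> rows U = tab (relink_word la B D (size la).-1) ->
  C T = C U.
Proof.
move=> bf eqT eqU; have szT := size_tab_word eqT; have szU := size_tab_word eqU.
have k_gt0 := bad_size_gt0 bf; have sB := bad_sorted bf; have bw := bad_ballot bf.
rewrite (relink_word_slink bf) in eqU szU; have bw' := ballot_slink bf.
set k := size la in k_gt0 *; set u := low_word la B k.-1; set c := count_mem k B.
have hiE : [seq x <- B | k.-1 < x] = nseq c k.
  apply: sorted_geq_eq; rewrite ?nseq_sorted ?(sorted_filter geq_trans) // => r.
  rewrite count_filter_mem count_nseq /= prednK // [k == r]eq_sym.
  case: (ltngtP r k) => [_|lt_r|->]; rewrite ?mul1n ?mul0n //.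
  by apply/count_memPn/negP=> /(bad_mem_le bf); rewrite leqNgt lt_r.
set A := sup (slink_la la); set d := (size B).-1.
have supE : sup la = A ++ nseq (nth 0 la k.-1) k.-1.
  rewrite /A /sup /slink_la -take_blocks -{1}(cat_take_drop k.-1 (blocks la)) flatten_cat.
  rewrite (drop_nth [::]) ?size_blocks ?prednK // nth_blocks ?prednK //= drop_oversize ?size_blocks //.
  by rewrite cats0.
have u_lt : all (gtn k) u.
  have lt_k : k.-1 < k by rewrite prednK.
  apply/allP=> x; rewrite mem_cat mem_filter /= => /orP[/nseqP[-> _] //|/andP[le_x _]].
  exact: leq_ltn_trans lt_k.
have le_c := count_top_le bf; have lt_c := count_top_lt bf.
have szu : size u + c = size B + nth 0 la k.-1 := size_low_slink bf.
have su : sorted geq u by apply: low_word_sorted.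
have wE : sup la ++ B ++ D =
    A ++ nseq (nth 0 la k.-1) k.-1 ++ nseq c k ++ [seq x <- B | x <= k.-1] ++ D.
  by rewrite supE {1}(geq_filter_cat k.-1 sB) hiE -!catA.
have wE' : sup (slink_la la) ++ slink_run la B ++ slink_rest la B ++ D =
    A ++ take d u ++ nseq c k ++ drop d u ++ D.
  by rewrite /slink_rest -/k hiE -!catA.
rewrite wE in eqT szT bw; rewrite wE' in eqU szU bw'.
have low0 : [seq x <- B | x <= k.-1] != [::].
  have /hasP[x xB lt_x] := bad_low bf; rewrite -has_filter; apply/hasP; exists x => //.
  by rewrite /= -ltnS prednK.
have drop0 : drop d u != [::].
  by rewrite -size_eq0 size_drop subn_eq0 -ltnNge; move: szu le_c; rewrite /d /c -/k; nlia.
have [|p1 b1 C1] := same_value_interleave (nseq_sorted _ _) u_lt _ low0 szT bw.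
  by rewrite size_nseq.
have [|||p2 _ C2] := @same_value_interleave c k A (take d u) (drop d u) D _ _ _ drop0 szU bw'.
- exact: take_sorted.
- by rewrite cat_take_drop.
- by rewrite size_takel /d; move: szu le_c lt_c; rewrite /c -/k; nlia.
have [|V eqV] := @syt_of_word n _ b1; first by rewrite -(perm_size p1).
by rewrite (C1 T V) // (C2 U V) // cat_take_drop.
Qed.

End DualEquivalence.

(** * Kostka numbers *)

Definition dec_blocks (g w : seq nat) : bool := all (sorted geq) (reshape g w).

Lemma mem_ascents w a : (a \in ascents w) = (0 < a < size w) && (nth 0 w a.-1 < nth 0 w a).
Proof.
by rewrite mem_filter mem_iota andbC; congr (_ && _); case: (size w) => [|m] //=; case: a.
Qed.

Lemma dec_blocksP g w : size w = sumn g ->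
  dec_blocks g w <-> {subset ascents w <= scanl addn 0 g}.
Proof.
rewrite /dec_blocks; elim: g w => [|m g IHg] w /= szw.
  by split=> // _ a; rewrite mem_ascents szw ltn0 andbF.
have sz_take : size (take m w) = m by rewrite size_takel // szw leq_addr.
have sz_drop : size (drop m w) = sumn g by rewrite size_drop szw addKn.
rewrite add0n scanl_addn; split=> [/andP[s_m /(IHg _ sz_drop) sub_g] a|sub_w].
  rewrite mem_ascents => /andP[a_in lt_a]; case: (ltngtP a m) => [lt_am|lt_ma|->]; last exact: mem_head.
    have := nth_geq_sorted s_m (leq_pred a); rewrite sz_take => /(_ lt_am).
    rewrite !nth_take //; last by rewrite (leq_ltn_trans (leq_pred a)).
    by rewrite leqNgt lt_a.
  rewrite inE; apply/orP; right; have [b eq_a] : exists b, a = m + b.+1.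
    by exists (a - m).-1; lia.
  have lt_b : b.+1 < sumn g by move: a_in; rewrite eq_a szw ltn_add2l => /andP[].
  rewrite eq_a; apply/map_f/sub_g; rewrite mem_ascents sz_drop !nth_drop lt_b /=.
  by rewrite -ltnS -eq_a; move: lt_a; rewrite {1}eq_a addnS.
have no_asc i : 0 < i < m -> nth 0 w i <= nth 0 w i.-1.
  move=> i_in; rewrite leqNgt; apply/negP=> lt_i; have := sub_w i.
  rewrite mem_ascents lt_i szw (_ : 0 < i < m + sumn g); last by lia.
  rewrite inE ltn_eqF; last by case/andP: i_in.
  by case/(_ isT)/mapP=> b _ eq_i; lia.
apply/andP; split.
  apply/(sortedP 0) => i; rewrite sz_take => lt_i /=.
  by rewrite !nth_take //; [apply: (no_asc i.+1)|apply: ltnW].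
apply/(IHg _ sz_drop) => a; rewrite mem_ascents sz_drop => /andP[a_in].
rewrite !nth_drop => lt_a; have := sub_w (m + a).
rewrite mem_ascents szw (_ : (m + a).-1 = m + a.-1) ?lt_a ?andbT; last by lia.
case/(_ _)/predU1P => [|eq_m|/mapP[b b_in /addnI->] //]; last by nlia.
by rewrite ltn_add2l; lia.
Qed.

Lemma dec_blocks_run_factors ws w : run_factors ws -> size w = size (flatten ws) ->
  dec_blocks (map size ws) w <-> {subset ascents w <= ascents (flatten ws)}.
Proof.
move=> rf szw; have [ws0|ws0] := eqVneq ws [::].
  by rewrite ws0 in szw *; split=> // _ a; rewrite mem_ascents szw; case: a.
have := run_ends_tab rf ws0; rewrite /run_ends ID_tab => -[eq_asc].
have := @dec_blocksP (map size ws) w; rewrite szw size_flatten => -[//|h1 h2].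
split=> [/h1 sub_w a a_in|sub_w].
  have := sub_w a a_in; rewrite -eq_asc mem_rcons inE => /predU1P[eq_a|//].
  by move: a_in; rewrite mem_ascents szw eq_a ltnn andbF.
by apply: h2 => a /sub_w a_in; rewrite -eq_asc mem_rcons inE a_in orbT.
Qed.

Lemma run_factors_blocks g : 0 \notin g -> run_factors (blocks g).
Proof.
move=> n0; have g_gt0 r : r < size g -> 0 < nth 0 g r.
  by move=> lt_r; rewrite lt0n; apply: contra n0 => /eqP<-; apply: mem_nth.
apply/and3P; split.
- by apply/allP=> s /mapP[r _ ->]; apply: nseq_sorted.
- by apply/mapP=> -[r]; rewrite mem_iota => /g_gt0; case: (nth 0 g r).
apply/(sortedP [::]) => r; rewrite size_blocks => lt_r; rewrite !nth_blocks ?(ltnW lt_r) //.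
have := g_gt0 _ (ltnW lt_r); have := g_gt0 _ lt_r.
case: (nth 0 g r.+1) => // m' _; case: (nth 0 g r) => // m _ /=.
by elim: m.
Qed.

Lemma map_size_blocks g : map size (blocks g) = g.
Proof.
rewrite /blocks -map_comp -[RHS](mkseq_nth 0); apply: eq_map => r /=.
by rewrite size_nseq.
Qed.

(** Each decreasing block is a horizontal strip and opens at most one new row. *)
Lemma dec_blocks_mem_lt g w : ballot w -> size w = sumn g -> dec_blocks g w ->
  forall k, {in flatten (take k (reshape g w)), forall x, x < k}.
Proof.
move=> bw szw dw; elim=> [|k IHk] x; first by rewrite take0.
case: (ltnP k (size (reshape g w))) => [lt_k|le_k]; last first.
  by rewrite take_oversize ?(leqW le_k) // => xw; apply/leqW/IHk; rewrite take_oversize.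
rewrite (take_nth [::]) // flatten_rcons mem_cat => /orP[/IHk/ltnW //|xs].
rewrite ltnS leqNgt; apply/negP; case: x xs => // r xs; rewrite ltnS => le_kr.
set u := flatten (take k _) in IHk; set s := nth [::] _ k in xs.
have ss : sorted geq s by apply: (allP dw); apply: mem_nth.
have bus : ballot (u ++ s).
  have : ballot (flatten (reshape g w)) by rewrite reshapeKr ?szw.
  by rewrite -(cat_take_drop k (reshape g w)) (drop_nth [::]) // flatten_cat /= catA => /ballot_catl.
have := ballot_strip ss bus r; rewrite count_cat leqNgt => /negP[].
have -> : count_mem r u = 0.
  by apply/count_memPn/negP=> /IHk; rewrite ltnNge le_kr.
by rewrite addn_gt0 -(has_count (pred1 r.+1) s) has_pred1 xs orbT.
Qed.

Lemma count_ltn_tab w k : count (gtn k) w = sumn (take k (shape (tab w))).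
Proof.
elim: k => [|k IHk]; first by rewrite take0 /= (eq_count (a2 := pred0)) ?count_pred0.
have -> : count (gtn k.+1) w = count (gtn k) w + count_mem k w.
  rewrite -count_predUI (eq_count (a1 := predI _ _) (a2 := pred0)) ?count_pred0 ?addn0.
    by apply: eq_count => x /=; rewrite ltnS leq_eqVlt orbC.
  by move=> x /=; case: ltngtP.
rewrite IHk; case: (ltnP k (size (shape (tab w)))) => [lt_k|le_k].
  by rewrite (take_nth 0) // sumn_rcons nth_shape_tab.
rewrite !take_oversize // ?(leq_trans le_k) //.
by rewrite -nth_shape_tab nth_default // addn0.
Qed.

Lemma sumn_take_reshape (g w : seq nat) k : size w = sumn g ->
  size (flatten (take k (reshape g w))) = sumn (take k g).
Proof. by move=> szw; rewrite size_flatten /shape map_take -/(shape _) reshapeKl ?szw. Qed.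

Lemma dec_blocks_dominance g w : ballot w -> size w = sumn g -> dec_blocks g w ->
  forall k, sumn (take k g) <= sumn (take k (shape (tab w))).
Proof.
move=> bw szw dw k; rewrite -(sumn_take_reshape k szw) -count_ltn_tab.
have all_lt := dec_blocks_mem_lt bw szw dw (k := k).
have eq_w : w = flatten (reshape g w) by rewrite reshapeKr ?szw.
rewrite {2}eq_w -{2}(cat_take_drop k (reshape g w)) flatten_cat count_cat.
apply: leq_trans (leq_addr _ _); rewrite (_ : count _ _ = size (flatten (take k (reshape g w)))) //.
by apply/eqP; rewrite -all_count; apply/allP=> x /all_lt.
Qed.

(** The equality case of dominance: the first [k] blocks already fill the first [k] rows, so block
    [k] has no room below row [k]. *)
Lemma dec_blocks_sup w : ballot w -> dec_blocks (shape (tab w)) w -> w = sup (shape (tab w)).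
Proof.
set g := shape (tab w) => bw dw.
have szw : size w = sumn g.
  by rewrite -size_flatten (perm_size (perm_flatten_tab w)) size_iota.
have eq_w : w = flatten (reshape g w) by rewrite reshapeKr ?szw.
rewrite eq_w; congr flatten; apply: (@eq_from_nth _ [::]); first by rewrite size_reshape size_blocks.
move=> k; rewrite size_reshape => lt_k; rewrite nth_blocks //.
set s := nth [::] _ k.
have sz_s : size s = nth 0 g k.
  by rewrite /s -(nth_map _ 0) ?size_reshape // -/(shape _) reshapeKl ?szw.
suff /all_pred1P-> : all (pred1 k) s by rewrite sz_s.
have split_w : w = flatten (take k (reshape g w)) ++ s ++ flatten (drop k.+1 (reshape g w)).
  by rewrite {1}eq_w -{1}(cat_take_drop k (reshape g w)) (drop_nth [::]) ?size_reshape // flatten_cat.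
apply/allP=> x xs /=; rewrite eqn_leq -ltnS.
rewrite (dec_blocks_mem_lt bw szw dw (k := k.+1)) /=; last first.
  by rewrite (take_nth [::]) ?size_reshape // flatten_rcons mem_cat xs orbT.
rewrite leqNgt; apply/negP=> lt_x.
have := count_ltn_tab w k; rewrite -/g -(sumn_take_reshape k szw) {1}split_w !count_cat.
have -> : count (gtn k) (flatten (take k (reshape g w))) = size (flatten (take k (reshape g w))).
  by apply/eqP; rewrite -all_count; apply/allP=> y; apply: dec_blocks_mem_lt.
have : 0 < count (gtn k) s by rewrite -has_count; apply/hasP; exists x.
lia.
Qed.

Lemma sup_dec_blocks la : dec_blocks la (sup la).
Proof.
rewrite /dec_blocks /sup -{1}(map_size_blocks la) flattenK.
by apply/allP=> s /mapP[r _ ->]; apply: nseq_sorted.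
Qed.

Lemma eq_nth_part (s t : seq nat) : 0 \notin s -> 0 \notin t -> nth 0 s =1 nth 0 t -> s = t.
Proof.
move=> s0 t0 eq_st.
have le_sz u v : 0 \notin u -> nth 0 u =1 nth 0 v -> size u <= size v.
  move=> u0 eq_uv; rewrite leqNgt; apply: contra u0 => lt_v.
  by rewrite -(nth_default 0 (leqnn (size v))) -eq_uv mem_nth.
apply: (@eq_from_nth _ 0) => [|i _]; last exact: eq_st.
by apply/eqP; rewrite eqn_leq !le_sz // => i; rewrite eq_st.
Qed.

(** * The Bender-Knuth involution *)

Definition dec_word (L : nat) (c : nat -> nat) : seq nat :=
  flatten (rev [seq nseq (c r) r | r <- iota 0 L]).

Lemma dec_wordS L c : dec_word L.+1 c = nseq (c L) L ++ dec_word L c.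
Proof. by rewrite /dec_word -addn1 iotaD map_cat rev_cat. Qed.

Lemma count_dec_word L c r : count_mem r (dec_word L c) = if r < L then c r else 0.
Proof.
elim: L => // L IHL; rewrite dec_wordS count_cat IHL count_nseq /= ltnS.
by case: (ltngtP r L) => [lt_r|lt_r|->]; rewrite ?mul1n ?addn0 // gtn_eqF.
Qed.

Lemma dec_word_sorted L c : sorted geq (dec_word L c).
Proof.
elim: L => // L IHL; rewrite dec_wordS; apply: sorted_geq_cat; rewrite ?nseq_sorted // => x y.
move=> /nseqP[-> _] yL; apply: ltnW; rewrite ltnNge; apply/negP=> le_y.
by have := count_dec_word L c y; rewrite ltnNge le_y; apply/eqP; rewrite -lt0n -has_count has_pred1.
Qed.

Lemma size_dec_word L c : size (dec_word L c) = \sum_(r < L) c r.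
Proof.
by elim: L => [|L IHL]; rewrite ?big_ord0 // dec_wordS big_ord_recr size_cat size_nseq IHL addnC.
Qed.

Lemma size_sum_count L (w : seq nat) : {in w, forall x, x < L} ->
  size w = \sum_(r < L) count_mem (r : nat) w.
Proof.
elim: w => [|x w IHw] lt_w; first by rewrite big1.
rewrite /= IHw => [|y yw]; last by rewrite lt_w // inE yw orbT.
have lt_x : x < L by rewrite lt_w ?mem_head.
rewrite big_split /= -add1n; congr (_ + _).
rewrite (bigD1 (Ordinal lt_x)) //= eqxx big1 // => r.
by rewrite -val_eqE /= eq_sym => /negbTE->.
Qed.

(* The middle shape [nu] of a chain of two horizontal strips from [ka] to [la]
   has [nu r] between [strip_lo] and [strip_hi]; it is reflected in each row. *)
Definition strip_lo (ka la : nat -> nat) (r : nat) : nat := maxn (ka r) (la r.+1).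

Definition strip_hi (ka la : nat -> nat) (r : nat) : nat :=
  if r is r'.+1 then minn (la r) (ka r') else la 0.

(** The lower bound in row [r] and the upper bound in row [r.+1] are the maximum and the minimum of
    the same two numbers, so the sum telescopes. *)
Lemma sum_strip (ka la : nat -> nat) L :
  \sum_(r < L) (strip_lo ka la r + strip_hi ka la r) + strip_hi ka la L =
  \sum_(r < L) (ka r + la r) + la L.
Proof.
elim: L => [|L IHL]; first by rewrite !big_ord0.
rewrite !big_ord_recr /=; move: IHL; rewrite [strip_lo ka la L]/strip_lo.
set s := \sum_(r < L) _; set t := \sum_(r < L) _; lia.
Qed.

Definition cont (w : seq nat) (r : nat) : nat := count_mem r w.

Definition bk_row (A B1 B2 : seq nat) (r : nat) : nat :=
  strip_lo (cont A) (cont (A ++ B1 ++ B2)) r + strip_hi (cont A) (cont (A ++ B1 ++ B2)) r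
  - cont (A ++ B1) r.

Definition bk1 (A B1 B2 : seq nat) : seq nat :=
  dec_word (height (A ++ B1 ++ B2)) (fun r => bk_row A B1 B2 r - cont A r).

Definition bk2 (A B1 B2 : seq nat) : seq nat :=
  dec_word (height (A ++ B1 ++ B2)) (fun r => cont (A ++ B1 ++ B2) r - bk_row A B1 B2 r).

Section BenderKnuth.

Variables (A B1 B2 : seq nat).
Hypotheses (s1 : sorted geq B1) (s2 : sorted geq B2) (bw : ballot (A ++ B1 ++ B2)).
Let ka := cont A.
Let nu := cont (A ++ B1).
Let la := cont (A ++ B1 ++ B2).
Let L := height (A ++ B1 ++ B2).
Let lo := strip_lo ka la.
Let hi := strip_hi ka la.
Let nu' := bk_row A B1 B2.

Lemma cont_height r : L <= r -> la r = 0.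
Proof. by move=> le_r; apply/count_memPn/negP=> /ltn_height; rewrite ltnNge le_r. Qed.

Lemma bk_ka_nu r : ka r <= nu r.
Proof. by rewrite /ka /nu /cont count_cat leq_addr. Qed.

Lemma bk_nu_la r : nu r <= la r.
Proof. by rewrite /nu /la /cont catA [X in _ <= X]count_cat leq_addr. Qed.

Lemma bk_bounds r : lo r <= nu r <= hi r.
Proof.
have strip1 := ballot_strip s1 (ballot_catl (_ : ballot ((A ++ B1) ++ B2))).
have strip2 : forall r, la r.+1 <= nu r.
  by rewrite /la catA; apply: (ballot_strip s2); rewrite -catA.
rewrite -catA in strip1; rewrite /lo /strip_lo geq_max bk_ka_nu strip2 /=.
by case: r => [|r]; rewrite /hi /strip_hi /= ?leq_min bk_nu_la //=; apply: strip1.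
Qed.

Lemma bk_rowE r : nu' r + nu r = lo r + hi r.
Proof.
by have /andP[h1 h2] := bk_bounds r; rewrite subnK // (leq_trans h2) ?leq_addl.
Qed.

Lemma bk_row_bounds r : lo r <= nu' r <= hi r.
Proof. by have := bk_bounds r; have := bk_rowE r; lia. Qed.

Lemma bk_row_ka r : ka r <= nu' r.
Proof. by have /andP[+ _] := bk_row_bounds r; apply: leq_trans; apply: leq_maxl. Qed.

Lemma bk_row_la r : nu' r <= la r.
Proof.
have /andP[_ le_hi] := bk_row_bounds r; apply: leq_trans le_hi _.
by case: r => //= r; apply: geq_minl.
Qed.

Lemma bk_row_height r : L <= r -> nu' r = 0.
Proof. by move=> le_r; apply/eqP; rewrite -leqn0 -(cont_height le_r) bk_row_la. Qed.

Lemma cont_bk1 r : cont (A ++ bk1 A B1 B2) r = nu' r.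
Proof.
rewrite /cont count_cat count_dec_word -/L; case: ltnP => [_|le_r].
  by rewrite subnKC // bk_row_ka.
have := bk_row_ka r; rewrite bk_row_height // leqn0 => /eqP; rewrite /ka /cont => ->.
by [].
Qed.

Lemma cont_bk2 r : cont (A ++ bk1 A B1 B2 ++ bk2 A B1 B2) r = la r.
Proof.
rewrite catA /cont count_cat -/(cont _ r) cont_bk1 count_dec_word -/L.
case: ltnP => [_|le_r]; first by rewrite subnKC // bk_row_la.
by rewrite addn0 bk_row_height // cont_height.
Qed.

Lemma perm_bk : perm_eq (A ++ bk1 A B1 B2 ++ bk2 A B1 B2) (A ++ B1 ++ B2).
Proof. by apply/allP=> r _ /=; apply/eqP; apply: cont_bk2. Qed.

Lemma ballot_bk : ballot (A ++ bk1 A B1 B2 ++ bk2 A B1 B2).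
Proof.
rewrite catA; apply: ballot_cat => [|r].
  apply: ballot_cat => [|r]; first exact: ballot_catl bw.
  rewrite -/(cont _ _) cont_bk1 -/(cont _ r) -/ka.
  by have /andP[_ /leq_trans] := bk_row_bounds r.+1; apply; apply: geq_minr.
rewrite -catA -/(cont _ _) cont_bk2 -/(cont _ r) cont_bk1.
by have /andP[+ _] := bk_row_bounds r; apply: leq_trans; apply: leq_maxr.
Qed.

(** Summing the reflection over all rows, the sizes of the two middle shapes add up to those of the
    two outer shapes; so the strips exchange their sizes. *)
Lemma size_bk1 : size (bk1 A B1 B2) = size B2.
Proof.
have lt_L : {in A ++ B1 ++ B2, forall x, x < L} by move=> x; apply: ltn_height.
have sum_la : size (A ++ B1 ++ B2) = \sum_(r < L) la r := size_sum_count lt_L.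
have sum_nu : size (A ++ B1) = \sum_(r < L) nu r.
  by apply: size_sum_count => x xw; apply: lt_L; rewrite catA mem_cat xw.
have sum_ka : size A = \sum_(r < L) ka r.
  by apply: size_sum_count => x xw; apply: lt_L; rewrite mem_cat xw.
have sum_lohi := sum_strip ka la L; rewrite -/lo -/hi in sum_lohi.
have : \sum_(r < L) (nu' r + nu r) = \sum_(r < L) (lo r + hi r).
  by apply: eq_bigr => r _; apply: bk_rowE.
have sum_1 : size (bk1 A B1 B2) + \sum_(r < L) ka r = \sum_(r < L) nu' r.
  rewrite size_dec_word -big_split /=; apply: eq_bigr => r _.
  by rewrite subnK // bk_row_ka.
have hiL : hi L = 0.
  apply/eqP; rewrite -leqn0 -(cont_height (leqnn L)) /hi.
  by case: (L) => //= m; apply: geq_minl.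
rewrite !big_split /= in sum_lohi *.
rewrite !size_cat in sum_la sum_nu; rewrite hiL (cont_height (leqnn L)) in sum_lohi.
rewrite -sum_ka -sum_la !addn0 in sum_1 sum_lohi.
rewrite -sum_1 -sum_nu sum_lohi; lia.
Qed.

Lemma size_bk2 : size (bk2 A B1 B2) = size B1.
Proof. by have := perm_size perm_bk; rewrite !size_cat size_bk1 => /addnI; rewrite addnC => /addIn. Qed.

End BenderKnuth.

Lemma bk_involutive A B1 B2 : sorted geq B1 -> sorted geq B2 -> ballot (A ++ B1 ++ B2) ->
  bk1 A (bk1 A B1 B2) (bk2 A B1 B2) = B1 /\ bk2 A (bk1 A B1 B2) (bk2 A B1 B2) = B2.
Proof.
move=> s1 s2 bw; have bw' := ballot_bk s1 s2 bw.
have s1' : sorted geq (bk1 A B1 B2) := dec_word_sorted _ _.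
have s2' : sorted geq (bk2 A B1 B2) := dec_word_sorted _ _.
have bkK r : bk_row A (bk1 A B1 B2) (bk2 A B1 B2) r = cont (A ++ B1) r.
  have := bk_rowE s1' s2' bw' r; have := bk_rowE s1 s2 bw r.
  rewrite cont_bk1 //.
  have -> : strip_lo (cont A) (cont (A ++ bk1 A B1 B2 ++ bk2 A B1 B2)) r =
     strip_lo (cont A) (cont (A ++ B1 ++ B2)) r by rewrite /strip_lo cont_bk2.
  have -> : strip_hi (cont A) (cont (A ++ bk1 A B1 B2 ++ bk2 A B1 B2)) r =
     strip_hi (cont A) (cont (A ++ B1 ++ B2)) r by case: r => [|r]; rewrite /strip_hi !cont_bk2.
  lia.
have count_1 r : count_mem r (bk1 A (bk1 A B1 B2) (bk2 A B1 B2)) = count_mem r B1.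
  apply/eqP; rewrite -(eqn_add2l (count_mem r A)) -!count_cat; apply/eqP.
  by rewrite -/(cont _ r) cont_bk1 // bkK.
split; apply: sorted_geq_eq; rewrite ?dec_word_sorted // => r.
apply/eqP; rewrite -(eqn_add2l (count_mem r (A ++ bk1 A (bk1 A B1 B2) (bk2 A B1 B2)))).
rewrite -count_cat -catA -/(cont _ r) cont_bk2 // cont_bk2 // /cont.
by rewrite !count_cat count_1 addnA.
Qed.

(** * Bender-Knuth moves on tableaux and symmetry of Kostka numbers *)

Lemma dec_blocks_cat (g1 g2 A W : seq nat) : size A = sumn g1 ->
  dec_blocks (g1 ++ g2) (A ++ W) = dec_blocks g1 A && dec_blocks g2 W.
Proof.
rewrite /dec_blocks; elim: g1 A => [|m g1 IHg] A /=; first by move/size0nil->.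
move=> szA; rewrite takel_cat; last by rewrite szA leq_addr.
rewrite -andbA; congr (_ && _); rewrite -IHg; last by rewrite size_drop szA addKn.
by rewrite drop_cat; case: ltngtP => // h; rewrite ?h ?subnn ?drop0 ?drop_size //; move: h; rewrite szA; lia.
Qed.

Definition bk_word (m a b : nat) (w : seq nat) : seq nat :=
  let A := take m w in
  let B1 := take a (drop m w) in
  let B2 := take b (drop a (drop m w)) in
  A ++ bk1 A B1 B2 ++ bk2 A B1 B2 ++ drop b (drop a (drop m w)).

Lemma bk_word_cat A B1 B2 D :
  bk_word (size A) (size B1) (size B2) (A ++ B1 ++ B2 ++ D) =
  A ++ bk1 A B1 B2 ++ bk2 A B1 B2 ++ D.
Proof.
by rewrite /bk_word !(take_size_cat, drop_size_cat).
Qed.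

Lemma dec_blocks_cat4 (g1 g2 A B1 B2 D : seq nat) : size A = sumn g1 ->
  dec_blocks (g1 ++ [:: size B1, size B2 & g2]) (A ++ B1 ++ B2 ++ D) =
  [&& dec_blocks g1 A, sorted geq B1, sorted geq B2 & dec_blocks g2 D].
Proof.
move=> szA; rewrite dec_blocks_cat //.
by rewrite /dec_blocks /= !(take_size_cat, drop_size_cat).
Qed.

Lemma bk_wordP (g1 g2 : seq nat) (a b : nat) w :
  ballot w -> size w = sumn (g1 ++ [:: a, b & g2]) -> dec_blocks (g1 ++ [:: a, b & g2]) w ->
  let w' := bk_word (sumn g1) a b w in
  [/\ ballot w', perm_eq w' w, dec_blocks (g1 ++ [:: b, a & g2]) w' &
      bk_word (sumn g1) b a w' = w].
Proof.
rewrite sumn_cat /= => bw szw dw.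
pose A := take (sumn g1) w; pose B1 := take a (drop (sumn g1) w).
pose B2 := take b (drop a (drop (sumn g1) w)); pose D := drop b (drop a (drop (sumn g1) w)).
have eq_w : w = A ++ B1 ++ B2 ++ D by rewrite !cat_take_drop.
have szA : size A = sumn g1 by rewrite size_takel // szw leq_addr.
have sz1 : size B1 = a by rewrite size_takel // size_drop szw addKn leq_addr.
have sz2 : size B2 = b by rewrite size_takel // !size_drop szw addKn addKn leq_addr.
move: bw dw; rewrite eq_w -szA -sz1 -sz2 bk_word_cat => bw.
rewrite dec_blocks_cat4 // => /and4P[dA s1 s2 dD].
have bw12 : ballot (A ++ B1 ++ B2) by apply: (@ballot_catl _ D); rewrite -!catA.
have pw := perm_bk s1 s2 bw12; have szbk1 := size_bk1 s1 s2 bw12; have szbk2 := size_bk2 s1 s2 bw12.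
have eq_cat X Y : A ++ X ++ Y ++ D = (A ++ X ++ Y) ++ D by rewrite -!catA.
split.
- rewrite eq_cat; apply: (ballot_perm_catr (u := A ++ B1 ++ B2)).
  + by rewrite perm_sym.
  + exact: ballot_bk.
  by rewrite -eq_cat.
- by rewrite !eq_cat perm_cat2r.
- by rewrite -szbk1 -szbk2 dec_blocks_cat4 // dA dD !dec_word_sorted.
rewrite -{1}szbk1 -{1}szbk2 bk_word_cat.
by have [-> ->] := bk_involutive s1 s2 bw12.
Qed.

(** Its cardinality is the Kostka number K_{mu,g}: by standardization, semistandard tableaux of
    content [g] correspond to the [T] whose inverse descents are partial sums of [g]. *)
Definition kostka_set n (mu g : seq nat) : {set syt n} :=
  [set T | (shape (rows T) == mu) && dec_blocks g (word n (rows T))].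

Lemma kostka_swap_leq n mu g1 a b g2 : sumn (g1 ++ [:: a, b & g2]) = n ->
  #|kostka_set n mu (g1 ++ [:: a, b & g2])| <= #|kostka_set n mu (g1 ++ [:: b, a & g2])|.
Proof.
move=> sumg; pose f x y (T : syt n) := insubd T (tab (bk_word (sumn g1) x y (word n (rows T)))).
have fE x y (T : syt n) : let w := word n (rows T) in let w' := bk_word (sumn g1) x y w in
    ballot w' -> perm_eq w' w -> rows (f x y T) = tab w' /\ word n (rows (f x y T)) = w'.
  move=> w w' bw' pw; have szw' : size w' = n by rewrite (perm_size pw) size_word.
  have eqf : rows (f x y T) = tab w' by rewrite /= val_insubd -{1}szw' is_syt_tab.
  by rewrite eqf -{1}szw' word_tab.
have inP x y (T : syt n) : sumn (g1 ++ [:: x, y & g2]) = n ->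
    T \in kostka_set n mu (g1 ++ [:: x, y & g2]) ->
    f x y T \in kostka_set n mu (g1 ++ [:: y, x & g2]) /\ f y x (f x y T) = T.
  move=> sumxy; rewrite !inE => /andP[/eqP shT dT]; have sT := valP T.
  have [||bw' pw' dw' eqK] := @bk_wordP g1 g2 x y (word n (rows T)) _ _ dT.
  - exact: ballot_word.
  - by rewrite size_word.
  have [eqr eqw] := fE x y T bw' pw'; rewrite eqw dw' eqr andbT; split.
    by rewrite (perm_shape_tab pw') tab_word // shT.
  apply: val_inj => /=; have [||-> _] := fE y x (f x y T); rewrite eqw eqK ?tab_word //.
    exact: ballot_word.
  by rewrite perm_sym.
rewrite -(@card_in_imset _ _ (f a b)).
  by apply/subset_leq_card/subsetP=> _ /imsetP[T TK ->]; have [] := inP a b T sumg TK.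
apply: (@can_in_inj _ _ _ _ (f b a)) => T TK; by have [] := inP a b T sumg TK.
Qed.

Lemma perm_invariant (X : Type) (h : seq nat -> X) n :
  (forall s x y t, sumn (s ++ [:: x, y & t]) = n -> h (s ++ [:: x, y & t]) = h (s ++ [:: y, x & t])) ->
  forall s t, sumn s = n -> perm_eq s t -> h s = h t.
Proof.
move=> h_swap; suff h_cat s p t : sumn (p ++ s) = n -> perm_eq s t -> h (p ++ s) = h (p ++ t).
  by move=> s t; apply: (h_cat s [::] t).
elim: s p t => [|x s IHs] p t sum_s pst.
  by move: pst; rewrite perm_sym => /perm_nilP->.
have xt : x \in t by rewrite -(perm_mem pst) mem_head.
case/splitPr: t / xt pst => t1 t2 pst.
have pst' : perm_eq s (t1 ++ t2).
  by move: pst; rewrite -[x :: t2]cat1s perm_sym perm_catCA perm_cons perm_sym.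
rewrite -cat_rcons (IHs _ (t1 ++ t2)) // ?cat_rcons //.
have {pst sum_s} : sumn (p ++ x :: t1 ++ t2) = n.
  by rewrite -sum_s !sumn_cat /= (perm_sumn pst') sumn_cat.
elim/last_ind: t1 t2 {pst' IHs} => [//|t1 y IHt] t2 sum_t.
rewrite !cat_rcons in sum_t *; rewrite IHt // catA h_swap ?catA //.
by rewrite -sum_t !sumn_cat /= !sumn_cat /=; lia.
Qed.

Lemma card_kostka_perm n mu g g' : sumn g = n -> perm_eq g g' ->
  #|kostka_set n mu g| = #|kostka_set n mu g'|.
Proof.
apply: (perm_invariant (h := fun g => #|kostka_set n mu g|)) => s x y t sum_n.
apply/eqP; rewrite eqn_leq !kostka_swap_leq //.
by move: sum_n; rewrite !sumn_cat /=; lia.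
Qed.

Lemma kostka_superstd n (la : intpart n) :
  kostka_set n la la = [set superstd la].
Proof.
have /and3P[sla n0 /eqP sum_la] := valP la.
apply/setP=> T; rewrite !inE; apply/andP/eqP => [[/eqP shT dT]|->].
  apply: val_inj; rewrite /= superstd_rows_tab // -shT.
  rewrite -[in LHS](tab_word (valP T)) /= {1}(dec_blocks_sup (ballot_word (valP T))) tab_word ?(valP T) //=.
  by rewrite shT.
have := word_tab (sup la); rewrite size_sup sum_la => w_sup.
by rewrite /= superstd_rows_tab // shape_tab_sup // w_sup sup_dec_blocks.
Qed.

(** A numerical substitute for dominance order: a partition that strictly dominates another has the
    smaller rank. *)
Definition part_rank n (la : seq nat) : nat := \sum_(k < n.+1) (n - sumn (take k la)).

Lemma kostka_rank n (mu nu : intpart n) : kostka_set n mu nu != set0 ->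
  mu != nu -> part_rank n mu < part_rank n nu.
Proof.
have /and3P[_ mu0 /eqP sum_mu] := valP mu; have /and3P[_ nu0 /eqP sum_nu] := valP nu.
case/set0Pn=> T; rewrite !inE => /andP[/eqP shT dT] neq_mu.
have bw := ballot_word (valP T).
have dom k : sumn (take k nu) <= sumn (take k mu).
  have := dec_blocks_dominance bw _ dT k; rewrite (tab_word (valP T)) shT size_word.
  by apply.
have [k neq_k] : exists k : 'I_n.+1, sumn (take k nu) != sumn (take k mu).
  apply/existsP; apply: contraR neq_mu; rewrite negb_exists => /forallP eq_sums.
  have eq_sum k : sumn (take k nu) = sumn (take k mu).
    case: (ltnP k n.+1) => [lt_k|le_k]; first by have /negPn/eqP := eq_sums (Ordinal lt_k).
    by rewrite !take_oversize ?sum_nu // (leq_trans (size_part (valP _))) // ltnW.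
  apply/eqP/val_inj/eq_nth_part => // i.
  have sumS (s : seq nat) : sumn (take i.+1 s) = sumn (take i s) + nth 0 s i.
    case: (ltnP i (size s)) => [lt_i|le_i]; first by rewrite (take_nth 0) // sumn_rcons.
    by rewrite !take_oversize ?nth_default ?addn0 // leqW.
  by have := eq_sum i.+1; rewrite !sumS eq_sum => /addnI.
have le_n (la : intpart n) j : sumn (take j la) <= n.
  have /and3P[_ _ /eqP sum_la] := valP la.
  by rewrite -[X in _ <= X]sum_la -[X in _ <= sumn X](cat_take_drop j la) sumn_cat leq_addr.
rewrite /part_rank (bigD1 k) //= [X in _ < X](bigD1 k) //= -addSn leq_add //.
  have := dom k; have := le_n mu k; have := le_n nu k; move/eqP: neq_k; lia.
by apply: leq_sum => j _; apply: leq_sub2l.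
Qed.

(** * Semistandard tableaux and fundamental quasisymmetric functions *)

(* The order of the pairs (entry, row) of a semistandard tableau that gives its
   standardization: equal entries are read from the top row down. *)
Definition lex_le (x y : nat * nat) : bool :=
  (x.1 < y.1) || ((x.1 == y.1) && (y.2 <= x.2)).

Lemma lex_le_trans : transitive lex_le.
Proof. by move=> [b b'] [a a'] [c c']; rewrite /lex_le /=; lia. Qed.

Lemma lex_le_refl : reflexive lex_le.
Proof. by move=> [a a']; rewrite /lex_le /= eqxx leqnn orbT. Qed.

Lemma lex_le_anti : antisymmetric lex_le.
Proof. by move=> [a a'] [b b']; rewrite /lex_le /= => h; congr pair; lia. Qed.

Lemma lex_le_total : total lex_le.
Proof. by move=> [a a'] [b b']; rewrite /lex_le /=; lia. Qed.

(** A repeated value of [j] is allowed exactly where [rho] has no ascent, that is where the row does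
    not go up. *)
Lemma compatible_lex n (j rho : seq nat) : size j = n -> size rho = n ->
  compatible n (ascents rho) j = sorted lex_le (zip j rho).
Proof.
move=> szj szr; have szz : size (zip j rho) = n by rewrite size_zip szj szr minnn.
have nth_z i : nth (0, 0) (zip j rho) i = (nth 0 j i, nth 0 rho i).
  by rewrite nth_zip // szj szr.
apply/andP/(sortedP (0, 0)) => [[sj /allP comp] i|sz].
  rewrite szz => lt_i; rewrite !nth_z /lex_le /=.
  have : nth 0 j i <= nth 0 j i.+1 by apply: (sortedP 0 sj); rewrite szj.
  rewrite leq_eqVlt => /predU1P[eq_j|->//].
  apply/orP; right; rewrite eq_j eqxx /= leqNgt; apply/negP=> lt_r.
  have := comp i.+1; rewrite mem_iota /= eq_j eqxx mem_ascents szr lt_i /= lt_r.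
  by rewrite add1n (ltn_predK lt_i) lt_i => /(_ isT).
split.
  apply/(sortedP 0) => i; rewrite szj => lt_i; have := sz i; rewrite szz => /(_ lt_i).
  by rewrite !nth_z /lex_le /=; case: ltngtP.
apply/allP=> [[|i]]; rewrite mem_iota // => i_in; apply/implyP=> /= eq_j.
rewrite mem_ascents negb_and -leqNgt; apply/orP; right.
have := sz i; rewrite szz !nth_z /lex_le /= (eqP eq_j) eqxx ltnn /=; apply; lia.
Qed.

Definition fill (j : seq nat) (T : seq (seq nat)) : seq (seq nat) :=
  map (map (fun k => nth 0 j k.-1)) T.

Definition biword (t : seq (seq nat)) : seq (nat * nat) :=
  flatten [seq [seq (v, r) | v <- nth [::] t r] | r <- iota 0 (size t)].

Lemma nth_fill j T r : nth [::] (fill j T) r = [seq nth 0 j k.-1 | k <- nth [::] T r].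
Proof.
case: (ltnP r (size T)) => [lt_r|le_r]; first by rewrite (nth_map [::]).
by rewrite !nth_default // size_map.
Qed.

Lemma filter_biword t r : [seq x.1 | x <- biword t & x.2 == r] = nth [::] t r.
Proof.
suff H m a : [seq x.1 | x <- flatten [seq [seq (v, r') | v <- nth [::] t r'] | r' <- iota a m] & x.2 == r]
    = if a <= r < a + m then nth [::] t r else [::].
  by rewrite H /=; case: ltnP => // le_r; rewrite nth_default.
elim: m a => [|m IHm] a /=; first by rewrite addn0; case: ltngtP.
rewrite filter_cat map_cat IHm filter_map /preim /=; case: (eqVneq a r) => [->|neq_a].
  by rewrite ltnn leqnn addnS ltnS leq_addr filter_predT -map_comp map_id cats0.
by rewrite filter_pred0 /= addSnnS; congr (if _ then _ else _); lia.
Qed.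

Lemma zip_iota (j rho : seq nat) : size j = size rho ->
  zip j rho = [seq (nth 0 j k.-1, nth 0 rho k.-1) | k <- iota 1 (size rho)].
Proof.
move=> szj; apply: (@eq_from_nth _ (0, 0)); first by rewrite size_zip size_map size_iota szj minnn.
move=> i; rewrite size_zip szj minnn => lt_i.
by rewrite nth_zip // (nth_map 0) ?size_iota // nth_iota.
Qed.

Lemma biword_fill j rho : size j = size rho ->
  perm_eq (biword (fill j (tab rho))) (zip j rho).
Proof.
move=> szj; pose f k := (nth 0 j k.-1, nth 0 rho k.-1).
have -> : biword (fill j (tab rho)) = map f (flatten (tab rho)).
  rewrite /biword map_flatten {2}/tab -map_comp; congr flatten.
  rewrite !size_map size_iota; apply: eq_map => r /=.
  rewrite nth_fill nth_tab -map_comp; apply/eq_in_map => k /=.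
  by rewrite mem_posn /f => /andP[_ /eqP->].
rewrite (zip_iota szj); exact/perm_map/perm_flatten_tab.
Qed.

Lemma shape_fill j T : shape (fill j T) = shape T.
Proof. by rewrite /shape -map_comp; apply: eq_map => s /=; rewrite size_map. Qed.

Lemma fill_ssyt n (T : syt n) j : size j = n ->
  sorted lex_le (zip j (word n (rows T))) -> is_ssyt (fill j (rows T)).
Proof.
move=> szj sz; have /and4P[_ pT /allP sT /(sortedP [::]) colT] := valP T.
set rho := word n (rows T) in sz; have szr : size rho = n by rewrite size_word.
have szz : size (zip j rho) = n by rewrite size_zip szj szr minnn.
have le_j a b : 0 < a -> a <= b -> b <= n ->
    lex_le (nth 0 j a.-1, nth 0 rho a.-1) (nth 0 j b.-1, nth 0 rho b.-1).
  move=> a_gt0 le_ab le_b; rewrite -!nth_zip ?szj ?szr //.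
  by apply: (sorted_leq_nth lex_le_trans lex_le_refl) => //; rewrite ?inE ?szz; lia.
have in_T r k : k \in nth [::] (rows T) r -> (0 < k <= n) && (nth 0 rho k.-1 == r).
  by rewrite -(posn_word _ (valP T)) mem_posn size_word.
apply/andP; split.
  apply/allP=> _ /mapP[s sT' ->].
  have /(nthP [::])[r lt_r eq_s] := sT'.
  apply: (homo_sorted_in (P := mem s) (e := ltn)); [|exact/allP|exact/sT].
  move=> a b; rewrite /= -eq_s => /in_T/andP[/andP[a_gt0 _] _] /in_T/andP[/andP[_ le_b] _] lt_ab.
  by have := le_j a b a_gt0 (ltnW lt_ab) le_b; rewrite /lex_le /=; case: ltngtP.
apply/(sortedP [::]) => r; rewrite size_map => lt_r; apply/allP=> c; rewrite mem_iota add0n /=.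
rewrite !nth_fill size_map => lt_c.
have lt_c' : nth 0 (nth [::] (rows T) r) c < nth 0 (nth [::] (rows T) r.+1) c.
  by apply: (allP (colT r lt_r)); rewrite mem_iota add0n.
have lt_sz : c < size (nth [::] (rows T) r).
  apply: leq_trans lt_c _; rewrite -!(posn_word _ (valP T)) !size_posn.
  exact/ballot_count/ballot_word/(valP T).
rewrite !(nth_map 0) //.
have /andP[/andP[a_gt0 _] /eqP eq_a] := in_T r _ (mem_nth 0 lt_sz).
have /andP[/andP[_ le_b] /eqP eq_b] := in_T r.+1 _ (mem_nth 0 lt_c).
have := le_j _ _ a_gt0 (ltnW lt_c') le_b.
(* Equal values would require the later of the two cells not to be in the higher row. *)
by rewrite /lex_le /= eq_a eq_b ltnn andbF orbF.
Qed.

Lemma sorted_zip_lex (j rho j' rho' : seq nat) : size j = size rho -> size j' = size rho' ->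
  sorted lex_le (zip j rho) -> sorted lex_le (zip j' rho') ->
  perm_eq (zip j rho) (zip j' rho') -> j = j' /\ rho = rho'.
Proof.
move=> szj szj' sz sz' pz.
have eqz := sorted_eq lex_le_trans lex_le_anti sz sz' pz.
split; first by rewrite -(unzip1_zip (s := j) (t := rho)) ?szj // eqz unzip1_zip ?szj'.
by rewrite -(unzip2_zip (s := j) (t := rho)) ?szj // eqz unzip2_zip ?szj'.
Qed.

(** Standardization: sorting the pairs (entry, row) lists the entries in [j] and the rows in [rho],
    which is the word of the standard tableau. Within a row the order is that of [t], so filling
    with [j] gives back [t]. *)
Lemma ssyt_fill n (la : seq nat) t : is_part n la -> shape t = la -> is_ssyt t ->
  exists T : syt n, exists j : seq nat, [/\ size j = n, shape (rows T) = la,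
    sorted lex_le (zip j (word n (rows T))), {subset j <= flatten t} & fill j (rows T) = t].
Proof.
case/and3P=> sla n0 /eqP sum_la sht /andP[/allP row_t /(sortedP [::]) col_t].
pose L := sort lex_le (biword t); pose j := unzip1 L; pose rho := unzip2 L.
have permL : perm_eq L (biword t) by rewrite perm_sort.
have sL : sorted lex_le L by apply: sort_sorted lex_le_total _.
have zipL : zip j rho = L by rewrite zip_unzip.
have szj : size j = size rho by rewrite !size_map.
have memL v r : ((v, r) \in L) = (v \in nth [::] t r).
  rewrite (perm_mem permL); apply/flatten_mapP/idP => [[s _ /mapP[x xt [-> ->]]] //|vt].
  exists r; last by apply: map_f.
  by rewrite mem_iota add0n /= ltnNge; apply/negP=> le_r; rewrite nth_default in vt.
have homo_fst (s : seq (nat * nat)) : sorted lex_le s -> sorted leq (map fst s).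
  by apply: homo_sorted => x y; rewrite /lex_le; case: ltngtP.
have filterL r : [seq x.1 | x <- L & x.2 == r] = nth [::] t r.
  apply: (sorted_eq leq_trans anti_leq).
  - exact/homo_fst/(sorted_filter lex_le_trans).
  - case: (ltnP r (size t)) => [lt_r|le_r]; last by rewrite nth_default.
    exact/row_t/mem_nth.
  by rewrite -filter_biword; apply/perm_map/perm_filter.
have count_rho r : count_mem r rho = nth 0 la r.
  rewrite /rho count_map -size_filter -(size_map fst) filterL -sht.
  case: (ltnP r (size t)) => [lt_r|le_r]; first by rewrite (nth_map [::]).
  by rewrite !nth_default ?size_map.
have sh_rho : shape (tab rho) = la.
  rewrite -(shape_tab_sup sla n0); apply/perm_shape_tab/allP => r _ /=.
  by rewrite count_rho count_sup.
have sz_rho : size rho = n.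
  by rewrite -sum_la -sh_rho -size_flatten (perm_size (perm_flatten_tab rho)) size_iota.
have fillE : fill j (tab rho) = t.
  apply: (@eq_from_nth _ [::]) => [|r _].
    by have := congr1 size (shape_fill j (tab rho)); rewrite sh_rho -sht !size_map.
  rewrite nth_fill nth_tab -filterL -zipL (zip_iota szj) filter_map -map_comp.
  exact: eq_map.
have sT : is_syt n (tab rho).
  apply/and4P; split.
  - by rewrite sh_rho /is_part sla n0 sum_la eqxx.
  - by rewrite -sz_rho perm_flatten_tab.
  - by apply/allP=> _ /mapP[r _ ->]; apply: posn_sorted.
  apply/(sortedP [::]) => r lt_r; rewrite !nth_tab; apply/allP=> c.
  rewrite mem_iota add0n size_posn /= => lt_c.
  have lt_c' : c < count_mem r rho.
    rewrite (leq_trans lt_c) // !count_rho; apply: nth_geq_sorted => //.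
    by rewrite -sh_rho size_map.
  have lt_t : r.+1 < size t by rewrite -fillE size_map.
  have := allP (col_t r lt_t) c; rewrite mem_iota add0n -fillE !nth_fill !nth_tab size_map size_posn.
  move=> /(_ lt_c); rewrite !(nth_map 0) ?size_posn // => lt_j.
  rewrite ltnNge; apply/negP=> le_ba; move: lt_j; rewrite ltnNge => /negP[].
  have : nth 0 (posn r rho) c \in posn r rho by rewrite mem_nth ?size_posn.
  rewrite mem_posn => /andP[/andP[a_gt0 le_a] _].
  apply: (sorted_leq_nth leq_trans leqnn 0 (homo_fst _ sL)); rewrite ?inE.
  - rewrite -[size _]szj in le_a; have -> : size [seq i.1 | i <- L] = size j by [].
    by move: le_ba le_a a_gt0; rewrite szj; lia.
  - by have -> : size [seq i.1 | i <- L] = size j by []; rewrite szj (ltn_predK a_gt0).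
  by rewrite -!subn1 leq_sub2r.
exists (Syt sT), j; split=> //=; first by rewrite szj.
- by rewrite -sz_rho word_tab zipL.
- move=> v /mapP[[x r]]; rewrite memL /= => xt ->; apply/flattenP.
  exists (nth [::] t r) => //; apply: mem_nth.
  by rewrite ltnNge; apply/negP=> le_r; rewrite nth_default in xt.
Qed.

(** * The sign-reversing involution *)

Lemma size_leq_sumn (s : seq nat) : 0 \notin s -> size s <= sumn s.
Proof.
elim: s => //= x s IHs; rewrite inE negb_or eq_sym -lt0n => /andP[x_gt0 /IHs le_s].
by rewrite -add1n leq_add.
Qed.

Lemma slink_star_superstd n (T : syt n) : is_superstd (rows T) -> slink_star n (rows T) = rows T.
Proof.
move=> supT; rewrite /slink_star /first_bad; have bw := ballot_word (valP T).
have eqT := tab_word (valP T).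
have sw : sorted leq (word n (rows T)) by rewrite -(is_superstd_tab bw) eqT.
rewrite (eq_in_filter (a2 := pred0)) ?filter_pred0 // => j _.
rewrite /first_runs -{2}eqT trunc_tab // is_superstd_tab ?take_sorted //.
exact: ballot_take.
Qed.

(** The default [T] never replaces a different image: [slink_star] fixes superstandard tableaux, and
    [star_tab] treats all others. *)
Definition star n (T : syt n) : syt n := insubd T (slink_star n (rows T)).

Lemma star_tab n la B D i (T : syt n) : bad_form la B D -> star_row la B i ->
  rows T = tab (sup la ++ B ++ D) ->
  rows (star T) = tab (sup (star_la la B i) ++ star_run la B i ++ D).
Proof.
move=> bf si eqT; have szT := size_tab_word eqT.
have E : slink_star n (rows T) = tab (sup (star_la la B i) ++ star_run la B i ++ D).
  by rewrite eqT -{1}szT (slink_star_tab bf si) (relink_word_star bf si).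
rewrite /star /= val_insubd E.
have pw : perm_eq (sup (star_la la B i) ++ star_run la B i ++ D) (sup la ++ B ++ D).
  by rewrite (catA (sup la)) (catA (sup _) (star_run la B i)) perm_cat2r (perm_star_run bf si).
rewrite -{1}szT -(perm_size pw) is_syt_tab //.
by apply: bad_ballot (bad_form_star bf si).
Qed.

Lemma syt_cases n (T : syt n) : is_superstd (rows T) \/
  exists la B D i, [/\ bad_form la B D, star_row la B i & rows T = tab (sup la ++ B ++ D)].
Proof.
have [w [bw szw eqT]] := word_of_syt T.
have [[la n0 eq_w]|[la [B [D [bf eq_w]]]]] := sup_or_bad bw.
  by left; rewrite eqT is_superstd_tab // eq_w sup_sorted.
have [i si] := star_row_exists bf; right; exists la, B, D, i.
by rewrite eqT eq_w.
Qed.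

Lemma bad_not_superstd la B D : bad_form la B D -> ~~ is_superstd (tab (sup la ++ B ++ D)).
Proof.
move=> bf; rewrite is_superstd_tab; last exact: bad_ballot bf.
apply/negP; rewrite (sorted_pairwise leq_trans) catA pairwise_cat => /and3P[_ + _].
rewrite pairwise_cat -!(sorted_pairwise leq_trans) => /and3P[_ _].
have := bad_head bf; have /hasP[x] := bad_low bf.
case: (B) => //= y s; rewrite inE => /predU1P[->|xs] lt_x eq_y; first by rewrite eq_y ltnn in lt_x.
by move/(order_path_min leq_trans)/allP/(_ x xs); rewrite eq_y leqNgt lt_x.
Qed.

Lemma starK n : involutive (@star n).
Proof.
move=> T; have [supT|[la [B [D [i [bf si eqT]]]]]] := syt_cases T.
  have E : star T = T by apply: val_inj; rewrite /star /= val_insubd slink_star_superstd // (valP T).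
  by rewrite !E.
have eqT' := star_tab bf si eqT.
apply: val_inj; rewrite /= (star_tab (bad_form_star bf si) (star_row_star bf si) eqT') eqT.
by rewrite (star_la_star bf si) (star_run_star bf si).
Qed.

Lemma superstd_star n (T : syt n) : is_superstd (rows (star T)) = is_superstd (rows T).
Proof.
have [supT|[la [B [D [i [bf si eqT]]]]]] := syt_cases T.
  by rewrite /star /= val_insubd slink_star_superstd // supT; case: ifP.
rewrite (star_tab bf si eqT) eqT (negbTE (bad_not_superstd bf)).
exact/negbTE/(bad_not_superstd (bad_form_star bf si)).
Qed.

Lemma star_invariant k n (X : Type) (C : syt n -> X) : k <= 2 ->
  (forall T U, generator k T U -> C T = C U) -> forall T, C (star T) = C T.
Proof.
move=> le_k gen T; have [supT|[la [B [D [i [bf si eqT]]]]]] := syt_cases T.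
  by congr C; apply: val_inj; rewrite /star /= val_insubd slink_star_superstd // (valP T).
have eqT' := star_tab bf si eqT; have szT := size_tab_word eqT.
rewrite -(relink_word_star bf si) in eqT'.
case: k le_k gen => [|[|[|//]]] _ /= gen.
- by symmetry; apply: gen; rewrite eqT' eqT -szT (slink_star_tab bf si).
- symmetry; apply: (slink_invariant_star _ bf si eqT eqT') => la' B' D' T1 U1 bf' eqT1 eqU1.
  by apply: gen; rewrite eqU1 eqT1 -(size_tab_word eqT1) (slink_tab bf').
symmetry; apply: (slink_invariant_star _ bf si eqT eqT') => la' B' D' T1 U1.
apply: dR_invariant_slink => j T2 U2 j_in eqU2; apply: gen; apply/hasP; exists j; last exact/eqP.
by rewrite mem_filter j_in mem_iota; lia.
Qed.

(** * The Jacobi-Trudi determinant of the run lengths *)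

Import Num.Theory.

Local Open Scope ring_scope.

(* The determinant is the coefficient of h_beta, for beta = beta(T), in the
   Jacobi-Trudi expansion of s_la, the factors of each term being ordered by row. *)
Definition run_matrix n (la : seq nat) (T : seq (seq nat)) : 'M[int]_n :=
  \matrix_(r, c) ((beta n T r.+1 + c == nth 0%N la c + r)%N : nat)%:R.

Lemma size_nth_nil (ws : seq (seq nat)) r : size (nth [::] ws r) = nth 0%N (map size ws) r.
Proof.
case: (ltnP r (size ws)) => [lt_r|le_r]; first by rewrite (nth_map [::]).
by rewrite !nth_default ?size_map.
Qed.

Lemma beta_bad_form n la B D wsD (T : syt n) : bad_form la B D ->
  run_factors wsD -> flatten wsD = D -> rows T = tab (sup la ++ B ++ D) ->
  forall r, beta n (rows T) r.+1 = nth 0%N (la ++ size B :: map size wsD) r.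
Proof.
move=> bf rfD eqD eqT r; have rf := bad_run_factors bf rfD eqD.
rewrite eqT -{1}(size_tab_word eqT) -eqD.
have -> : sup la ++ B ++ flatten wsD = flatten (blocks la ++ B :: wsD) by rewrite flatten_cat.
rewrite beta_tab //= -[size B :: _]/(map size (B :: wsD)) -{2}(map_size_blocks la) -map_cat.
exact: size_nth_nil.
Qed.

Lemma run_matrix_star n lam (T : syt n) : ~~ is_superstd (rows T) ->
  \det (run_matrix n lam (rows (star T))) = - \det (run_matrix n lam (rows T)).
Proof.
have [->//|[la [B [D [i [bf si eqT]]]]] _] := syt_cases T.
have eqT' := star_tab bf si eqT; have bf' := bad_form_star bf si.
have [wsD rfD eqD] := run_factors_exist D.
have szT := size_tab_word eqT.
have lt_kn : (size la < n)%N.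
  rewrite -szT size_cat size_sup size_cat; have := size_leq_sumn (bad_pos bf).
  have := bad_run_gt0 bf; lia.
have lt_in : (i < n)%N := ltn_trans (star_lt si) lt_kn.
(* Row [r] of the matrix depends only on beta_r - r, and slink_* exchanges two of these numbers. *)
have -> : run_matrix n lam (rows (star T)) =
    xrow (Ordinal lt_in) (Ordinal lt_kn) (run_matrix n lam (rows T)).
  apply/matrixP=> r c; rewrite /xrow !mxE.
  rewrite (beta_bad_form bf' rfD eqD eqT') (beta_bad_form bf rfD eqD eqT).
  have part_eq : (star_part la B i + size la = size B + i)%N := star_partE si.
  have sz_run : (size (star_run la B i) + star_part la B i = size B + nth 0 la i)%N := size_star_run bf si.
  have lt_i := star_lt si.
  rewrite !nth_cat (size_star_la si) nth_star_la; congr (nat_of_bool _)%:R.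
  case: tpermP => [->|->|/eqP neq_i /eqP neq_k] /=.
  - rewrite lt_i ltnn subnn eqxx /=; apply/eqP/eqP; lia.
  - rewrite ltnn lt_i subnn /=; apply/eqP/eqP; lia.
  rewrite -!val_eqE /= in neq_i neq_k; rewrite (negbTE neq_i).
  case: ltngtP neq_k => // lt_kr _; rewrite -[(r - size la)%N]prednK ?subn_gt0 //.
rewrite /xrow row_permE det_mulmx det_perm odd_tperm.
by rewrite -val_eqE /= (ltn_eqF (star_lt si)) expr1 mulN1r.
Qed.

Lemma run_matrix_superstd n (lam nu : intpart n) :
  \det (run_matrix n lam (rows (superstd nu))) = (nu == lam)%:R.
Proof.
have /and3P[snu nu0 /eqP sum_nu] : is_part n nu := valP nu.
have /and3P[slam lam0 _] : is_part n lam := valP lam.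
have betaE r : beta n (rows (superstd nu)) r.+1 = nth 0%N nu r.
  rewrite /= superstd_rows_tab //; have := @beta_tab _ (run_factors_blocks nu0) r.+1 isT.
  rewrite -/(sup nu) size_sup sum_nu => ->; rewrite -[in RHS](map_size_blocks nu) /=.
  exact: size_nth_nil.
have mxE' r c : run_matrix n lam (rows (superstd nu)) r c = (nth 0%N nu r + c == nth 0%N lam c + r)%N%:R.
  by rewrite mxE betaE.
have le_nth (s : seq nat) a b : sorted geq s -> (a <= b)%N -> (nth 0%N s b <= nth 0%N s a)%N.
  move=> ss le_ab; case: (ltnP b (size s)) => [lt_b|le_b]; first exact: nth_geq_sorted.
  by rewrite nth_default.
have [eq_nu|neq_nu] := eqVneq nu lam.
  rewrite -(det1 int n); congr (\det _); apply/matrixP=> r c; rewrite mxE' mxE eq_nu.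
  congr (nat_of_bool _)%:R; rewrite -val_eqE /=.
  case: (ltngtP r c) => [lt_rc|lt_cr|->]; last exact: eqxx.
    by have le_rc := le_nth _ _ _ slam (ltnW lt_rc); apply/negbTE/eqP; lia.
  by have le_rc := le_nth _ _ _ slam (ltnW lt_cr); apply/negbTE/eqP; lia.
pose P r := (nth 0 nu r != nth 0 lam r)%N.
have exP : exists r, P r.
  case: (boolP [exists r : 'I_n, P r]) => [/existsP[r Pr]|]; first by exists r.
  rewrite negb_exists => /forallP eq_nth; case/eqP: neq_nu; apply/val_inj/eq_nth_part => // r.
  case: (ltnP r n) => [lt_r|le_r]; first by have /negPn/eqP := eq_nth (Ordinal lt_r).
  by rewrite !nth_default // (leq_trans (size_part (valP _))).
case: (ex_minnP exP) => r Pr min_r.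
have eq_nth s : (s < r)%N -> nth 0%N nu s = nth 0%N lam s.
  by move=> lt_s; apply/eqP/negPn/negP=> /min_r; rewrite leqNgt lt_s.
have lt_r : (r < n)%N.
  rewrite ltnNge; apply/negP=> le_r; case/eqP: Pr.
  by rewrite !nth_default // (leq_trans (size_part (valP _))).
(* The shifted parts decrease strictly in both partitions and agree before [r]. The larger of the
   two values at [r] is therefore missing in the other sequence, so column [r] or row [r] of the
   matrix vanishes. *)
rewrite /P in Pr; case: (ltngtP (nth 0%N nu r) (nth 0%N lam r)) Pr => // [lt_nu|gt_nu] _.
  rewrite (expand_det_col _ (Ordinal lt_r)) big1 // => s _; rewrite mxE' /=.
  suff /negbTE-> : (nth 0 nu s + r != nth 0 lam r + s)%N by rewrite mul0r.
  apply/eqP; case: (ltnP s r) => [lt_s|le_s].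
    by rewrite eq_nth //; have := le_nth _ _ _ slam (ltnW lt_s); lia.
  by have := le_nth _ _ _ snu le_s; lia.
rewrite (expand_det_row _ (Ordinal lt_r)) big1 // => s _; rewrite mxE' /=.
suff /negbTE-> : (nth 0 nu r + s != nth 0 lam s + r)%N by rewrite mul0r.
apply/eqP; case: (ltnP s r) => [lt_s|le_s].
  by rewrite -eq_nth //; have := le_nth _ _ _ snu (ltnW lt_s); lia.
by have := le_nth _ _ _ slam le_s; lia.
Qed.

(** * Coefficients of a symmetric combination of fundamental functions *)

(** Forward substitution by rank: adding the defect to [d] in rank [k] settles the equations of rank
    [k] and does not affect those of lower rank. *)
Lemma unitriangular_solve (I : finType) (K : I -> I -> int) (r : I -> nat) :
  (forall i, K i i = 1) -> (forall i j, K i j != 0 -> i != j -> (r i < r j)%N) ->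
  forall m : I -> int, exists d : I -> int, forall j, m j = \sum_i d i * K i j.
Proof.
move=> K1 Kr m.
suff [d eq_d] : exists d : I -> int, forall j, (r j < \max_j (r j).+1)%N -> m j = \sum_i d i * K i j.
  by exists d => j; apply: eq_d; apply: (bigmax_sup j).
elim: (\max_j _)%N => [|k [d eq_d]]; first by exists (fun _ => 0).
exists (fun i => d i + (if r i == k then m i - \sum_i' d i' * K i' i else 0)) => j.
under eq_bigr do rewrite mulrDl; rewrite big_split /= ltnS leq_eqVlt => /predU1P[eq_k|lt_k].
  rewrite [X in _ + X](bigD1 j) //= eq_k eqxx K1 mulr1 [X in _ + (_ + X)]big1 => [|i neq_i].
    by rewrite addr0 addrC subrK.
  case: eqP => [eq_i|_]; last by rewrite mul0r.
  have [->|nz] := eqVneq (K i j) 0; first by rewrite mulr0.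
  by have := Kr i j nz neq_i; rewrite eq_i eq_k ltnn.
rewrite [X in _ + X]big1 ?addr0 => [|i _]; first exact: eq_d.
case: eqP => [eq_i|_]; last by rewrite mul0r.
have [->|nz] := eqVneq (K i j) 0; first by rewrite mulr0.
have neq_i : i != j by apply/eqP=> eq_ij; rewrite -eq_i eq_ij ltnn in lt_k.
by have := Kr i j nz neq_i; rewrite eq_i ltnNge (ltnW lt_k).
Qed.

Definition idset n (T : syt n) : {set 'I_n} := [set i : 'I_n | (i : nat) \in ID n (rows T)].

Lemma ID_word_syt n (T : syt n) : ID n (rows T) = ascents (word n (rows T)).
Proof. by rewrite -ID_tab size_word tab_word ?(valP T). Qed.

Lemma idset_subset n (T U : syt n) : (idset T \subset idset U) =
  all (mem (ID n (rows U))) (ID n (rows T)).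
Proof.
apply/subsetP/allP => sub i; last by rewrite !inE => /sub.
move=> iT; have lt_i : (i < n)%N.
  by move: iT; rewrite ID_word_syt mem_ascents size_word => /andP[/andP[]].
by have := sub (Ordinal lt_i); rewrite !inE; apply.
Qed.

Lemma idset_eq n (T U : syt n) : idset T = idset U -> ID n (rows T) = ID n (rows U).
Proof.
move=> eqTU; have sub (V W : syt n) : idset V = idset W -> {subset ID n (rows V) <= ID n (rows W)}.
  by move=> eqVW; apply/allP; have := idset_subset V W; rewrite eqVW subxx => /esym.
apply: (irr_sorted_eq (leT := ltn)); first exact: ltn_trans.
- exact: ltnn.
- by rewrite ID_word_syt; apply/(sorted_filter ltn_trans)/iota_ltn_sorted.
- by rewrite ID_word_syt; apply/(sorted_filter ltn_trans)/iota_ltn_sorted.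
by move=> i; apply/idP/idP; apply: sub.
Qed.

(** The composition [g] is beta(U), whose proper partial sums are the inverse descents of [U]. *)
Lemma dec_blocks_idset n (U : syt n) : exists g : seq nat,
  [/\ 0%N \notin g, sumn g = n &
      forall T : syt n, dec_blocks g (word n (rows T)) = (idset T \subset idset U)].
Proof.
have [ws rf eq_w] := run_factors_exist (word n (rows U)).
have [_ n0 _] := and3P rf.
exists (map size ws); split.
- by apply: contra n0 => /mapP[s sws /esym/size0nil s0]; rewrite -s0.
- by rewrite -size_flatten eq_w size_word.
move=> T; rewrite idset_subset !ID_word_syt.
have [|h1 h2] := @dec_blocks_run_factors ws (word n (rows T)) rf; first by rewrite eq_w !size_word.
by apply/idP/allP; rewrite -eq_w.
Qed.

(** * Moebius inversion over inverse descent sets *)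

Section Moebius.

Variables (n : nat) (z : syt n -> int).
Hypothesis z0 : forall g : seq nat, 0%N \notin g -> sumn g = n ->
  \sum_T z T *+ dec_blocks g (word n (rows T)) = 0.

(** Induction on the size of [D]: the sum over all [T] with [idset T] inside [D] vanishes by [z0],
    and proper subsets contribute 0. If [D] is not the set of any tableau, the sum is empty. *)
Lemma idset_sum0 (D : {set 'I_n}) : \sum_(T | idset T == D) z T = 0.
Proof.
have [m] := ubnP #|D|; elim: m D => // m IHm D; rewrite ltnS => le_D.
have [/existsP[U /eqP eqU]|] := boolP [exists U : syt n, idset U == D]; last first.
  rewrite negb_exists => /forallP no_T; rewrite big_pred0 // => T; exact/negbTE.
have [g [g0 sum_g dec_g]] := dec_blocks_idset U.
have := z0 g0 sum_g; under eq_bigr do rewrite dec_g eqU mulrb.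
rewrite -big_mkcond (partition_big (@idset n) (fun D' => D' \subset D)) //=.
rewrite (bigD1 D) //= [X in _ + X]big1 => [|D' /andP[sub_D neq_D]].
  rewrite addr0 => eq0; rewrite -[RHS]eq0; apply: eq_bigl => T; case: eqP => [->|]; rewrite ?subxx ?andbF //.
have := IHm D'; rewrite (leq_trans _ le_D) => [/(_ isT) eq0|].
  by rewrite -[RHS]eq0; apply: eq_bigl => T; apply: andb_idl => /eqP->.
by apply: proper_card; rewrite properEneq neq_D.
Qed.

(** Applied both to the determinants, with integer values, and to the fundamental functions, with
    polynomial values; hence the general group [V]. *)
Lemma idset_sum (V : zmodType) (g : syt n -> V) :
  (forall T U, idset T = idset U -> g T = g U) -> \sum_T g T *~ z T = 0.
Proof.
move=> g_id; rewrite (partition_big (@idset n) xpredT) //= big1 // => D _.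
have [/existsP[U /eqP eqU]|] := boolP [exists U : syt n, idset U == D]; last first.
  rewrite negb_exists => /forallP no_T; rewrite big_pred0 // => T; exact/negbTE.
under eq_bigr => T /eqP eqT do rewrite (g_id T U) ?eqU //.
by rewrite -mulrz_sumr idset_sum0.
Qed.

End Moebius.

Lemma star_sum n (z : syt n -> int) (lam : intpart n) : (forall T, z (star T) = z T) ->
  \sum_T z T * \det (run_matrix n lam (rows T)) = z (superstd lam).
Proof.
move=> z_star; rewrite (bigID (fun T => is_superstd (rows T))) /=.
rewrite [X in _ + X](_ : _ = 0) ?addr0; last first.
  set S := (X in X = 0); have : S = - S.
    rewrite {1}/S (reindex_inj (inv_inj (@starK n))) /= -sumrN.
    apply: eq_big => [T|T nT]; first by rewrite superstd_star.
    by rewrite superstd_star in nT; rewrite z_star (run_matrix_star _ nT) mulrN.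
  by move/eqP; rewrite -subr_eq0 opprK -mulr2n mulrn_eq0 /= => /eqP.
have sup_lam (nu : intpart n) : is_superstd (rows (superstd nu)).
  have /and3P[snu nu0 _] : is_part n nu := valP nu.
  by rewrite /= superstd_rows_tab // is_superstd_tab ?sup_sorted //; apply: ballot_sup.
rewrite (bigD1 (superstd lam)) ?sup_lam // run_matrix_superstd eqxx mulr1 big1 => [|T]; first exact: addr0.
case/andP=> supT neqT.
have shP : is_part n (shape (rows T)) by have /and4P[] := valP T.
have eqT : T = superstd (IntPart shP) by apply: val_inj; apply/eqP.
rewrite eqT run_matrix_superstd; suff /negbTE-> : IntPart shP != lam by rewrite mulr0.
by apply: contra neqT => /eqP <-; rewrite -eqT.
Qed.

Definition shape_part n (T : syt n) : intpart n := IntPart (let: And4 h _ _ _ := and4P (valP T) in h).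

Theorem schur_coefficients n (C : syt n -> int) : (forall T, C (star T) = C T) ->
  (forall g g' : seq nat, 0%N \notin g -> sumn g = n -> perm_eq g g' ->
     \sum_T C T *+ dec_blocks g (word n (rows T)) =
     \sum_T C T *+ dec_blocks g' (word n (rows T))) ->
  forall (V : zmodType) (F : syt n -> V), (forall T U, idset T = idset U -> F T = F U) ->
  \sum_T F T *~ C T = \sum_T F T *~ C (superstd (shape_part T)).
Proof.
move=> C_star C_sym V F F_id.
pose cf g := \sum_T C T *+ dec_blocks g (word n (rows T)).
have [||d eq_d] := @unitriangular_solve _ (fun mu nu : intpart n => #|kostka_set n mu nu|%:R)
    (part_rank n) _ _ (fun nu : intpart n => cf nu).
- by move=> mu; rewrite kostka_superstd cards1.
- move=> mu nu; rewrite pnatr_eq0 cards_eq0; exact: kostka_rank.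
(* The difference of the two combinations, tableau by tableau. It is again constant under [star],
   which preserves shapes. *)
pose z T := C T - d (shape_part T).
have z_sum g : 0%N \notin g -> sumn g = n ->
    \sum_T z T *+ dec_blocks g (word n (rows T)) = 0.
  move=> g0 sum_g; have perm_g : perm_eq g (sort geq g) by rewrite perm_sym perm_sort.
  have part_g : is_part n (sort geq g).
    by rewrite /is_part sort_sorted ?mem_sort ?g0 -?(perm_sumn perm_g) ?sum_g ?eqxx // => x y; apply: leq_total.
  have := eq_d (IntPart part_g); rewrite /cf /= -(C_sym _ _ g0 sum_g perm_g).
  under [in RHS]eq_bigr do rewrite -(card_kostka_perm _ sum_g perm_g).
  move=> eq_cf; under eq_bigr do rewrite mulrnBl; rewrite sumrB eq_cf; apply/eqP.
  rewrite subr_eq0; apply/eqP; rewrite [RHS](partition_big (@shape_part n) xpredT) //=.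
  apply: eq_bigr => mu _; rewrite -sum1_card natr_sum mulr_sumr.
  rewrite big_mkcond [RHS]big_mkcond; apply: eq_bigr => T _; rewrite inE mulr1.
  have -> : (shape_part T == mu) = (shape (rows T) == mu) by [].
  by case: eqP => [eq_mu|//]; case: dec_blocks; rewrite //= (_ : shape_part T = mu) //; apply: val_inj.
have z_star T : z (star T) = z T.
  rewrite /z C_star; congr (_ - d _); apply: val_inj => /=.
  have [supT|[la [B [D [i [bf si eqT]]]]]] := syt_cases T.
    by rewrite /star /= val_insubd slink_star_superstd // (valP T).
  rewrite (star_tab bf si eqT) eqT; apply: perm_shape_tab.
  by rewrite (catA (sup _)) (catA (sup la)) perm_cat2r (perm_star_run bf si).
(* The sum of [z] against the determinants is evaluated twice: by [star_sum] it is the value of [z]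
   at [U_lam], and it is 0 because the determinant depends on ID(T) only. *)
have z_sup lam : z (superstd lam) = 0.
  rewrite -(star_sum lam z_star).
  rewrite -[RHS](idset_sum z_sum (g := fun T => \det (run_matrix n lam (rows T)))).
    by apply: eq_bigr => T _; rewrite -mulrzr intz mulrC.
  move=> T U /idset_eq eqID; congr (\det _); apply/matrixP=> r c.
  by rewrite !mxE /beta /run_end /run_ends eqID.
have C_sup lam : C (superstd lam) = d lam.
  have /eqP := z_sup lam; rewrite subr_eq0 => /eqP->; congr d; apply: val_inj => /=.
  have /and3P[snu nu0 _] : is_part n lam := valP lam.
  by rewrite superstd_rows_tab // shape_tab_sup.
have := idset_sum z_sum F_id; under eq_bigr do rewrite mulrzBr.
rewrite sumrB => /eqP; rewrite subr_eq0 => /eqP->; apply: eq_bigr => T _.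
by rewrite C_sup.
Qed.

(** * Expansions of symmetric polynomials *)

Lemma exists_tuple N n (s : seq nat) : size s = n -> all (gtn N) s ->
  exists j : n.-tuple 'I_N, map val j = s.
Proof.
move=> szs lt_s; have eq_s : map val (pmap insub s : seq 'I_N) = s.
  rewrite pmap_filter; last exact: insubK.
  apply/all_filterP/allP => x /(allP lt_s) /= lt_x.
  by case: insubP => //; rewrite lt_x.
have szj : size (pmap insub s : seq 'I_N) == n by rewrite -(size_map val) eq_s szs.
by exists (Tuple szj).
Qed.

Lemma val_tuple_inj N n (j j' : n.-tuple 'I_N) : map val j = map val j' -> j = j'.
Proof. by move=> /(inj_map val_inj) eq_j; apply: val_inj. Qed.

Lemma prodX_tuple N n (j : n.-tuple 'I_N) :
  \prod_(k < n) 'X_(tnth j k) = 'X_[[multinom count_mem (i : nat) (map val j) | i < N]]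
    :> {mpoly int[N]}.
Proof.
rewrite mprodXE; congr 'X_[_]; apply/mnmP=> i; rewrite mnm_sumE mnmE count_map.
rewrite -sum1_count big_tuple [RHS]big_mkcond /=; apply: eq_bigr => k _.
by rewrite mnm1E -val_eqE /=; case: eqP.
Qed.

Lemma compatible_sup n (g rho : seq nat) : 0%N \notin g -> sumn g = n -> size rho = n ->
  compatible n (ascents rho) (sup g) = dec_blocks g rho.
Proof.
move=> g0 sum_g szr; rewrite /compatible sup_sorted /=.
have [|h1 h2] := @dec_blocks_run_factors (blocks g) rho (run_factors_blocks g0).
  by rewrite -/(sup g) size_sup sum_g.
rewrite map_size_blocks -/(sup g) in h1 h2; have szg := size_sup g; rewrite sum_g in szg.
apply/allP/idP => [comp|/h1 sub a a_in].
  apply: h2 => a a_asc; move: (a_asc); rewrite !mem_ascents szr szg => /andP[a_in _].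
  rewrite a_in /= ltn_neqAle; apply/andP; split; last first.
    by apply: (sorted_leq_nth leq_trans leqnn 0%N (sup_sorted g)); rewrite ?inE ?szg; lia.
  have := comp a; rewrite a_asc implybF mem_iota; apply.
  by move: a_in; lia.
apply/implyP=> /eqP eq_a; apply/negP=> /sub; rewrite mem_ascents eq_a ltnn andbF //.
Qed.

(** The only weakly increasing index sequence with content [g] is [sup g], so a single term can
    contribute. *)
Lemma mcoeff_fundamental n (T : syt n) (g : seq nat) : 0%N \notin g -> sumn g = n ->
  (fundamental n (ID n (rows T)) (size g))@_[multinom nth 0%N g i | i < size g] =
  (dec_blocks g (word n (rows T)))%:R.
Proof.
move=> g0 sum_g; rewrite /fundamental raddf_sum /= ID_word_syt.
rewrite -(compatible_sup g0 sum_g (size_word _ _)).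
have szg : size (sup g) = n by rewrite size_sup.
have [|j0 eq_j0] := @exists_tuple (size g) n (sup g) szg.
  apply/allP=> x; rewrite -has_pred1 has_count count_sup /= => nz.
  by rewrite ltnNge; apply/negP=> le_x; rewrite nth_default in nz.
rewrite -eq_j0 big_mkcond (bigD1 j0) //= [X in _ + X]big1 => [|j neq_j].
  rewrite addr0 prodX_tuple mcoeffX; case: compatible => //.
  rewrite (_ : _ == _) //; apply/eqP/mnmP=> i; by rewrite !mnmE eq_j0 count_sup.
case: ifP => // /andP[sj _]; rewrite prodX_tuple mcoeffX.
suff /negbTE-> : [multinom count_mem (i : nat) (map val j) | i < size g] !=
    [multinom nth 0%N g i | i < size g] by [].
apply: contra neq_j => /eqP/mnmP eq_m; apply/eqP/val_tuple_inj; rewrite eq_j0.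
apply: (sorted_eq leq_trans anti_leq sj (sup_sorted g)).
apply/allP=> r _ /=; rewrite count_sup; apply/eqP.
case: (ltnP r (size g)) => [lt_r|le_r]; first by have := eq_m (Ordinal lt_r); rewrite !mnmE.
rewrite nth_default //; apply/count_memPn/mapP=> -[i _ eq_r].
by move: le_r; rewrite eq_r leqNgt ltn_ord.
Qed.

Lemma symmetric_mcoeff_perm N (p : {mpoly int[N]}) (g g' : seq nat) :
  p \is symmetric -> size g = N -> perm_eq g g' ->
  p@_[multinom nth 0%N g i | i < N] = p@_[multinom nth 0%N g' i | i < N].
Proof.
move=> symp szg pg; have szg' : size g' == N by rewrite -(perm_size pg) szg.
move/eqP: szg => szg; have /tuple_permP[s eq_s] : perm_eq (Tuple szg) (Tuple szg') by [].
have /issymP/(_ s) symps := symp; rewrite -[in RHS]symps mcoeff_sym; congr (_@__).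
apply/mnmP=> i; rewrite !mnmE (eq_s : g = _).
by rewrite -tnth_nth tnth_mktuple (tnth_nth 0%N).
Qed.

(** A pair of a standard [T] and a compatible [j] is sent to the filling of [T] by [j]. This is onto
    by [ssyt_fill], and injective because the filling determines the multiset of pairs (entry, row),
    whose sorted form is [j] with the word of [T]. *)
Lemma schur_fundamental n (la : intpart n) N :
  schur la N = \sum_(T : syt n | shape (rows T) == la) fundamental n (ID n (rows T)) N.
Proof.
pose Xp (j : n.-tuple 'I_N) : {mpoly int[N]} := \prod_(k < n) 'X_(tnth j k).
rewrite /schur /fundamental pair_big_dep /=.
pose P (x : syt n * n.-tuple 'I_N) :=
  (shape (rows x.1) == la) && compatible n (ID n (rows x.1)) (map val x.2).
have lexP x : P x = (shape (rows x.1) == la) &&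
    sorted lex_le (zip (map val x.2) (word n (rows x.1))).
  by rewrite /P ID_word_syt compatible_lex ?size_map ?size_tuple ?size_word.
pose J (x : syt n * n.-tuple 'I_N) := map val x.2; have szJ x : size (J x) = n.
  by rewrite size_map size_tuple.
have perm_fill x : perm_eq (flatten (fill (J x) (rows x.1))) (J x).
  have /and4P[_ pT _ _] := valP x.1.
  rewrite /fill -map_flatten (perm_trans (perm_map _ pT)) //.
  rewrite (_ : map _ _ = J x) //; apply: (@eq_from_nth _ 0%N).
    by rewrite size_map size_iota szJ.
  by move=> i; rewrite size_map size_iota => lt_i; rewrite (nth_map 0%N) ?size_iota // nth_iota.
have ex_h x : exists w : n.-tuple 'I_N, map val w == flatten (fill (J x) (rows x.1)).
  have [||w eq_w] := @exists_tuple N n (flatten (fill (J x) (rows x.1))).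
  - by rewrite (perm_size (perm_fill x)).
  - by apply/allP=> v; rewrite (perm_mem (perm_fill x)) => /mapP[i _ ->]; apply: ltn_ord.
  by exists w; apply/eqP.
pose h x := xchoose (ex_h x); have hE x := eqP (xchooseP (ex_h x)).
have reshapeE x : P x -> reshape la (map val (h x)) = fill (J x) (rows x.1).
  by move=> /andP[/eqP sh _]; rewrite hE -sh -(shape_fill (J x)) flattenK.
have h_inj : {in [set x | P x] &, injective h}.
  move=> x y; rewrite !inE => Px Py eq_h.
  have := reshapeE x Px; rewrite eq_h (reshapeE y Py) => eq_f.
  move: (Px) (Py); rewrite !lexP => /andP[_ sx] /andP[_ sy].
  have [|||eqJ eqW] := sorted_zip_lex _ _ sx sy; rewrite ?szJ ?size_word //.
    have biw z : perm_eq (biword (fill (J z) (rows z.1))) (zip (J z) (word n (rows z.1))).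
      by rewrite -{1}(tab_word (valP z.1)) biword_fill // szJ size_word.
    by rewrite -(permPl (biw x)) -eq_f biw.
  case: x y eqJ eqW {Px Py eq_h eq_f sx sy} => T j [T' j'] /= /val_tuple_inj-> eqW.
  congr pair; apply: val_inj => /=.
  by rewrite -(tab_word (valP T)) eqW tab_word // (valP T').
rewrite (eq_bigl (mem [set h x | x in [set x | P x]])) => [|w /=].
  rewrite big_imset //=; apply: eq_big => [x|x _]; first by rewrite inE.
  rewrite !prodX_tuple; congr 'X_[_]; apply/mnmP=> i; rewrite !mnmE hE.
  exact: (permP (perm_fill x)).
have laP : is_part n la := valP la; have sum_la : sumn la = n by case/and3P: laP => _ _ /eqP.
have szw : size (map val w) = n by rewrite size_map size_tuple.
apply/idP/imsetP => [w_ssyt|[x]]; last first.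
  rewrite inE => Px ->; rewrite reshapeE //; move: Px; rewrite lexP => /andP[_].
  exact: fill_ssyt (szJ x).
have [|T [j [szj shT sj sub_j fillE]]] := ssyt_fill laP _ w_ssyt.
  by rewrite reshapeKl ?szw ?sum_la.
have eq_w : flatten (fill j (rows T)) = map val w by rewrite fillE reshapeKr ?szw ?sum_la.
have [|t eq_t] := @exists_tuple N n j szj.
  by apply/allP=> v /sub_j; rewrite reshapeKr ?szw ?sum_la // => /mapP[i _ ->]; apply: ltn_ord.
exists (T, t); first by rewrite inE lexP /= shT eqxx eq_t.
by apply: val_tuple_inj; rewrite hE /J /= eq_t.
Qed.

Lemma big_count (V : nmodType) (I : finType) (s : seq I) (F : I -> V) :
  \sum_(x <- s) F x = \sum_x F x *+ count_mem x s.
Proof.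
elim: s => [|y s IHs]; first by rewrite big_nil big1.
rewrite big_cons IHs /=; under [RHS]eq_bigr do rewrite mulrnDr.
rewrite big_split /=; congr (_ + _); rewrite (bigD1 y) //= eqxx big1 ?addr0 // => x.
by rewrite eq_sym => /negbTE->.
Qed.

Lemma union_of_classes_generator k n (C : multiset (syt n)) (T U : syt n) :
  union_of_classes k C -> generator k T U -> C T = C U.
Proof.
move=> [Ks [classKs C_count]] gTU; rewrite !C_count; apply: eq_in_count => K /classKs[T0 ->].
rewrite !inE; apply: same_connect_r; last by apply: connect1; rewrite /= gTU.
by apply: sym_connect_sym => x y /=; rewrite orbC.
Qed.

Theorem theorem1p1 (k n : nat) (hk : (k <= 2)%N) (hn : (1 <= n)%N)
  (C : multiset (syt n)) (hC : union_of_classes k C)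
  (f : series)
  (hf : forall N, f N = \sum_(T <- C) fundamental n (ID n (rows T)) N)
  (hsym : symfun f) :
  forall N, f N = \sum_(la : intpart n) schur la N *+ C (superstd la).
Proof.
have fE N : f N = \sum_T fundamental n (ID n (rows T)) N *+ C T.
  by rewrite hf big_count; under eq_bigr do rewrite count_mem_mset.
have C_star (T : syt n) : ((C (star T))%:Z = (C T)%:Z)%R.
  congr Posz; apply: (star_invariant (C := fun T => C T) hk) => U V.
  exact: union_of_classes_generator hC.
(* With one variable per part of [g], a permutation of [g] stays in the same polynomial ring, where
   the symmetry of [f (size g)] applies. *)
have coefE g : 0%N \notin g -> sumn g = n ->
    \sum_(T : syt n) (C T)%:Z *+ dec_blocks g (word n (rows T)) =
    (f (size g))@_[multinom nth 0%N g i | i < size g].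
  move=> g0 sum_g; rewrite fE raddf_sum /=; apply: eq_bigr => T _.
  by rewrite mcoeffMn mcoeff_fundamental // -[(C T)%:Z]natz -!mulrnA mulnC.
move=> N; rewrite fE.
have := @schur_coefficients n (fun T => (C T)%:Z) C_star.
move=> /(_ _ _ (fun T => fundamental n (ID n (rows T)) N)) => -> .
- rewrite (partition_big (@shape_part n) xpredT) //=; apply: eq_bigr => la _.
  rewrite schur_fundamental -sumrMnl; apply: eq_big => [T|T /eqP <-] //.
- move=> g g' g0 sum_g pg; rewrite !coefE -?(perm_sumn pg) -?(perm_mem pg) //.
  by rewrite -(perm_size pg); apply: symmetric_mcoeff_perm (hsym _) erefl pg.
by move=> T U /idset_eq ->.
Qed.
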